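(* Let $\Omega\subseteq\mathbf{R}^n$ be an open set, let $\mathfrak{V}$ be a linear subspace of $\mathcal{L}(\mathbf{R}^n,\mathbf{R}^m)$, and let $\mathcal{M}=\Omega\times\mathfrak{V}$, so that $$\Sigma(\mathcal{M})=\left\{F\in C^1(\Omega,\mathbf{R}^m)\;\middle|\;\forall x\in\Omega\;\;DF(x)\in\mathfrak{V}\right\}.$$ Then $\Sigma(\mathcal{M})$ is a vector space, which is finite dimensional if and only if $\delta(\mathfrak{V})<\infty$. In this case (that is, when $\delta(\mathfrak{V})<\infty$), $\Sigma(\mathcal{M})$ coincides with the set of restrictions to $\Omega$ of elements of $\mathcal{P}(\mathfrak{V})$. The same conclusions hold if in the definition of $\Sigma(\mathcal{M})$ the space $C^1(\Omega,\mathbf{R}^m)$ is replaced with the space $\mathcal{D}'(\Omega,\mathbf{R}^m)$ of vector-valued distributions.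
   Context: $n,m\ge 1$ are integers and $\mathcal{L}(\mathbf{R}^n,\mathbf{R}^m)$ is the space of linear operators $\mathbf{R}^n\to\mathbf{R}^m$. $\operatorname{Sym}^k(\mathbf{R}^n;\mathbf{R}^m)$ is the space of symmetric $k$-linear maps $(\mathbf{R}^n)^k\to\mathbf{R}^m$, with $\operatorname{Sym}^0(\mathbf{R}^n;\mathbf{R}^m)=\mathbf{R}^m$. For a linear subspace $\mathfrak{V}\subseteq\mathcal{L}(\mathbf{R}^n,\mathbf{R}^m)$ and $k\ge 1$, $$M_k(\mathfrak{V})=\{T\in\operatorname{Sym}^k(\mathbf{R}^n;\mathbf{R}^m)\mid \forall x_1,\dots,x_{k-1}\in\mathbf{R}^n\text{ the operator }x\mapsto T(x_1,\dots,x_{k-1},x)\text{ belongs to }\mathfrak{V}\},$$ and $M_0(\mathfrak{V})=\mathbf{R}^m$ (so $M_1(\mathfrak{V})=\mathfrak{V}$). Set $\mathfrak{M}(\mathfrak{V})=\bigoplus_{k\ge 0}M_k(\mathfrak{V})$ and $\delta(\mathfrak{V})=\sup\{k\mid M_k(\mathfrak{V})\neq 0\}\in\mathbf{N}\cup\{\infty\}$. $\mathcal{P}(\mathfrak{V})$ is the space of $\mathbf{R}^m$-valued polynomials on $\mathbf{R}^n$ corresponding to $\mathfrak{M}(\mathfrak{V})$ under the linear bijection sending a homogeneous tensor $T\in\operatorname{Sym}^k(\mathbf{R}^n;\mathbf{R}^m)$ to the polynomial $p(x)=T(x,\dots,x)$. For a distribution $F\in\mathcal{D}'(\Omega,\mathbf{R}^m)$,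 the condition that $DF$ takes values in $\mathfrak{V}$ means that for every linear functional $\ell$ on $\mathcal{L}(\mathbf{R}^n,\mathbf{R}^m)$ vanishing on $\mathfrak{V}$, the scalar distribution $\ell(DF)$ is zero.
   Formalization: The finite-dimensionality equivalence and the identification with restrictions of P(V) are proved for Ω nonempty and connected: for V=0 and disconnected Ω locally constant functions are further solutions, and for Ω empty with δ(V)=∞ the space Σ is zero. *)

(* Defs.v *)
From HB Require Import structures.
From mathcomp Require Export all_boot all_order all_algebra all_fingroup.
From mathcomp Require Export all_classical all_reals all_analysis.

Set Implicit Arguments.
Unset Strict Implicit.
Unset Printing Implicit Defensive.

Export Order.TTheory GRing.Theory Num.Theory.
Export numFieldNormedType.Exports.

Local Open Scope classical_set_scope.
Local Open Scope ring_scope.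

Definition is_vector_space (R : realType) (E : lmodType R) (S : set E) : Prop :=
  GRing.submod_closed (mem S).

Definition finite_dimensional (R : realType) (E : lmodType R) (S : set E) :
    Prop :=
  exists (d : nat) (b : 'I_d -> E), (forall i, S (b i)) /\
    forall u, S u -> exists c : 'I_d -> R, u = \sum_i c i *: b i.

Section tensors.
Variables (R : realType) (n m : nat).
Local Notation X := 'rV[R]_n.
Local Notation Y := 'rV[R]_m.

Definition multilinear k (T : ('I_k -> X) -> Y) : Prop :=
  forall (i : 'I_k) (x : 'I_k -> X), linear (fun v => T [eta x with i |-> v]).

Definition symmetric_map k (T : ('I_k -> X) -> Y) : Prop :=
  forall (s : 'S_k) (x : 'I_k -> X), T (x \o s) = T x.

(* For k = 0 both conditions are vacuous: Sym 0 is the set of all maps from a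
   one-point type to R^m, i.e. a copy of R^m. *)
Definition Sym k : set (('I_k -> X) -> Y) :=
  [set T | multilinear T /\ symmetric_map T].

Arguments Sym k : clear implicits.

Variable V : {vspace 'Hom(X, Y)}.

(* The last entry of x in the condition below is overwritten, so x ranges over
   the k - 1 fixed arguments x_1, ..., x_(k-1). *)
Definition M k : set (('I_k -> X) -> Y) :=
  match k return set (('I_k -> X) -> Y) with
  | 0 => Sym 0
  | k'.+1 => [set T | Sym k'.+1 T /\ forall x : 'I_k'.+1 -> X,
      linfun (fun v => T [eta x with ord_max |-> v]) \in V]
  end.
Arguments M k : clear implicits.

Definition delta : \bar R :=
  ereal_sup [set (k%:R)%:E | k in [set k : nat | M k <> [set 0]]].

(* A family (T_k)_(k < N) stands for an element of the direct sum of the M k;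
   polynomials are identified with polynomial functions. *)
Definition calP : set (X -> Y) :=
  [set p | exists (N : nat) (T : forall k, ('I_k -> X) -> Y),
    (forall k, M k (T k)) /\ p = (fun x => \sum_(k < N) T k (fun=> x))].

End tensors.
Arguments Sym {R} n m k.
Arguments M {R n m} V k.

Section C1_solutions.
Variables (R : realType) (n m : nat) (Omega : set 'rV[R]_n).

(* Total functions, of which only the values on Omega are meaningful. *)
Definition C1_on (F : 'rV[R]_n -> 'rV[R]_m) : Prop :=
  forall x, Omega x -> differentiable F x /\ {for x, continuous (jacobian F)}.

(* A set of functions on (the subtype) Omega: sigL is restriction to Omega, and
   since Omega will be open the differential on Omega only depends on the
   restriction. *)
Definition Sigma_C1 (V : {vspace 'Hom('rV[R]_n, 'rV[R]_m)}) :
    set (Omega -> 'rV[R]_m) :=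
  [set sigL Omega F | F in [set F : 'rV[R]_n -> 'rV[R]_m |
    C1_on F /\ forall x, Omega x -> linfun ('d F x) \in V]].

End C1_solutions.
Arguments Sigma_C1 {R n m} Omega V.

Section test_functions.
Variables (R : realType) (n : nat).
Local Notation X := 'rV[R]_n.
Implicit Types (f g : X -> R^o).

Definition iter_derive (s : seq X) f : X -> R^o :=
  foldr (fun v g => 'D_v g) f s.

(* Differentiability of all iterated directional derivatives also yields their
   continuity. *)
Definition smooth f : Prop :=
  forall (s : seq X) (x : X), differentiable (iter_derive s f) x.

Definition supp f : set X := closure [set x | f x != 0].

Definition is_test (Omega : set X) : set (X -> R^o) :=
  [set f | [/\ smooth f, compact (supp f) & supp f `<=` Omega]].

Lemma iter_derive_rcons s v f : iter_derive (rcons s v) f = iter_derive s ('D_v f).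
Proof. by rewrite /iter_derive -cats1 foldr_cat. Qed.

Lemma iter_deriveZD s (a : R) f g : smooth f -> smooth g ->
  iter_derive s (a *: f + g) = a *: iter_derive s f + iter_derive s g.
Proof.
move=> sf sg; elim: s => [//|v s IH] /=; rewrite IH; apply/funext => x /=.
have df : derivable (iter_derive s f) x v by exact/diff_derivable/sf.
have dg : derivable (iter_derive s g) x v by exact/diff_derivable/sg.
by rewrite deriveD ?deriveZ //; exact: derivableZ.
Qed.

Lemma supp_derive v f : supp ('D_v f) `<=` supp f.
Proof.
rewrite /supp (closure_id (closure [set x | f x != 0])).1; last first.
  exact: closed_closure.
apply: closureS => x /= Dx; apply: contrapT => nx; move/eqP: Dx; apply.
have nf : \near x, f x = (cst 0 : X -> R^o) x.
  have : nbhs x (~` closure [set x | f x != 0]).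
    by apply: open_nbhs_nbhs; split => //; apply: closed_openC; exact: closed_closure.
  apply: filterS => y ny /=; apply/eqP; apply/negPn/negP => fy; apply: ny.
  exact: subset_closure.
by rewrite (near_eq_derive v nf) derive_cst.
Qed.

Lemma is_test_derive Omega v f : is_test Omega f -> is_test Omega ('D_v f).
Proof.
move=> [sf cf fO]; split.
- by move=> s x; rewrite -iter_derive_rcons; exact: sf.
- by apply: (subclosed_compact _ cf); [exact: closed_closure|exact: supp_derive].
- exact: subset_trans (@supp_derive v f) fO.
Qed.

Lemma is_test_submod Omega : GRing.submod_closed (mem (is_test Omega)).
Proof.
have s0 s : iter_derive s (0 : X -> R^o) = 0.
  by elim: s => [//|v s IH] /=; rewrite IH; apply/funext => x; exact: derive_cst.
have supp0 : supp (0 : X -> R^o) = set0.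
  rewrite /supp (_ : [set x | _] = set0) ?closure0 //.
  by apply/seteqP; split => x //=; rewrite eqxx.
split.
  rewrite inE; split.
  - by move=> s x; rewrite s0; exact: differentiable_cst.
  - by rewrite supp0; exact: compact0.
  - by rewrite supp0; exact: sub0set.
move=> a f g; rewrite !inE => -[sf cf fO] [sg cg gO].
have sub : supp (a *: f + g) `<=` supp f `|` supp g.
  rewrite /supp -closureU; apply: closureS => x /= /eqP fgx.
  have [fx|fx] := eqVneq (f x) 0; last by left.
  right; apply/eqP => gx; apply: fgx.
  by rewrite -[LHS]/(a * f x + g x) fx gx mulr0 addr0.
split.
- move=> s x; rewrite iter_deriveZD //.
  by apply: differentiableD => //; exact: differentiableZ.
- apply: (subclosed_compact _ (compactU cf cg)); last exact: sub.
  exact: closed_closure.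
- by move=> x /sub [/fO|/gO].
Qed.

End test_functions.

Record testfun (R : realType) (n : nat) (Omega : set 'rV[R]_n) := TestFun {
  testfun_val :> 'rV[R]_n -> R^o;
  testfunP : testfun_val \in is_test Omega }.

HB.instance Definition _ R n Omega :=
  [isSub for @testfun_val R n Omega].
HB.instance Definition _ R n Omega :=
  [Choice of @testfun R n Omega by <:].
HB.instance Definition _ (R : realType) n (Omega : set 'rV[R]_n) :=
  GRing.SubChoice_isSubLmodule.Build R ('rV[R]_n -> R^o) _ (testfun Omega)
    (GRing.submod_closed_semi (is_test_submod Omega)).

Definition test_derive (R : realType) n (Omega : set 'rV[R]_n) (v : 'rV[R]_n)
    (phi : testfun Omega) : testfun Omega :=
  TestFun (mem_set (is_test_derive v (set_mem (testfunP phi)))).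

Section distribution_solutions.
Variables (R : realType) (n m : nat) (Omega : set 'rV[R]_n).
Local Notation X := 'rV[R]_n.
Local Notation Y := 'rV[R]_m.
Local Notation D := (testfun Omega).

Definition partials (s : seq 'I_n) (f : X -> R^o) : X -> R^o :=
  iter_derive [seq delta_mx 0 i | i <- s] f.

(* Continuity is expressed by the seminorm estimates
   |F phi| <= C * max_(|s| <= N) sup_x |partials s phi x|
   for phi supported in a compact K; B ranges over the upper bounds of the
   seminorm. *)
Definition is_distribution (F : D -> Y) : Prop :=
  linear F /\
  forall K : set X, compact K -> K `<=` Omega ->
    exists (C : R) (N : nat), forall (phi : D), supp phi `<=` K ->
      forall B : R,
        (forall (s : seq 'I_n) (x : X), (size s <= N)%N ->
          `|partials s phi x| <= B) ->
        `|F phi| <= C * B.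

(* DF, a distribution with values in L(R^n, R^m):
   <DF, phi> v = <d_v F, phi> = - <F, d_v phi>. *)
Definition distD (F : D -> Y) (phi : D) : 'Hom(X, Y) :=
  linfun (fun v : X => - F (test_derive v phi)).

Definition Sigma_distr (V : {vspace 'Hom(X, Y)}) : set (D -> Y) :=
  [set F | is_distribution F /\
    forall l : {linear 'Hom(X, Y) -> R^o}, (forall A, A \in V -> l A = 0) ->
      forall phi : D, l (distD F phi) = 0].

End distribution_solutions.
Arguments Sigma_distr {R n m} Omega V.

(* Iterated Lebesgue integral over R^n. It is only applied to continuous
   functions with compact support, for which it is, by Fubini, the integral with
   respect to n-dimensional Lebesgue measure. *)
Fixpoint integral_rV (R : realType) (n : nat) : ('rV[R]_n -> R) -> R :=
  match n return ('rV[R]_n -> R) -> R with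
  | 0 => fun f => f 0
  | n'.+1 => fun f => \int[@lebesgue_measure R]_t
      integral_rV (fun v : 'rV[R]_n' => f (row_mx (t%:M : 'rV[R]_1) v))
  end.

(* phi vanishes off Omega, so this is the distribution on Omega defined by the
   restriction of p to Omega. *)
Definition distr_of (R : realType) (n m : nat) (Omega : set 'rV[R]_n)
    (p : 'rV[R]_n -> 'rV[R]_m) : testfun Omega -> 'rV[R]_m :=
  fun phi => \row_j integral_rV (fun x => phi x * p x 0 j).
Arguments distr_of {R n m} Omega p.

(* Main.v *)
(** Let F be a distribution such that DF has values in V. For every test function
    phi the tensor (x_1, ..., x_k) |-> <F, d_x1 ... d_xk phi> belongs to M_k(V), so
    if M_N(V) = 0 then all the derivatives of F of order N vanish. One then goes
    down: if the derivatives of order k + 1 vanish, those of order k are constant,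
    they are given by an element of M_k(V), and they can be removed from F by
    subtracting the corresponding homogeneous polynomial. Thus F is an element of
    P(V).

    The constancy of a distribution with zero derivative is purely algebraic: on a
    small cube, a test function is congruent, modulo derivatives of test functions,
    to a multiple of a fixed bump function (average over one coordinate at a time),
    so a linear form killing all derivatives is locally a multiple of the integral.
    Connectedness and a cutoff argument globalize this.

    A C^1 solution defines a distributional solution by integration by parts, and a
    continuous function is determined on Omega by the distribution that it defines.

    Conversely, nonzero elements of M_k(V) in infinitely many degrees k yield
    linearly independent solutions: in a vanishing linear combination, derivatives
    of the top degree isolate the top tensor. *)

(* On a disconnected open set a solution may be a different polynomial on each component, and on the
   empty set the solution space vanishes whatever [delta] is; this is where nonemptiness and
   connectedness of [Omega] enter. The reduction to one bump function holds for linear forms with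
   values in any module, so it serves twice: for the given form, and for the integral, which also
   kills derivatives and thereby identifies the factor. Its obstacle is that a primitive of a test
   function must again be a test function. Smoothness requires differentiation under the integral
   sign; compact support requires that the integral over every line be removed beforehand, which is
   the purpose of the averages. Since the integral is an iterated one-dimensional one, its
   linearity, bounds, translation invariance and positivity come by induction on the dimension,
   within continuous functions of compact support. The factor (-1)^k / k! has two sources: k
   integrations by parts give (-1)^k, and k derivatives of T(x, ..., x) give k! T. *)
From HB Require Import structures.
Require Import Defs.
From mathcomp Require Import all_boot all_order all_algebra.
From mathcomp Require Import all_classical all_reals all_analysis.
From mathcomp Require finmap.
From mathcomp Require Import ring lra.
Import Order.TTheory GRing.Theory Num.Theory numFieldNormedType.Exports.

Set Implicit Arguments.
Unset Strict Implicit.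
Unset Printing Implicit Defensive.

Local Open Scope classical_set_scope.
Local Open Scope ring_scope.

(** * Smooth functions *)

Section smooth_functions.
Variables (R : realType) (n : nat).
Local Notation X := 'rV[R]_n.
Implicit Types (f g : X -> R^o) (v w x : X).

(** Smoothness as a greatest fixed point: iterated derivatives never leave a class that is stable
    under derivation. Each closure property below then amounts to finding a class of differentiable
    functions that is large enough to be stable. *)
Lemma smooth_coind (P : set (X -> R^o)) :
  (forall f, P f -> (forall x, differentiable f x) /\ forall v, P ('D_v f)) ->
  forall f, P f -> smooth f.
Proof.
move=> PD f Pf s x.
suff /PD[] : P (iter_derive s f) by move=> /(_ x).
by elim: s => [//|v s /PD[_]] /=; apply.
Qed.

Lemma smooth_differentiable f x : smooth f -> differentiable f x.
Proof. by move/(_ [::]) => /=. Qed.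

Lemma smooth_derivable f x v : smooth f -> derivable f x v.
Proof. by move=> sf; apply: diff_derivable; exact: smooth_differentiable. Qed.

Arguments smooth_derivable [f] x v _.

Lemma smooth_continuous f : smooth f -> continuous f.
Proof.
by move=> sf x; apply: differentiable_continuous; exact: smooth_differentiable.
Qed.

Lemma smooth_derive f v : smooth f -> smooth ('D_v f).
Proof. by move=> sf s x; rewrite -iter_derive_rcons; exact: sf. Qed.

Lemma smooth_iter_derive s f : smooth f -> smooth (iter_derive s f).
Proof. by move=> sf; elim: s => [//|v s /= /smooth_derive]. Qed.

Lemma smooth_cst (c : R) : smooth (fun _ : X => c : R^o).
Proof.
apply: (@smooth_coind [set f | exists c : R, f = (fun _ : X => c : R^o)]); last by exists c.
move=> _ [{}c ->]; split => [x|v]; first exact: differentiable_cst.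
by exists 0; apply/funext => x; exact: derive_cst.
Qed.

Lemma smoothD f g : smooth f -> smooth g -> smooth (fun x => f x + g x).
Proof.
move=> sf sg.
apply: (@smooth_coind [set h | exists f g, [/\ smooth f, smooth g &
  h = (fun x => f x + g x)]]); last by exists f, g.
move=> _ [{}f [{}g [{}sf {}sg ->]]]; split.
  by move=> x; apply: differentiableD; exact: smooth_differentiable.
move=> v; exists ('D_v f), ('D_v g); split; [exact: smooth_derive..|].
by apply/funext => x; apply: deriveD; exact: smooth_derivable.
Qed.

Lemma derive_fctM f g x v : derivable f x v -> derivable g x v ->
  'D_v (fun y => f y * g y : R^o) x = 'D_v f x * g x + f x * 'D_v g x.
Proof.
move=> df dg; rewrite (_ : (fun y => _) = f * g)//.
have -> := deriveM df dg.
by rewrite addrC [X in X + _]mulrC.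
Qed.

Lemma smoothM f g : smooth f -> smooth g -> smooth (fun x => f x * g x : R^o).
Proof.
(* Products alone are not stable under derivation, since the Leibniz rule gives a sum of two. [P k]
   consists of sums of 2^k products, arranged as a binary tree of depth [k], and a derivative raises
   [k] by one. *)
pose P := fix P k h := if k is k'.+1 then
    exists h1 h2, [/\ P k' h1, P k' h2 & h = (fun x => h1 x + h2 x : R^o)]
  else exists f g, [/\ smooth f, smooth g & h = (fun x => f x * g x : R^o)].
have Pdiff k h : P k h -> forall x, differentiable h x.
  elim: k h => [|k IH] h /=.
    move=> [{}f [{}g [sf sg ->]]] x.
    by apply: differentiableM; exact: smooth_differentiable.
  by move=> [f1 [g1 [/IH pf /IH pg ->]]] x; exact: differentiableD.
have Pderive k h v : P k h -> P k.+1 ('D_v h).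
  elim: k h => [|k IH] h.
    move=> [{}f [{}g [sf sg ->]]].
    exists (fun x => 'D_v f x * g x), (fun x => f x * 'D_v g x); split.
    - by exists ('D_v f), g; split => //; exact: smooth_derive.
    - by exists f, ('D_v g); split => //; exact: smooth_derive.
    - by apply/funext => x; apply: derive_fctM; exact: smooth_derivable.
  move=> [h1 [h2 [P1 P2 ->]]]; exists ('D_v h1), ('D_v h2).
  split; [exact: IH|exact: IH|].
  apply/funext => x; apply: deriveD; apply: diff_derivable;
    [exact: Pdiff P1 x|exact: Pdiff P2 x].
move=> sf sg; apply: (@smooth_coind [set h | exists k, P k h]).
  move=> h [k Pk]; split; first exact: Pdiff Pk.
  by move=> v; exists k.+1; exact: Pderive.
by exists 0%N, f, g.
Qed.

Lemma smooth_prod (I : Type) (r : seq I) (F : I -> X -> R^o) :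
  (forall i, smooth (F i)) -> smooth (fun x => \prod_(i <- r) F i x : R^o).
Proof.
move=> sF; elim: r => [|i r IH].
  by under eq_fun do rewrite big_nil; exact: smooth_cst.
by under eq_fun do rewrite big_cons; exact: smoothM.
Qed.

Lemma smooth_sum (I : Type) (r : seq I) (F : I -> X -> R^o) :
  (forall i, smooth (F i)) -> smooth (fun x => \sum_(i <- r) F i x : R^o).
Proof.
move=> sF; elim: r => [|i r IH].
  by under eq_fun do rewrite big_nil; exact: smooth_cst.
by under eq_fun do rewrite big_cons; exact: smoothD.
Qed.

Lemma derive_coord (i : 'I_n) x v : 'D_v (fun y : X => y 0 i : R^o) x = v 0 i.
Proof.
have lf : linear (fun y : X => y 0 i : R^o) by move=> a u w; rewrite !mxE.
pose mf := GRing.isLinear.Build _ _ _ _ (fun y : X => y 0 i : R^o) lf.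
pose F : {linear X -> R^o} := HB.pack (fun y : X => y 0 i : R^o) mf.
have cF : continuous F by exact: coord_continuous.
rewrite -[fun y : X => _]/(F : X -> R^o) deriveE; last exact: linear_differentiable.
by rewrite (diff_lin x cF).
Qed.

Lemma smooth_coord (i : 'I_n) : smooth (fun x : X => x 0 i : R^o).
Proof.
apply: (@smooth_coind
  [set f | smooth f \/ f = (fun x : X => x 0 i : R^o)]); last by right.
move=> f [sf|->]; split.
- by move=> x; exact: smooth_differentiable.
- by move=> v; left; exact: smooth_derive.
- by move=> x; exact: differentiable_coord.
- move=> v; left; rewrite (_ : 'D_v _ = fun=> v 0 i); first exact: smooth_cst.
  by apply/funext => x; exact: derive_coord.
Qed.


(** This form exhibits a candidate differential together with an explicit remainder; it is used to
    transfer differentiability between functions that agree near a point and to differentiate under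
    the integral sign. *)
Lemma differentiable_epsP f (L : {linear X -> R^o}) x : continuous L ->
  (differentiable f x /\ 'd f x = L :> (X -> R^o)) <->
  forall e : R, 0 < e ->
    \forall h \near (0 : X), `|f (h + x) - f x - L h| <= e * `|h|.
Proof.
move=> cL; split.
  move=> [/diff_locallyP[_ /eqaddoP fx] dL] e e0.
  move: (fx e e0); apply: filterS => h /=; rewrite dL.
  by rewrite !fctE /= opprD addrA.
move=> fL.
have fo : f \o shift x = cst (f x) + L +o_ (0 : X) id.
  apply/eqaddoP => e e0; move: (fL e e0); apply: filterS => h.
  by rewrite !fctE /= opprD addrA.
have dL := diff_unique cL fo.
by split; [apply/diff_locallyP; rewrite dL|].
Qed.

Lemma near_eq_differentiable f g x : (\near x, f x = g x) ->
  differentiable g x -> differentiable f x.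
Proof.
move=> fg dg.
have cd := diff_continuous dg.
have eg := (differentiable_epsP g x cd).1 (conj dg erefl).
apply: (proj1 ((differentiable_epsP f x cd).2 _)) => e e0.
have nfg : \forall h \near (0 : X), f (h + x) = g (h + x).
  by move: fg; rewrite (near_shift 0 x (fun y => f y = g y)) /= subr0.
rewrite (nbhs_singleton fg).
by near=> h; rewrite (near nfg h)//; near: h; exact: eg e e0.
Unshelve. all: by end_near. Qed.

(** Needed for functions defined by cases, such as the truncated primitive in
    [line_average_exact]. *)
Lemma smooth_near f : (forall x, exists2 g, smooth g & \near x, f x = g x) ->
  smooth f.
Proof.
apply: (@smooth_coind
  [set f | forall x, exists2 g, smooth g & \near x, f x = g x]).
move=> {}f fg; split=> [x|v x].
  have [g sg ng] := fg x.
  exact: near_eq_differentiable ng (smooth_differentiable x sg).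
have [g sg ng] := fg x; exists ('D_v g); first exact: smooth_derive.
move/near_join : ng; apply: filterS => y; exact: near_eq_derive.
Qed.

Lemma smooth_derive_is_linear f x : smooth f ->
  linear (fun v => 'D_v f x : R^o).
Proof.
move=> sf a v w; have df := smooth_differentiable x sf.
by rewrite !deriveE// linearP.
Qed.

Lemma smooth_deriveZv f x (a : R) v : smooth f -> 'D_(a *: v) f x = a * 'D_v f x.
Proof.
move=> sf; have df := smooth_differentiable x sf.
by rewrite !deriveE// linearZ.
Qed.

Lemma is_derive_line f (v x : X) (t : R) : derivable f (t *: v + x) v ->
  is_derive (t : R^o) 1 (fun s : R => f (s *: v + x)) ('D_v f (t *: v + x)).
Proof.
move=> df.
have E : (fun h : R => h^-1 *: ((fun s : R => f (s *: v + x)) (h *: (1 : R^o) + t)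
      - f (t *: v + x))) =
    (fun h : R => h^-1 *: (f (h *: v + (t *: v + x)) - f (t *: v + x))).
  by apply/funext => h; rewrite /= [h *: 1]mulr1 scalerDl addrA.
by apply: DeriveDef; [rewrite /derivable E|rewrite /derive E].
Qed.

Lemma mean_value_line f (v x : X) (t : R) : 0 <= t ->
  (forall y, derivable f y v) ->
  exists2 s : R, 0 <= s <= t & f (x + t *: v) - f x = t * 'D_v f (x + s *: v).
Proof.
move=> t0 df; pose g (s : R) := f (s *: v + x).
have dg (s : R) : is_derive (s : R^o) 1 g ('D_v f (s *: v + x)).
  exact: is_derive_line.
have cg : {within `[0, t], continuous g}.
  by apply: derivable_within_continuous => s _; have [] := dg s.
have [s st] := MVT_segment t0 (fun s _ => dg s) cg.
rewrite /g scale0r add0r subr0 [t *: v + x]addrC => ->.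
by exists s; [move: st; rewrite in_itv|rewrite addrC mulrC].
Qed.

Lemma mean_value_dir f (v x : X) : (forall y, derivable f y v) ->
  exists2 t : R, 0 <= t <= 1 & f (x + v) - f x = 'D_v f (x + t *: v).
Proof.
move=> df; have [t t01] := mean_value_line x ler01 df.
by rewrite scale1r mul1r => ->; exists t.
Qed.

(** The mean value theorem is applied twice: in direction [v] to y |-> f(y + w) - f(y), then in
    direction [w] to the derivative of [f] along [v]. *)
Lemma second_difference f (v w x : X) : smooth f ->
  exists2 st : R * R, 0 <= st.1 <= 1 /\ 0 <= st.2 <= 1 &
  f (x + v + w) - f (x + v) - (f (x + w) - f x) =
    'D_w ('D_v f) (x + st.1 *: v + st.2 *: w).
Proof.
move=> sf; pose g y := f (y + w) - f y.
have shift_derivable y : derivable (fun z => f (z + w)) y v /\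
    'D_v (fun z => f (z + w)) y = 'D_v f (y + w).
  have E : (fun h : R => h^-1 *: ((fun z => f (z + w)) (h *: v + y) - f (y + w)))
      = (fun h : R => h^-1 *: (f (h *: v + (y + w)) - f (y + w))).
    by apply/funext => h; rewrite addrA.
  have := smooth_derivable (y + w) v sf.
  by rewrite /derivable /derive E.
have dg y : derivable g y v.
  apply: derivableB; first by have [] := shift_derivable y.
  exact: smooth_derivable.
have [s s01 gs] := mean_value_dir x dg.
have gE : 'D_v g (x + s *: v) = 'D_v f (x + s *: v + w) - 'D_v f (x + s *: v).
  rewrite [LHS]deriveB; [|by have [] := shift_derivable (x + s *: v)|
    exact: smooth_derivable].
  by have [_ ->] := shift_derivable (x + s *: v).
have [t t01 ft] := mean_value_dir (x + s *: v)
  (fun y => smooth_derivable y w (smooth_derive v sf)).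
by exists (s, t) => //=; rewrite -ft -gE -gs /g opprB addrA.
Qed.

Local Opaque derive.

(** The second difference with increments r v and r w is symmetric in the two directions, and equals
    r^2 times either mixed derivative at some point of the small parallelogram at [x]. Continuity of
    both mixed derivatives at [x] concludes. *)
Lemma derive_comm f v w : smooth f -> 'D_v ('D_w f) = 'D_w ('D_v f).
Proof.
move=> sf.
suff AB (A B : X -> R^o) (x : X) (e : R) : A = 'D_v ('D_w f) ->
    B = 'D_w ('D_v f) -> 0 < e -> `|A x - B x| <= e.
  apply/funext => x; apply/eqP; rewrite -subr_eq0 -normr_le0.
  apply/ler_addgt0Pl => e e0; rewrite addr0.
  exact: (AB _ _ x e erefl erefl e0).
move=> AE BE e0.
have sA : smooth A by rewrite AE; exact/smooth_derive/smooth_derive.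
have sB : smooth B by rewrite BE; exact/smooth_derive/smooth_derive.
have e20 : 0 < e / 2 by rewrite divr_gt0.
have near_le (g : X -> R^o) : smooth g -> exists2 d : R, 0 < d &
    forall y : X, ball x d y -> `|g x - g y| <= e / 2.
  move=> /smooth_continuous/(_ x)/cvgrPdist_le/(_ _ e20).
  by move=> /nbhs_ballP[d /= d0 xd]; exists d.
have [d1 d10 xd1] := near_le A sA; have [d2 d20 xd2] := near_le B sB.
pose d := Num.min d1 d2.
have d0 : 0 < d by rewrite lt_min d10.
have {}xd1 (y : X) : ball x d y -> `|A x - A y| <= e / 2.
  by move=> xy; apply: xd1; apply: le_ball xy; rewrite ge_min lexx.
have {}xd2 (y : X) : ball x d y -> `|B x - B y| <= e / 2.
  by move=> xy; apply: xd2; apply: le_ball xy; rewrite ge_min lexx orbT.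
have p0 : 0 < `|v| + `|w| + 1 by rewrite ltr_wpDl ?addr_ge0.
(* With this [r] the whole parallelogram lies in the ball of radius [d], where each mixed derivative
   is within e / 2 of its value at [x]. The summand 1 keeps the divisor positive when [v] and [w]
   vanish. *)
have [r r0 rd] : exists2 r : R, 0 < r & r * (`|v| + `|w| + 1) = d.
  exists (d / (`|v| + `|w| + 1)); first by rewrite divr_gt0.
  by rewrite divfK// lt0r_neq0.
have small (s t : R) : 0 <= s <= 1 -> 0 <= t <= 1 ->
    ball x d (x + s *: (r *: v) + t *: (r *: w)).
  move=> /andP[s0 s1] /andP[t0 t1]; rewrite -ball_normE /ball_/=.
  rewrite opprD addrA opprD addrA subrr add0r.
  apply: (le_lt_trans (ler_normD _ _)); rewrite !normrN !normrZ.
  rewrite (ger0_norm s0) (ger0_norm t0) (gtr0_norm r0).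
  apply: (@le_lt_trans _ _ (r * `|v| + r * `|w|)).
    by apply: lerD; rewrite ler_piMl ?mulr_ge0// ltW.
  rewrite -mulrDr -rd ltr_pM2l//.
  by rewrite ltrDl.
have [[a b] /= [a01 b01] E1] := second_difference (r *: v) (r *: w) x sf.
have [[a' b'] /= [a01' b01'] E2] := second_difference (r *: w) (r *: v) x sf.
have {E1}E1 : f (x + r *: v + r *: w) - f (x + r *: v) - (f (x + r *: w) - f x)
    = r * (r * B (x + a *: (r *: v) + b *: (r *: w))).
  rewrite E1 BE smooth_deriveZv; last exact: smooth_derive.
  congr (_ * _); rewrite (_ : 'D_(r *: v) f = r *: 'D_v f); last first.
    by apply/funext => y; exact: smooth_deriveZv.
  by rewrite deriveZ //; exact/smooth_derivable/smooth_derive.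
have {E2}E2 : f (x + r *: w + r *: v) - f (x + r *: w) - (f (x + r *: v) - f x)
    = r * (r * A (x + a' *: (r *: w) + b' *: (r *: v))).
  rewrite E2 AE smooth_deriveZv; last exact: smooth_derive.
  congr (_ * _); rewrite (_ : 'D_(r *: w) f = r *: 'D_w f); last first.
    by apply/funext => y; exact: smooth_deriveZv.
  by rewrite deriveZ //; exact/smooth_derivable/smooth_derive.
have AB : A (x + b' *: (r *: v) + a' *: (r *: w)) =
    B (x + a *: (r *: v) + b *: (r *: w)).
  apply: (mulfI (lt0r_neq0 r0)); apply: (mulfI (lt0r_neq0 r0)).
  rewrite -E1 addrAC -E2 [x + r *: w + _]addrAC.
  by ring.
have Ax := xd1 _ (small _ _ b01' a01').
have Bx := xd2 _ (small _ _ a01 b01).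
rewrite -(subrK (A (x + b' *: (r *: v) + a' *: (r *: w))) (A x)) -addrA.
have -> : e = e / 2 + e / 2 by field.
rewrite {2}AB (le_trans (ler_normD _ _))// lerD//.
by rewrite distrC.
Qed.

Lemma iter_derive_comm1 s v f : smooth f ->
  iter_derive s ('D_v f) = 'D_v (iter_derive s f).
Proof.
move=> sf; elim: s => [//|w s /= ->].
exact/derive_comm/smooth_iter_derive.
Qed.

Lemma iter_derive_cat s1 s2 f :
  iter_derive (s1 ++ s2) f = iter_derive s1 (iter_derive s2 f).
Proof. exact: foldr_cat. Qed.

Lemma iter_derive_perm s1 s2 f : smooth f -> perm_eq s1 s2 ->
  iter_derive s1 f = iter_derive s2 f.
Proof.
move=> sf s12; pose P s := iter_derive s1 f = iter_derive s f.
suff PA t1 t2 t3 : P (t1 ++ t2 ++ t3) -> P (t2 ++ t1 ++ t3).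
  exact: (catCA_perm_ind PA s12 erefl).
rewrite /P => ->.
rewrite !iter_derive_cat.
have {}sf := smooth_iter_derive t3 sf.
elim: t1 => [//|v t1 /= ->].
by rewrite (iter_derive_comm1 _ _ (smooth_iter_derive t1 sf)).
Qed.

End smooth_functions.
Arguments smooth_derivable [R n f] x v _.

Local Opaque derive.

(** * The iterated integral of compactly supported functions *)

Section one_dimensional_integral.
Variable R : realType.
Local Notation mu := (@lebesgue_measure R).
Implicit Types (f g : R -> R) (a b c : R).

Lemma integrable_segment f a b : continuous f ->
  mu.-integrable `[a, b] (EFin \o f).
Proof.
move=> cf; apply: continuous_compact_integrable; first exact: segment_compact.
exact: continuous_subspaceT.
Qed.

Lemma Rintegral_support f a b : (forall t, t \notin `[a, b] -> f t = 0) ->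
  \int[mu]_t f t = \int[mu]_(t in `[a, b]) f t.
Proof.
move=> f0; rewrite [RHS]Rintegral_mkcond; congr (Rintegral _ _ _).
apply/funext => t; rewrite patchE; case: ifPn => // tab; apply: f0.
by apply: contra tab => tab; rewrite inE.
Qed.

Lemma Rintegral_segmentZD k f g a b : continuous f -> continuous g ->
  \int[mu]_(t in `[a, b]) (k * f t + g t) =
  k * \int[mu]_(t in `[a, b]) f t + \int[mu]_(t in `[a, b]) g t.
Proof.
move=> cf cg; rewrite RintegralD//=; last 2 first.
- by apply: integrable_segment => t; apply: cvgM; [exact: cvg_cst|exact: cf].
- exact: integrable_segment.
by rewrite RintegralZl//; exact: integrable_segment.
Qed.

Lemma Rintegral_segment_le f a b (B : R) : continuous f -> a <= b ->
  (forall t, a <= t <= b -> `|f t| <= B) ->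
  `|\int[mu]_(t in `[a, b]) f t| <= (b - a) * B.
Proof.
move=> cf ab fB.
have iB : mu.-integrable `[a, b] (EFin \o (fun=> B)).
  by apply: integrable_segment => t; exact: cvg_cst.
apply: (le_trans (le_normr_Rintegral _ (integrable_segment _ _ _))) => //.
have <- : \int[mu]_(t in `[a, b]) B = (b - a) * B.
  rewrite Rintegral_cst//= (lebesgue_measure_itv (Interval (BLeft a) (BRight b))).
  rewrite /= lte_fin mulrC.
  by move: ab; rewrite le_eqVlt => /predU1P[->|->//]; rewrite ltxx subrr.
apply: le_Rintegral => //.
  by apply: integrable_segment => t; apply: cvg_norm; exact: cf.
Qed.

Lemma Rintegral_segment_ftc f F a b : continuous f -> a < b ->
  (forall t : R, a <= t <= b -> is_derive (t : R^o) 1 F (f t)) ->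
  \int[mu]_(t in `[a, b]) f t = F b - F a.
Proof.
move=> cf ab dF.
have cF (t : R) : a <= t <= b -> {for t, continuous F}.
  move=> /dF[dFt _].
  exact/differentiable_continuous/derivable1_diffP.
rewrite /Rintegral (@continuous_FTC2 _ f F)//.
- exact: continuous_subspaceT.
- split.
  + by move=> t; rewrite in_itv/= => /andP[/ltW at' /ltW tb]; have [|] := dF t;
      first by rewrite at'.
  + by apply: cvg_at_right_filter; apply: cF; rewrite lexx ltW.
  + by apply: cvg_at_left_filter; apply: cF; rewrite lexx ltW.
- move=> t; rewrite in_itv/= => /andP[/ltW at' /ltW tb].
  by rewrite derive1E; have [|_ ->] := dF t; first by rewrite at'.
Qed.

Lemma continuous_antiderivative f a : continuous f ->
  exists F : R -> R, forall t : R, a < t -> is_derive (t : R^o) 1 F (f t).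
Proof.
move=> cf; exists (fun x => \int[mu]_(t in `[a, x]) f t) => t at'.
have t1 : t < t + 1 by rewrite ltrDl.
have [dF F'] := continuous_FTC1_closed t1 (integrable_segment a _ cf) at' (cf t).
apply: DeriveDef; first exact: dF.
by rewrite -derive1E; exact: F'.
Qed.


(** Both integrals are increments of one antiderivative [F], over [-M, M] and over [-M + s, M + s];
    they agree because [F] is constant where [f] vanishes. *)
Lemma Rintegral_shift f (L s : R) : continuous f ->
  (forall t, L < `|t| -> f t = 0) ->
  \int[mu]_t f (t + s) = \int[mu]_t f t.
Proof.
move=> cf f0.
have [M [M0 LM sM LsM]] : exists M, [/\ 0 < M, L < M, `|s| < M & L + `|s| < M].
  by exists (`|L| + `|s| + 1); have := ler_norm L; have := normr_ge0 s;
    have := normr_ge0 L; split; lra.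
(* As |s| < M, the point -2M lies below every argument at which [F] is evaluated. *)
have [F dF] := continuous_antiderivative (- M - M) cf.
have NM (t : R) : t \notin `[- M, M] -> M < `|t|.
  by rewrite in_itv/= -ler_norml -ltNge.
have cfs : continuous (fun t => f (t + s)).
  by move=> t; apply: continuous_comp; [apply: cvgD; [exact: cvg_id|exact: cvg_cst]|exact: cf].
rewrite (@Rintegral_support f (- M) M); last first.
  by move=> t /NM tM; apply: f0; exact: lt_trans tM.
rewrite (@Rintegral_support (fun t => f (t + s)) (- M) M); last first.
  move=> t /NM tM; apply: f0; have := ler_normB (t + s) s.
  by rewrite addrK; lra.
move: (sM); rewrite ltr_norml => /andP[sM1 sM2].
have -> : \int[mu]_(t in `[- M, M]) f (t + s) = F (M + s) - F (- M + s).
  apply: (@Rintegral_segment_ftc _ (fun t => F (t + s))) => //; first lra.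
  move=> t /andP[tM Mt]; have ts : - M - M < t + s by lra.
  have := @is_derive1_comp _ F (shift s) t _ _ (dF _ ts) (is_derive_shift t 1 s).
  by rewrite mulr1.
have -> : \int[mu]_(t in `[- M, M]) f t = F M - F (- M).
  apply: Rintegral_segment_ftc => //; first lra.
  by move=> t /andP[tM Mt]; apply: dF; lra.
have Fcst (x y : R) : - M - M < x -> x <= y ->
    (forall t, x <= t <= y -> L < `|t|) -> F x = F y.
  move=> Mx xy xyL; apply/eqP; rewrite eq_sym -subr_eq0.
  have [||t txy ->] := @MVT_segment _ F f x y xy.
  - by move=> t; rewrite in_itv/= => /andP[xt ty]; apply: dF; exact: lt_trans xt.
  - apply: derivable_within_continuous => t; rewrite in_itv/= => /andP[xt ty].
    by have [] := dF t (lt_le_trans Mx xt).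
  - by rewrite f0 ?mul0r//; apply: xyL; move: txy; rewrite in_itv.
have absM (t : R) : M - `|s| <= t \/ t <= - M + `|s| -> L < `|t|.
  by move=> [?|?]; rewrite ltr_normr; apply/orP; [left|right]; lra.
have := normr_ge0 s; have := ler_norm s; have := ler_norm (- s); rewrite normrN.
move=> s1 s2 s3.
have [s0|s0] := leP 0 s.
  rewrite -(Fcst M (M + s)); [|lra|lra|by move=> t /andP[? ?]; apply: absM; left; lra].
  rewrite -(Fcst (- M) (- M + s)); [|lra|lra|]; first by [].
  by move=> t /andP[? ?]; apply: absM; right; lra.
rewrite (Fcst (M + s) M); [|lra|lra|by move=> t /andP[? ?]; apply: absM; left; lra].
rewrite (Fcst (- M + s) (- M)); [|lra|lra|]; first by [].
by move=> t /andP[? ?]; apply: absM; right; lra.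
Qed.

(** An antiderivative is nondecreasing; if the integral were 0 it would be constant on [-M, M], and
    its derivative at [t0] would be 0. *)
Lemma Rintegral_gt0 f (L t0 : R) : continuous f -> (forall t, 0 <= f t) ->
  (forall t, L < `|t| -> f t = 0) -> 0 < f t0 -> 0 < \int[mu]_t f t.
Proof.
move=> cf f_ge0 f0 ft0.
have Lt : `|t0| <= L by rewrite leNgt; apply/negP => /f0 E; rewrite E ltxx in ft0.
pose M := L + 1.
have t0M : - M < t0 < M by rewrite -ltr_norml /M; lra.
rewrite (@Rintegral_support f (- M) M); last first.
  move=> t; rewrite in_itv/= -ler_norml -ltNge => tM; apply: f0.
  by rewrite /M in tM; lra.
have [F dF] := continuous_antiderivative (- M - 1) cf.
have M0 : 0 < M by have := normr_ge0 t0; rewrite /M; lra.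
have dF' (t : R) : - M <= t <= M -> is_derive (t : R^o) 1 F (f t).
  by move=> /andP[? ?]; apply: dF; lra.
rewrite (@Rintegral_segment_ftc f F)//; last by lra.
have Fmono (x y : R) : - M <= x -> x <= y -> F x <= F y.
  move=> Mx xy.
  have [||t txy] := @MVT_segment _ F f x y xy.
  - by move=> t; rewrite in_itv/= => /andP[xt ty]; apply: dF; lra.
  - apply: derivable_within_continuous => t; rewrite in_itv/= => /andP[xt ty].
    by have [|] := dF t; first lra.
  - by rewrite -subr_ge0 => ->; rewrite mulr_ge0// subr_ge0.
rewrite subr_gt0 lt_neqAle Fmono ?andbT//; last by lra.
apply/eqP => FM.
have Fcst (t : R) : - M <= t <= M -> F t = F M.
  move=> /andP[? ?]; apply/eqP; rewrite eq_le Fmono//=.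
  by rewrite -[in leLHS]FM Fmono.
have /dF[_ ft0E] : - M - 1 < t0 by lra.
suff ft0_0 : f t0 = 0 by rewrite ft0_0 ltxx in ft0.
rewrite -ft0E (@near_eq_derive _ _ _ _ (cst (F M))) ?derive_cst//.
have : t0 \in `]- M, M[ by rewrite in_itv.
move=> /near_in_itvoo; apply: filterS => t; rewrite in_itv/= => /andP[tM Mt].
by apply: Fcst; rewrite !ltW.
Qed.

End one_dimensional_integral.

(** * Uniform continuity and integration in several variables *)

Section compactly_supported.
Variables (R : realType).

Lemma rV_norm_leP n (x : 'rV[R]_n) (e : R) : 0 <= e ->
  reflect (forall i, `|x 0 i| <= e) (`|x| <= e).
Proof.
move=> e0; rewrite [`|x|]/Num.norm/= mx_normrE; apply: (iffP idP).
  move=> /bigmax_leP[_ xe] i; exact: (xe (0, i)).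
by move=> xe; apply/bigmax_leP; split => // -[i j] _ /=; rewrite ord1.
Qed.

Lemma rV_norm_ge n (x : 'rV[R]_n) i : `|x 0 i| <= `|x|.
Proof. by have /rV_norm_leP := lexx `|x|; apply. Qed.

Lemma norm_row_mx_l n (t : R) (v : 'rV[R]_n) :
  `|t| <= `|row_mx (t%:M : 'rV_1) v|.
Proof.
have := rV_norm_ge (row_mx (t%:M : 'rV_1) v) (lshift n 0).
by rewrite row_mxEl mxE mulr1n.
Qed.

Lemma norm_row_mx_r n (t : R) (v : 'rV[R]_n) :
  `|v| <= `|row_mx (t%:M : 'rV_1) v|.
Proof.
apply/rV_norm_leP => // i.
by have := rV_norm_ge (row_mx (t%:M : 'rV_1) v) (rshift 1 i); rewrite row_mxEr.
Qed.

Lemma norm_row_mx_le n (t : R) (v : 'rV[R]_n) (e : R) : `|t| <= e -> `|v| <= e ->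
  `|row_mx (t%:M : 'rV_1) v| <= e.
Proof.
move=> te ve; have e0 : 0 <= e by exact: le_trans te.
apply/rV_norm_leP => // i; rewrite mxE; case: splitP => j _.
  by rewrite ord1 mxE mulr1n.
by apply: le_trans ve; exact: rV_norm_ge.
Qed.

Lemma row_mxB1 n (s t : R) (v w : 'rV[R]_n) :
  row_mx (s%:M : 'rV_1) v - row_mx (t%:M : 'rV_1) w =
  row_mx ((s - t)%:M : 'rV_1) (v - w).
Proof. by rewrite opp_row_mx add_row_mx raddfB. Qed.

Lemma row_mx_eta n (w : 'rV[R]_(1 + n)) :
  w = row_mx ((w 0 0)%:M : 'rV_1) (rsubmx w).
Proof.
rewrite -[LHS]hsubmxK; congr (row_mx _ _).
by apply/rowP => i; rewrite !mxE ord1 mulr1n; congr (w _ _); exact/val_inj.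
Qed.

Lemma add_row_mx_eta n (t : R) (v : 'rV[R]_n) (w : 'rV[R]_(1 + n)) :
  row_mx (t%:M : 'rV_1) v + w = row_mx ((t + w 0 0)%:M : 'rV_1) (v + rsubmx w).
Proof. by rewrite {1}(row_mx_eta w) add_row_mx raddfD. Qed.

(** Only [x] is confined to [K], whereas [y] may leave it, so this says more than uniform continuity
    of the restriction to [K]. Around each point a ball of half the radius of continuity leaves room
    for [y]. *)
Lemma compact_uniform_continuous n (K : set 'rV[R]_n) (f : 'rV[R]_n -> R)
    (e : R) : compact K -> continuous f -> 0 < e ->
  exists2 d : R, 0 < d &
    forall x y, K x -> `|x - y| < d -> `|f x - f y| <= e.
Proof.
move=> cK cf e0.
have e20 : 0 < e / 2 by rewrite divr_gt0.
pose P (d : R) (x : 'rV[R]_n) := forall y, `|x - y| < d -> `|f x - f y| <= e.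
have nearP : \forall d \near 0^'+, K `<=` P d.
  have /compact_near_coveringP := cK; apply => x Kx.
  have /cvgrPdist_le/(_ _ e20)/nbhs_ballP[d /= d0 xd] := cf x.
  have d20 : 0 < d / 2 by rewrite divr_gt0.
  exists (ball x (d / 2), [set r : R | r < d / 2]) => /=.
    split; first exact: nbhsx_ballx.
    exact: nbhs_right_lt.
  move=> [z r] /= [xz rd] y zy.
  have xz' : ball x d z by apply: le_ball xz; lra.
  have xy : ball x d y.
    have -> : d = d / 2 + d / 2 by lra.
    apply: ball_triangle xz _.
    by rewrite -ball_normE/= (lt_trans zy).
  have := xd _ xz'; have := xd _ xy => /= fy fz.
  have -> : f z - f y = (f x - f y) - (f x - f z) by ring.
  by apply: (le_trans (ler_normB _ _)); lra.
have [d [d0 Pd]] := filter_ex (filterI (nbhs_right_gt (0 : R)) nearP).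
by exists d => // x y /Pd; apply.
Qed.

(** The norm is the maximum norm, so [L] is the half-side of a cube containing the support; it is
    kept explicit because the bound on the integral contains the volume (2L)^n. *)
Definition compactly_supported n (L : R) (f : 'rV[R]_n -> R) :=
  continuous f /\ forall x, L < `|x| -> f x = 0.

Lemma compactly_supported_uniform n L (f : 'rV[R]_n -> R) (e : R) :
  compactly_supported L f -> 0 < e ->
  exists2 d : R, 0 < d & forall x y, `|x - y| < d -> `|f x - f y| <= e.
Proof.
move=> [cf f0] e0.
pose K := [set x : 'rV[R]_n | `|x| <= L + 1].
have cK : compact K.
  apply: bounded_closed_compact.
    by exists (L + 1); split; [exact: num_real|move=> M LM]; move=> x /= /le_trans; apply; exact: ltW.
  have -> : K = Num.norm @^-1` [set t | t <= L + 1] by [].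
  apply: closed_comp; last exact: closed_le.
  by move=> x _; exact: norm_continuous.
have [d d0 Kd] := compact_uniform_continuous cK cf e0.
(* If |x| > L + 1, a point at distance less than 1 from [x] is still outside the support, and both
   values are 0. *)
exists (Num.min d 1); first by rewrite lt_min d0 /=.
move=> x y; rewrite lt_min => /andP[xyd xy1].
have [Kx|Kx] := leP `|x| (L + 1); first exact: Kd.
rewrite !f0 ?subrr ?normr0 ?ltW//; last by lra.
have -> : y = x - (x - y) by rewrite opprB addrC subrK.
by have := lerB_dist x (x - y); lra.
Qed.


Lemma compactly_supportedZD n L (k : R) (f g : 'rV[R]_n -> R) :
  compactly_supported L f -> compactly_supported L g ->
  compactly_supported L (fun x => k * f x + g x).
Proof.
move=> [cf f0] [cg g0]; split.
  by move=> x; exact: (cvgD (cvgM (cvg_cst k) (cf x)) (cg x)).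
by move=> x Lx; rewrite f0// g0// mulr0 addr0.
Qed.

Lemma compactly_supported_widen n L L' (f : 'rV[R]_n -> R) : L <= L' ->
  compactly_supported L f -> compactly_supported L' f.
Proof. by move=> LL' [cf f0]; split => // x /(le_lt_trans LL')/f0. Qed.

Lemma compactly_supported_shift n L (f : 'rV[R]_n -> R) w :
  compactly_supported L f -> compactly_supported (L + `|w|) (fun x => f (x + w)).
Proof.
move=> [cf f0]; split.
  move=> x; apply: continuous_comp; last exact: cf.
  exact: (cvgD cvg_id (cvg_cst w)).
move=> x Lx; apply: f0; have := ler_normB (x + w) w; rewrite addrK.
by lra.
Qed.

Lemma continuous_row_mx n (t : R) :
  continuous (fun v : 'rV[R]_n => row_mx (t%:M : 'rV_1) v).
Proof.
move=> v; apply/(@cvgrPdist_le R 'rV[R]_(1 + n) _ (nbhs v)) => e e0; near=> w.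
rewrite row_mxB1 subrr; apply: norm_row_mx_le; first by rewrite normr0 ltW.
by near: w; apply: cvgr_dist_le => //; exact: cvg_id.
Unshelve. all: by end_near. Qed.

Lemma compactly_supported_slice n L (f : 'rV[R]_(1 + n) -> R) (t : R) :
  compactly_supported L f ->
  compactly_supported L (fun v : 'rV[R]_n => f (row_mx t%:M v)).
Proof.
move=> [cf f0]; split.
  by move=> v; apply: continuous_comp; [exact: continuous_row_mx|exact: cf].
by move=> v Lv; apply: f0; apply: lt_le_trans Lv (norm_row_mx_r _ _).
Qed.

Definition slice_integral n (f : 'rV[R]_(1 + n) -> R) (t : R) : R :=
  integral_rV (fun v : 'rV[R]_n => f (row_mx t%:M v)).

Lemma integral_rVS n (f : 'rV[R]_n.+1 -> R) :
  integral_rV f = \int[@lebesgue_measure R]_t slice_integral f t.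
Proof. by []. Qed.

(** The two properties form a single induction hypothesis: together, in dimension n, they give the
    continuity of the slice integrals, without which neither can be proved in dimension n + 1. *)
Definition linear_bounded_integral n (L : R) :=
  (forall (k : R) (f g : 'rV[R]_n -> R), compactly_supported L f ->
    compactly_supported L g ->
    integral_rV (fun x => k * f x + g x) = k * integral_rV f + integral_rV g) /\
  (forall (f : 'rV[R]_n -> R) (B : R), compactly_supported L f ->
    (forall x, `|f x| <= B) -> `|integral_rV f| <= (2 * L) ^+ n * B).

(** By linearity the difference of two slice integrals is the integral of the difference of the
    slices, which is uniformly small by uniform continuity of [f]; the bound turns this into
    smallness of the integral. *)
Lemma linear_bounded_slice n (L : R) (f : 'rV[R]_(1 + n) -> R) : 0 <= L ->
  linear_bounded_integral n L -> compactly_supported L f ->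
  continuous (slice_integral f) /\ forall t, L < `|t| -> slice_integral f t = 0.
Proof.
move=> L0 [lin bnd] cf; split=> t; last first.
  move=> Lt; have f0 v : f (row_mx t%:M v) = 0.
    by apply: cf.2; apply: lt_le_trans Lt _; exact: norm_row_mx_l.
  apply/eqP; rewrite -normr_le0.
  have -> : 0 = (2 * L) ^+ n * 0 :> R by rewrite mulr0.
  by apply: bnd => [|v]; [exact: compactly_supported_slice|rewrite f0 normr0].
apply/cvgrPdist_le => e e0.
pose e' := e / ((2 * L) ^+ n + 1).
have p0 : 0 < (2 * L) ^+ n + 1 by rewrite ltr_wpDl ?exprn_ge0 ?mulr_ge0.
have e'0 : 0 < e' by rewrite divr_gt0.
have [d d0 fd] := compactly_supported_uniform cf e'0.
near=> s.
have -> : slice_integral f t - slice_integral f s = integral_rV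
    (fun v : 'rV[R]_n => -1 * f (row_mx (s%:M : 'rV_1) v) + f (row_mx (t%:M : 'rV_1) v)).
  by rewrite lin ?mulN1r 1?addrC//; exact: compactly_supported_slice.
apply: (@le_trans _ _ ((2 * L) ^+ n * e')).
  apply: bnd => [|v].
    by apply: compactly_supportedZD; exact: compactly_supported_slice.
  rewrite mulN1r addrC; apply: fd; rewrite row_mxB1 subrr.
  apply: (@le_lt_trans _ _ `|t - s|).
    by apply: norm_row_mx_le => //; rewrite normr0.
  by near: s; apply: cvgr_dist_lt => //; exact: cvg_id.
by rewrite /e' mulrA ler_pdivrMr// [leLHS]mulrC ler_pM2l// lerDl.
Unshelve. all: by end_near. Qed.

Lemma integral_rV_linear_bounded n (L : R) : 0 <= L -> linear_bounded_integral n L.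
Proof.
move=> L0; elim: n => [|n IH].
  by split => [//|f B _ fB]; rewrite /= expr0 mul1r.
have [lin bnd] := IH; have slice f cf := @linear_bounded_slice n L f L0 IH cf.
have intE (f : 'rV[R]_n.+1 -> R) : compactly_supported L f -> integral_rV f =
    \int[@lebesgue_measure R]_(t in `[- L, L]) slice_integral f t.
  move=> cf; rewrite integral_rVS (@Rintegral_support _ _ (- L) L)// => t.
  by rewrite in_itv/= -ler_norml -ltNge; exact: (slice f cf).2.
split => [k f g cf cg|f B cf fB].
  rewrite !intE//; last exact: compactly_supportedZD.
  rewrite -Rintegral_segmentZD; [|exact: (slice f cf).1|exact: (slice g cg).1].
  congr (Rintegral _ _ _); apply/funext => t.
  by rewrite /slice_integral -lin//; exact: compactly_supported_slice.
rewrite intE// exprS -mulrA (_ : 2 * L = L - - L); last by ring.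
apply: Rintegral_segment_le; [exact: (slice f cf).1|lra|move=> t _].
rewrite opprK -mulr2n -[L *+ 2]mulr_natl.
by apply: bnd => //; exact: compactly_supported_slice.
Qed.

Lemma compactly_supportedW n L (f : 'rV[R]_n -> R) :
  compactly_supported L f -> compactly_supported `|L| f.
Proof. by apply: compactly_supported_widen; exact: ler_norm. Qed.

Lemma compactly_supported_pair n L L' (f g : 'rV[R]_n -> R) :
  compactly_supported L f -> compactly_supported L' g ->
  exists2 M, 0 <= M & compactly_supported M f /\ compactly_supported M g.
Proof.
move=> cf cg; exists (Num.max `|L| `|L'|).
  by rewrite le_max normr_ge0.
split; [apply: compactly_supported_widen (compactly_supportedW cf)|
  apply: compactly_supported_widen (compactly_supportedW cg)];
  by rewrite le_max lexx ?orbT.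
Qed.

Lemma integral_rVZD n L L' (k : R) (f g : 'rV[R]_n -> R) :
  compactly_supported L f -> compactly_supported L' g ->
  integral_rV (fun x => k * f x + g x) = k * integral_rV f + integral_rV g.
Proof.
move=> cf cg; have [M M0 [cf' cg']] := compactly_supported_pair cf cg.
by have [+ _] := integral_rV_linear_bounded n M0; apply.
Qed.

Lemma le_integral_rV n L (f : 'rV[R]_n -> R) (B : R) : 0 <= L ->
  compactly_supported L f -> (forall x, `|f x| <= B) ->
  `|integral_rV f| <= (2 * L) ^+ n * B.
Proof.
by move=> L0; have [_ +] := integral_rV_linear_bounded n L0; apply.
Qed.

Lemma integral_rV0 n : integral_rV (fun _ : 'rV[R]_n => 0 : R) = 0.
Proof.
have c0 : compactly_supported 0 (fun _ : 'rV[R]_n => 0 : R).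
  by split => // x; exact: cst_continuous.
rewrite -[RHS](addNr (integral_rV (fun _ : 'rV[R]_n => 0 : R))) -mulN1r.
rewrite -(integral_rVZD (-1) c0 c0); congr integral_rV.
by apply/funext => x; rewrite mulr0 addr0.
Qed.

Lemma continuous_slice_integral n L (f : 'rV[R]_(1 + n) -> R) :
  compactly_supported L f -> continuous (slice_integral f).
Proof.
move=> /compactly_supportedW cf; have L0 := normr_ge0 L.
by have [] := linear_bounded_slice L0 (integral_rV_linear_bounded n L0) cf.
Qed.

Lemma slice_integral_supported n L (f : 'rV[R]_(1 + n) -> R) (t : R) :
  compactly_supported L f -> L < `|t| -> slice_integral f t = 0.
Proof.
move=> [_ f0] Lt; rewrite /slice_integral -[RHS](integral_rV0 n).
congr integral_rV; apply/funext => v; apply: f0.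
by apply: lt_le_trans Lt _; exact: norm_row_mx_l.
Qed.

Lemma integral_rV_shift n L (f : 'rV[R]_n -> R) w : compactly_supported L f ->
  integral_rV (fun x => f (x + w)) = integral_rV f.
Proof.
elim: n f w => [|n IH] f w cf.
  by rewrite /= (_ : 0 + w = 0)//; apply/rowP => -[].
rewrite !integral_rVS -(@Rintegral_shift _ (slice_integral f) L (w 0 0)).
- congr (Rintegral _ _ _); apply/funext => t; rewrite /slice_integral.
  rewrite -(IH _ (rsubmx (w : 'rV_(1 + n)))
    (compactly_supported_slice (t + w 0 0) cf)).
  congr integral_rV; apply/funext => v; congr f.
  exact: (add_row_mx_eta t v (w : 'rV_(1 + n))).
- exact: continuous_slice_integral cf.
- by move=> t; exact: slice_integral_supported.
Qed.

Lemma integral_rV_ge0 n (f : 'rV[R]_n -> R) : (forall x, 0 <= f x) ->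
  0 <= integral_rV f.
Proof.
elim: n f => [|n IH] f f0; first exact: f0.
by rewrite integral_rVS; apply: Rintegral_ge0 => t _; exact: IH.
Qed.

Lemma integral_rV_gt0 n L (f : 'rV[R]_n -> R) x : compactly_supported L f ->
  (forall x, 0 <= f x) -> 0 < f x -> 0 < integral_rV f.
Proof.
elim: n f x => [|n IH] f x cf f0 fx.
  by rewrite /= (_ : 0 = x)//; apply/rowP => -[].
have xE := row_mx_eta (x : 'rV_(1 + n)).
rewrite integral_rVS (@Rintegral_gt0 _ _ L (x 0 0))//.
- exact: continuous_slice_integral cf.
- by move=> t; exact: integral_rV_ge0.
- by move=> t; exact: slice_integral_supported.
- apply: (IH _ (rsubmx (x : 'rV_(1 + n)))) => //.
    exact: compactly_supported_slice.
  by rewrite -xE.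
Qed.

Lemma compactly_supported_derive n L (f : 'rV[R]_n -> R^o) v :
  compactly_supported L f -> continuous ('D_v f) ->
  compactly_supported L ('D_v f).
Proof.
move=> [cf f0] cD; split => // x Lx.
rewrite (@near_eq_derive _ _ _ _ (cst 0)) ?derive_cst//.
have : \forall y \near x, L < `|y|.
  by apply: (@cvgr_gt _ _ (nbhs x) _ (fun y : 'rV[R]_n => `|y|) `|x|) => //;
    exact: norm_continuous.
by apply: filterS => y /f0.
Qed.

(* The difference quotients of f in direction v have integral 0 by translation
   invariance, and they converge uniformly to 'D_v f. *)
Lemma integral_rV_derive n L (f : 'rV[R]_n -> R^o) v :
  compactly_supported L f -> (forall x, derivable f x v) ->
  continuous ('D_v f) -> integral_rV ('D_v f) = 0.
Proof.
move=> cf df cD; have cDf := compactly_supported_derive cf cD.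
pose L' := `|L| + `|v|; have L'0 : 0 <= L' by rewrite addr_ge0.
have LL' : L <= L' by rewrite (le_trans (ler_norm L))// lerDl.
apply/eqP; rewrite -normr_le0; apply/ler_addgt0Pl => e e0; rewrite addr0.
pose e' := e / ((2 * L') ^+ n + 1).
have p0 : 0 < (2 * L') ^+ n + 1 by rewrite ltr_wpDl ?exprn_ge0 ?mulr_ge0.
have e'0 : 0 < e' by rewrite divr_gt0.
have [d d0 Dd] := compactly_supported_uniform cDf e'0.
have v0 : 0 < `|v| + 1 by rewrite ltr_wpDl.
have [t /andP[t0 t1] tv] : exists2 t : R, 0 < t <= 1 & t * `|v| < d.
  exists (Num.min 1 (d / 2 / (`|v| + 1))).
    by rewrite lt_min ge_min lexx ltr01 !divr_gt0.
  apply: (@le_lt_trans _ _ (d / 2 / (`|v| + 1) * `|v|)).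
    by rewrite ler_wpM2r// ge_min lexx orbT.
  rewrite mulrAC ltr_pdivrMr//; have := normr_ge0 v; nra.
pose g x := - t^-1 * f (x + t *: v) + (t^-1 * f x + 'D_v f x).
have cfs : compactly_supported L' (fun x => f (x + t *: v)).
  apply: compactly_supported_widen (compactly_supported_shift (t *: v)
    (compactly_supportedW cf)).
  by rewrite lerD2l normrZ gtr0_norm// ler_piMl.
have cf' := compactly_supported_widen LL' cf.
have cDf' := compactly_supported_widen LL' cDf.
have gE : integral_rV g = integral_rV ('D_v f).
  rewrite (@integral_rVZD n L' L')//; last exact: compactly_supportedZD.
  rewrite (integral_rV_shift _ cf) (@integral_rVZD n L' L')//.
  by rewrite addrA mulNr addNr add0r.
rewrite -gE; apply: (@le_trans _ _ ((2 * L') ^+ n * e')); last first.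
  by rewrite /e' mulrA ler_pdivrMr// [leLHS]mulrC ler_pM2l// lerDl.
apply: le_integral_rV => // [|x].
  by do 2 apply: compactly_supportedZD => //.
have [s /andP[s0 st] fs] := mean_value_line x (ltW t0) df.
have -> : g x = 'D_v f x - 'D_v f (x + s *: v).
  rewrite -[in RHS](mulKf (lt0r_neq0 t0) ('D_v f (x + s *: v))) -fs /g.
  by ring.
apply: Dd; rewrite opprD addrA subrr add0r normrN normrZ ger0_norm//.
by apply: le_lt_trans tv; rewrite ler_wpM2r.
Qed.


End compactly_supported.

(** * Bump functions *)

Section flat_functions.
Variable R : realType.
Implicit Types (p : {poly R}) (t : R).

(* Extended by 0 to t <= 0, these functions are smooth, and the derivative of
   one of them is another one (see is_derive_flat). *)
Definition flat p t : R := if 0 < t then p.[t^-1] * expR (- t^-1) else 0.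

(** Put w = u / (k + 1); then exp(u) = exp(w)^(k + 1) >= w^(k + 1). One power more than [k] is taken
    so that a factor 1/u, which becomes t for u = 1/t, is left over. *)
Lemma exprn_expRN_le k (u : R) : 0 < u ->
  u ^+ k * expR (- u) <= k.+1%:R ^+ k.+1 / u.
Proof.
move=> u0; pose w : R := u / k.+1%:R.
have k0 : 0 < k.+1%:R :> R by rewrite ltr0n.
have w0 : 0 < w by rewrite divr_gt0.
have -> : expR (- u) = (expR w ^+ k.+1)^-1.
  by rewrite expRN -expRM_natl /w mulrC divfK ?lt0r_neq0.
have wk : w ^+ k.+1 <= expR w ^+ k.+1.
  rewrite lerXn2r ?nnegrE ?expR_ge0 ?ltW//.
  by rewrite (le_lt_trans _ (expR_gt1Dx (lt0r_neq0 w0)))// lerDr.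
apply: (@le_trans _ _ (u ^+ k * (w ^+ k.+1)^-1)).
  apply: ler_wpM2l; first by rewrite exprn_ge0// ltW.
  by rewrite lef_pV2 ?posrE ?exprn_gt0 ?expR_gt0.
rewrite /w expr_div_n invf_div [u ^+ k.+1]exprS invfM.
have -> : u ^+ k * (k.+1%:R ^+ k.+1 * (u^-1 / u ^+ k)) =
  k.+1%:R ^+ k.+1 / u * (u ^+ k / u ^+ k) by ring.
by rewrite mulfV ?mulr1// expf_neq0// lt0r_neq0.
Qed.

Lemma flat_bound p : exists2 C : R, 0 <= C &
  forall t, `|t| <= 1 -> `|flat p t| <= C * `|t|.
Proof.
pose k := size p; pose A : R := \sum_(i < k) `|p`_i|.
have A0 : 0 <= A by exact: sumr_ge0.
exists (A * k.+1%:R ^+ k.+1); first by rewrite mulr_ge0// exprn_ge0.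
move=> t t1; rewrite /flat; case: ifPn => [t0|_]; last first.
  by rewrite normr0 mulr_ge0// mulr_ge0// exprn_ge0.
have u1 : 1 <= t^-1 by rewrite invf_ge1// (le_trans (ler_norm t)).
have u0 : 0 < t^-1 by rewrite invr_gt0.
have pu : `|p.[t^-1]| <= A * t^-1 ^+ k.
  rewrite horner_coef (le_trans (ler_norm_sum _ _ _))// mulr_suml.
  apply: ler_sum => i _; rewrite normrM ler_wpM2l// normrX (gtr0_norm u0).
  by rewrite ler_weXn2l// ltnW.
rewrite normrM (gtr0_norm (expR_gt0 _)).
apply: (@le_trans _ _ (A * t^-1 ^+ k * expR (- t^-1))).
  by rewrite ler_wpM2r// expR_ge0.
rewrite -!mulrA ler_wpM2l// (gtr0_norm t0).
by have := exprn_expRN_le k u0; rewrite invrK.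
Qed.

Lemma flat_le0 p t : t <= 0 -> flat p t = 0.
Proof. by rewrite /flat leNgt => /negbTE ->. Qed.

(** Thus the difference quotient of [flat p] at 0 is again a flat function, and [flat_bound] makes
    it tend to 0. *)
Lemma flatX p t : flat p t = t * flat ('X * p) t.
Proof.
rewrite /flat; case: ifPn => [t0|]; last by rewrite mulr0.
by rewrite hornerM hornerX -mulrA mulVKf ?lt0r_neq0.
Qed.

(** For t > 0 the derivative of p(1/t) exp(-1/t) is t^(-2) (p - p')(1/t) exp(-1/t), and t^(-2) is
    absorbed into the polynomial as ['X^2]. Only t = 0 needs an estimate. *)
Lemma is_derive_flat p t :
  is_derive (t : R^o) 1 (flat p) (flat ('X^2 * (p - p^`())) t).
Proof.
have [t0|t0|->] := ltgtP t 0.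
- rewrite (flat_le0 _ (ltW t0)).
  apply: (@near_eq_is_derive _ _ _ (cst 0)).
  by have := lt_nbhsl t0; apply: filterS => s /ltW/flat_le0.
- rewrite {2}/flat t0.
  apply: (@near_eq_is_derive _ _ _ (fun s : R => p.[s^-1] * expR (- s^-1))).
    have := lt_nbhsr t0; apply: filterS => s s0.
    by rewrite /flat s0.
  have tn0 : t != 0 by rewrite lt0r_neq0.
  have dV : is_derive (t : R^o) 1 (fun s : R => s^-1) (- t ^- 2).
    have := is_deriveV tn0 (is_derive_id (t : R^o) 1).
    by rewrite [_ *: _]mulr1.
  have dp : is_derive (t : R^o) 1 (fun s : R => p.[s^-1]) (p^`().[t^-1] * - t ^- 2).
    exact: is_derive1_comp.
  have dN : is_derive (t : R^o) 1 (fun s : R => - s^-1) (- - t ^- 2).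
    exact: is_deriveN.
  have de : is_derive (t : R^o) 1 (fun s : R => expR (- s^-1)) (expR (- t^-1) * (- - t ^- 2)).
    exact: is_derive1_comp.
  apply: is_derive_eq.
  rewrite hornerM hornerXn hornerD hornerN -exprVn /GRing.scale/=.
  by ring.
- have [C C0 flatC] := flat_bound ('X * p).
  rewrite {2}/flat ltxx.
  have f0 : flat p 0 = 0 by rewrite /flat ltxx.
  have cvg0 : h^-1 *: (flat p (h *: (1 : R^o) + 0) - flat p 0) @[h --> (0 : R)^'] --> (0 : R^o).
    apply/cvgrPdist_le => e e0; near=> h.
    rewrite sub0r normrN f0 subr0 addr0 [h *: _]mulr1 flatX.
    have h0 : h != 0 by near: h; exact: nbhs_dnbhs_neq.
    rewrite /GRing.scale/= mulKf//.
    have h1 : `|h| <= 1 by near: h; apply: dnbhs0_le.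
    apply: (le_trans (flatC _ h1)).
    apply: (@le_trans _ _ (C * (e / (C + 1)))).
      rewrite ler_wpM2l//; near: h; apply: dnbhs0_le.
      by rewrite divr_gt0// ltr_wpDl.
    by rewrite mulrCA ler_piMr ?(ltW e0)// ler_pdivrMr ?ltr_wpDl// mul1r lerDl.
  by apply: DeriveDef; [apply/cvg_ex; exists 0|exact: cvg_lim].
Unshelve. all: by end_near. Qed.

End flat_functions.

(** * Smooth cutoffs adapted to cubes *)

Section bump_functions.
Variables (R : realType) (n : nat).
Local Notation X := 'rV[R]_n.
Implicit Types (c x : X).

(** The algebra generated by 1/u over the smooth functions. It is stable under derivation because
    D(1/u) = - Du (1/u)^2, hence fits [smooth_coind]. *)
Inductive smooth_with_inverse (u : X -> R^o) : (X -> R^o) -> Prop :=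
| SmoothBase g of smooth g : smooth_with_inverse u g
| SmoothInv : smooth_with_inverse u (fun x => (u x)^-1)
| SmoothAdd g h of smooth_with_inverse u g & smooth_with_inverse u h :
    smooth_with_inverse u (fun x => g x + h x)
| SmoothMul g h of smooth_with_inverse u g & smooth_with_inverse u h :
    smooth_with_inverse u (fun x => g x * h x).

Lemma smoothV (u : X -> R^o) : smooth u -> (forall x, u x != 0) ->
  smooth (fun x => (u x)^-1 : R^o).
Proof.
move=> su u0; pose V (x : X) : R^o := (u x)^-1.
have Vdiff f : smooth_with_inverse u f -> forall x, differentiable f x.
  elim=> {f} [g sg x|x|g h _ dg _ dh x|g h _ dg _ dh x].
  - exact: smooth_differentiable.
  - by apply: differentiableV => //; exact: smooth_differentiable.
  - exact: differentiableD.
  - exact: differentiableM.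
apply: (@smooth_coind R n (smooth_with_inverse u)); last exact: SmoothInv.
move=> f uf; split; first exact: Vdiff.
move=> v; elim: uf => {f} [g sg||g h ug Dg uh Dh|g h ug Dg uh Dh].
- exact/SmoothBase/smooth_derive.
- have -> : 'D_v (fun x => (u x)^-1 : R^o) = fun x => (-1 * 'D_v u x) * (V x * V x).
    apply/funext => x; rewrite deriveV//; last exact: smooth_derivable.
    by rewrite /GRing.scale/= expr2 invfM -/(V x); ring.
  apply: SmoothMul; last by apply: SmoothMul; exact: SmoothInv.
  apply: SmoothBase; apply: smoothM; first exact: smooth_cst.
  exact: smooth_derive.
- have -> : 'D_v (fun x => g x + h x) = fun x => 'D_v g x + 'D_v h x.
    by apply/funext => x; apply: deriveD; exact/diff_derivable/Vdiff.
  exact: SmoothAdd.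
- have -> : 'D_v (fun x => g x * h x) = fun x => 'D_v g x * h x + g x * 'D_v h x.
    by apply/funext => x; apply: derive_fctM; exact/diff_derivable/Vdiff.
  by apply: SmoothAdd; exact: SmoothMul.
Qed.

Lemma rV_norm_attained x (r : R) : 0 < r -> r <= `|x| ->
  exists i, r <= `|x 0 i|.
Proof.
move=> r0 rx; have : mx_norm x != 0 by rewrite lt0r_neq0// (lt_le_trans r0).
by move=> /mx_norm_neq0[[i j] /= E]; exists j; rewrite -(ord1 i) -E.
Qed.

Definition flat_coord (p : {poly R}) (i : 'I_n) (a b : R) : X -> R^o :=
  fun x => flat p (a * x 0 i + b).

(** The stable class consists of the multiples of the [flat_coord p i a b] with [p] varying; the
    scalar collects the inner derivatives a v_i of the chain rule. *)
Lemma smooth_flat_coord p i a b : smooth (flat_coord p i a b).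
Proof.
apply: (@smooth_coind R n [set h | exists C p, h = (fun x => C * flat_coord p i a b x)]);
  last by exists 1, p; apply/funext => x; rewrite mul1r.
move=> _ [C [{}p ->]].
pose w x : R^o := a * x 0 i + b.
have sw : smooth w.
  by apply: smoothD; [apply: smoothM; [exact: smooth_cst|exact: smooth_coord]|exact: smooth_cst].
have dw x : differentiable w x by exact: smooth_differentiable.
have df (t : R) : differentiable (flat p : R^o -> R^o) t.
  by apply/derivable1_diffP; have [] := is_derive_flat p t.
have dfw x : differentiable (flat_coord p i a b) x.
  by rewrite (_ : flat_coord p i a b = flat p \o w)//; exact: differentiable_comp.
split.
  by move=> x; apply: differentiableM => //; exact: differentiable_cst.
move=> v; exists (C * a * v 0 i), ('X^2 * (p - p^`())); apply/funext => x.
rewrite derive_fctM; [|exact: derivable_cst|exact: diff_derivable].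
rewrite derive_cst mul0r add0r; rewrite deriveE// (_ : flat_coord p i a b = flat p \o w)// diff_comp//=.
rewrite deriv1E; last by have [] := is_derive_flat p (w x).
rewrite derive1E; have [_ ->] := is_derive_flat p (w x).
have -> : 'd w x v = 'D_v w x by rewrite deriveE.
have -> : 'D_v w x = a * v 0 i.
  rewrite [LHS](deriveD (f := fun y : X => a * y 0 i : R^o) (g := cst b)); last 2 first.
  - apply/smooth_derivable/smoothM; [exact: smooth_cst|exact: smooth_coord].
  - exact: derivable_cst.
  rewrite derive_cst addr0 derive_fctM; [|exact: derivable_cst|]; last first.
    exact/smooth_derivable/smooth_coord.
  by rewrite derive_cst mul0r add0r derive_coord.
by rewrite /GRing.scale/= /flat_coord -/(w x); ring.
Qed.


(** With h(t) = exp(-1/t) for t > 0 and 0 otherwise, this is the product over i of h(r - (x_i -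
    c_i)) h(r + (x_i - c_i)): for r > 0 it is positive exactly on the open cube. Its product form is
    what the averaging over single coordinates reproduces. *)
Definition bump c (r : R) : X -> R^o := fun x =>
  \prod_i (flat_coord 1 i (-1) (r + c 0 i) x * flat_coord 1 i 1 (r - c 0 i) x).

Lemma flat1_ge0 (t : R) : 0 <= flat 1 t.
Proof. by rewrite /flat; case: ifP => // _; rewrite hornerC mul1r expR_ge0. Qed.

Lemma flat1_gt0 (t : R) : (0 < flat 1 t) = (0 < t).
Proof.
by rewrite /flat; case: ifP; rewrite ?ltxx// => _; rewrite hornerC mul1r expR_gt0.
Qed.

Lemma smooth_bump c r : smooth (bump c r).
Proof.
by apply: smooth_prod => i; apply: smoothM; exact: smooth_flat_coord.
Qed.

Lemma bump_ge0 c r x : 0 <= bump c r x.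
Proof. by apply: prodr_ge0 => i _; rewrite mulr_ge0// flat1_ge0. Qed.

Lemma bump_gt0 c r x : 0 < r -> `|x - c| < r -> 0 < bump c r x.
Proof.
move=> r0 xc; apply: prodr_gt0 => i _.
have := le_lt_trans (rV_norm_ge (x - c) i) xc.
rewrite !mxE ltr_norml => /andP[? ?].
by rewrite mulr_gt0// /flat_coord flat1_gt0; lra.
Qed.

Lemma bump_eq0 c r x : 0 < r -> r <= `|x - c| -> bump c r x = 0.
Proof.
move=> r0 xc.
have [i ri] := rV_norm_attained r0 xc.
rewrite /bump (bigD1 i)//=.
suff -> : flat_coord 1 i (-1) (r + c 0 i) x * flat_coord 1 i 1 (r - c 0 i) x = 0.
  by rewrite mul0r.
move: ri; rewrite !mxE ler_normr => /orP[|] ri.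
  by rewrite /flat_coord flat_le0 ?mul0r//; lra.
by rewrite mulrC /flat_coord flat_le0 ?mul0r//; lra.
Qed.

(** For each face put s = e (x_i - c_i) and take h(r' - s) / (h(r' - s) + h(s - r)), with h(t) =
    exp(-1/t) extended by 0: it is 1 for s <= r and 0 for s >= r'. Since r < r', the two terms of
    the denominator never vanish together. *)
Lemma plateau c (r r' : R) : 0 < r -> r < r' ->
  exists theta : X -> R^o, [/\ smooth theta,
    forall x, `|x - c| <= r -> theta x = 1 &
    forall x, r' <= `|x - c| -> theta x = 0].
Proof.
move=> r0 rr'.
pose num (e : R) (i : 'I_n) : X -> R^o := flat_coord 1 i (- e) (r' + e * c 0 i).
pose den e i : X -> R^o := fun x => num e i x + flat_coord 1 i e (- (e * c 0 i) - r) x.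
have den0 e i x : den e i x != 0.
  rewrite lt0r_neq0// /den /num /flat_coord.
  have [h|h] := ltP (- e * x 0 i + (r' + e * c 0 i)) (r' - r).
    by rewrite ltr_wpDl ?flat1_ge0// flat1_gt0; lra.
  by rewrite ltr_pwDl ?flat1_ge0// flat1_gt0; lra.
have sden e i : smooth (den e i) by apply: smoothD; exact: smooth_flat_coord.
(* e = 1 and e = -1 cut off the two sides of the cube in the i-th coordinate. *)
exists (fun x => \prod_i ((num 1 i x * (den 1 i x)^-1) * (num (-1) i x * (den (-1) i x)^-1))).
split.
- have sq e i : smooth (fun x => num e i x * (den e i x)^-1).
    by apply: smoothM; [exact: smooth_flat_coord|exact: smoothV].
  apply: smooth_prod => i; exact: smoothM (sq 1 i) (sq (-1) i).
- move=> x xc; apply: big1 => i _.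
  have := le_trans (rV_norm_ge (x - c) i) xc.
  rewrite !mxE ler_norml => /andP[? ?].
  have E e : (e == 1) || (e == -1) -> num e i x * (den e i x)^-1 = 1.
    move=> e1; rewrite (_ : num e i x = den e i x) ?mulfV//.
    rewrite /den [X in _ + X]flat_le0 ?addr0//.
    by move: e1 => /orP[/eqP ->|/eqP ->]; lra.
  by rewrite !E ?eqxx ?orbT// mulr1.
- move=> x xc; have [i ri] := rV_norm_attained (lt_trans r0 rr') xc.
  rewrite (bigD1 i)//=; move: ri; rewrite !mxE ler_normr => /orP[|] ri.
    by rewrite [num 1 i x]flat_le0 ?mul0r//; lra.
  by rewrite [num (-1) i x]flat_le0 ?mul0r ?mulr0 ?mul0r//; lra.
Qed.

End bump_functions.

(** * Test functions on a cube modulo derivatives *)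

Section segment_average.
Variables (R : realType) (n : nat).
Local Notation X := 'rV[R]_n.
Local Notation mu := (@lebesgue_measure R).
Implicit Types (f : X -> R^o) (x v w : X) (a b : R).

Definition segment_integral a b v f : X -> R^o :=
  fun x => \int[mu]_(s in `[a, b]) f (s *: v + x).

Lemma continuous_line f v x : continuous f -> continuous (fun s : R => f (s *: v + x)).
Proof.
move=> cf s; apply: continuous_comp; last exact: cf.
exact: (cvgD (cvgZr_tmp cvg_id) (cvg_cst x)).
Qed.

Arguments continuous_line [f] v x _.

Lemma derive_partials f x v : smooth f ->
  'D_v f x = \sum_i v 0 i * 'D_(delta_mx 0 i) f x.
Proof.
move=> sf; have df := smooth_differentiable x sf.
rewrite deriveE// [in LHS](row_sum_delta v) linear_sum; apply: eq_bigr => i _.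
by rewrite linearZ deriveE.
Qed.

Lemma Rintegral_segment_sum (I : Type) (r : seq I) (c : I -> R) (g : I -> R -> R) a b :
  (forall i, continuous (g i)) ->
  \int[mu]_(s in `[a, b]) (\sum_(i <- r) c i * g i s) =
  \sum_(i <- r) c i * \int[mu]_(s in `[a, b]) g i s.
Proof.
move=> cg; elim: r => [|i r IH].
  by under eq_Rintegral do rewrite big_nil; rewrite Rintegral_cst// mul0r big_nil.
under eq_Rintegral do rewrite big_cons.
rewrite Rintegral_segmentZD//; first by rewrite IH big_cons.
elim: r {IH} => [|j r IH].
  by under eq_fun do rewrite big_nil; exact: cst_continuous.
under eq_fun do rewrite big_cons.
by move=> s; exact: (cvgD (cvgM (cvg_cst _) (cg j s)) (IH s)).
Qed.

Lemma compact_line v x a b : compact [set s *: v + x | s in `[a, b]].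
Proof.
apply: continuous_compact; last exact: segment_compact.
apply: continuous_subspaceT => s.
exact: (cvgD (cvgZr_tmp cvg_id) (cvg_cst x)).
Qed.

Arguments compact_line v x a b : clear implicits.

(** The mean value theorem expresses the increment by the derivative along [h] at an intermediate
    point; expanding in partial derivatives reduces the claim to their uniform continuity.
    Uniformity over [K] permits integration of the remainder over a segment. *)
Lemma smooth_first_order f (K : set X) (e : R) : smooth f -> compact K -> 0 < e ->
  exists2 d : R, 0 < d & forall x h, K x -> `|h| < d ->
    `|f (h + x) - f x - 'D_h f x| <= e * `|h|.
Proof.
move=> sf cK e0.
(* There are n partial derivatives to control; dividing by n + 1 covers n = 0 too. *)
pose e' := e / n.+1%:R.
have n0 : 0 < n.+1%:R :> R by rewrite ltr0n.
have e'0 : 0 < e' by rewrite divr_gt0.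
have /choice[d dP] : forall i : 'I_n, exists d : R, 0 < d /\ forall x y : X, K x ->
    `|x - y| < d -> `|'D_(delta_mx 0 i) f x - 'D_(delta_mx 0 i) f y| <= e'.
  move=> i; have cD := smooth_continuous (smooth_derive (delta_mx 0 i) sf).
  by have [d d0 dK] := compact_uniform_continuous cK cD e'0; exists d.
exists (\big[Num.min/1]_i d i).
  by apply: lt_bigmin => [|i _]; [exact: ltr01|have [] := dP i].
move=> x h Kx hd.
have [s /andP[s0 s1]] := mean_value_dir x (fun y => smooth_derivable y h sf).
rewrite [h + x]addrC => ->; rewrite !(derive_partials _ h sf) -sumrB.
apply: (le_trans (ler_norm_sum _ _ _)).
apply: (@le_trans _ _ (\sum_(i < n) e' * `|h|)); last first.
  rewrite sumr_const card_ord -mulrnAl ler_wpM2r// /e' -mulr_natr mulrAC.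
  by rewrite ler_pdivrMr// ler_pM2l// ler_nat.
apply: ler_sum => i _; rewrite -mulrBr normrM mulrC.
apply: ler_pM => //; last exact: rV_norm_ge.
have [_ di] := dP i; rewrite distrC; apply: di => //.
rewrite opprD addrA subrr add0r normrN normrZ ger0_norm//.
apply: (@le_lt_trans _ _ `|h|); first by rewrite ler_piMl.
by apply: (lt_le_trans hd); exact: bigmin_le.
Qed.

(** Differentiation under the integral sign: the first order remainder is at most e |h| / (b - a),
    uniformly along the compact segment, hence its integral is at most e |h|. *)
Lemma segment_integral_derive f v a b x : smooth f -> a < b ->
  differentiable (segment_integral a b v f) x /\
  forall w, 'D_w (segment_integral a b v f) x = segment_integral a b v ('D_w f) x.
Proof.
move=> sf ab.
pose c (i : 'I_n) : R := segment_integral a b v ('D_(delta_mx 0 i) f) x.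
(* The candidate differential is written through partial derivatives, which makes its linearity and
   continuity evident; [LE] identifies it with the integral of the derivative of [f]. *)
pose L0 (h : X) : R^o := \sum_i h 0 i * c i.
have L0lin : linear L0.
  move=> k u w; rewrite /L0 scaler_sumr -big_split/=; apply: eq_bigr => i _.
  by rewrite !mxE mulrDl -mulrA.
pose L : {linear X -> R^o} := HB.pack L0 (GRing.isLinear.Build _ _ _ _ L0 L0lin).
have cL : continuous L.
  apply: smooth_continuous; apply: smooth_sum => i; apply: smoothM.
    exact: smooth_coord.
  exact: smooth_cst.
have cD w := smooth_continuous (smooth_derive w sf).
have cf := smooth_continuous sf.
have LE w : L w = segment_integral a b v ('D_w f) x.
  rewrite /L/= /L0 /segment_integral.
  under [RHS]eq_Rintegral do rewrite derive_partials//.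
  have cDl i := continuous_line v x (cD (delta_mx 0 i)).
  by rewrite (Rintegral_segment_sum _ _ _ _ cDl).
suff [dS SL] : differentiable (segment_integral a b v f) x /\
    'd (segment_integral a b v f) x = L :> (X -> R^o).
  by split => // w; rewrite deriveE// SL LE.
apply/(differentiable_epsP _ _ cL) => e e0.
have ba0 : 0 < b - a by rewrite subr_gt0.
have [d d0 fd] := smooth_first_order sf (compact_line v x a b) (divr_gt0 e0 ba0).
near=> h.
have hd : `|h| < d.
  near: h; apply/nbhs_ballP; exists d => //= z.
  by rewrite -ball_normE /= sub0r normrN.
have c1 := continuous_line v x (cD h).
have c2 := continuous_line v x cf.
have c3 := continuous_line v (h + x) cf.
have c12 : continuous (fun s : R => 'D_h f (s *: v + x) + f (s *: v + x)).
  by move=> s; exact: (cvgD (c1 s) (c2 s)).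
have -> : segment_integral a b v f (h + x) - segment_integral a b v f x - L h =
    \int[mu]_(s in `[a, b]) (- 1 * ('D_h f (s *: v + x) + f (s *: v + x))
      + f (s *: v + (h + x))).
  have cDf := Rintegral_segmentZD 1 a b c1 c2.
  rewrite LE (Rintegral_segmentZD _ _ _ c12 c3).
  under [X in _ = -1 * X + _]eq_Rintegral do rewrite -['D_h f _]mul1r.
  by rewrite cDf /segment_integral; ring.
apply: (@le_trans _ _ ((b - a) * (e / (b - a) * `|h|))); last first.
  by rewrite mulrA mulrCA mulfV ?mulr1// lt0r_neq0.
apply: Rintegral_segment_le; [|exact: ltW|move=> s sab].
  by move=> s; exact: (cvgD (cvgM (cvg_cst _) (c12 s)) (c3 s)).
have -> : - 1 * ('D_h f (s *: v + x) + f (s *: v + x)) + f (s *: v + (h + x)) =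
    f (h + (s *: v + x)) - f (s *: v + x) - 'D_h f (s *: v + x).
  by rewrite [s *: v + (h + x)]addrCA; ring.
apply: fd => //; exists s => //=.
Unshelve. all: by end_near. Qed.

Lemma smooth_segment_integral f v a b : smooth f -> a < b ->
  smooth (segment_integral a b v f).
Proof.
move=> sf ab; apply: (@smooth_coind R n
  [set h | exists2 f, smooth f & h = segment_integral a b v f]); last by exists f.
move=> _ [g sg ->]; split => [x|w].
  by have [] := segment_integral_derive v x sg ab.
exists ('D_w g); first exact: smooth_derive.
by apply/funext => x; have [_] := segment_integral_derive v x sg ab; apply.
Qed.

Lemma segment_integral_ftc f v a b x : smooth f -> a < b ->
  'D_v (segment_integral a b v f) x = f (b *: v + x) - f (a *: v + x).
Proof.
move=> sf ab; have [_ ->] := segment_integral_derive v x sf ab.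
apply: (@Rintegral_segment_ftc R (fun s => 'D_v f (s *: v + x))
  (fun s => f (s *: v + x))) => //.
  exact: (continuous_line v x (smooth_continuous (smooth_derive v sf))).
by move=> t _; apply: is_derive_line; exact: smooth_derivable.
Qed.

End segment_average.
Arguments continuous_line [R n f] v x _.

Lemma Rintegral_supportedZD (R : realType) (k L : R) (f g : R -> R) :
  continuous f -> continuous g ->
  (forall t, L < `|t| -> f t = 0) -> (forall t, L < `|t| -> g t = 0) ->
  \int[@lebesgue_measure R]_t (k * f t + g t) =
  k * \int[@lebesgue_measure R]_t f t + \int[@lebesgue_measure R]_t g t.
Proof.
move=> cf cg f0 g0.
have out (t : R) : t \notin `[- L, L] -> L < `|t|.
  by rewrite in_itv/= -ler_norml -ltNge.
rewrite (@Rintegral_support _ f (- L) L) => [|t /out/f0//].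
rewrite (@Rintegral_support _ g (- L) L) => [|t /out/g0//].
rewrite (@Rintegral_support _ _ (- L) L) => [|t /out Lt]; last first.
  by rewrite f0// g0// mulr0 addr0.
exact: Rintegral_segmentZD.
Qed.

(** * Averaging a function on a cube over one coordinate at a time *)

Section cube.
Variables (R : realType) (n : nat) (c : 'rV[R]_n) (rho : R).
Hypothesis rho0 : 0 < rho.
Local Notation X := 'rV[R]_n.
Local Notation mu := (@lebesgue_measure R).
Local Notation e i := (delta_mx 0 i : X).
Implicit Types (f g : X -> R^o) (x y : X) (i j : 'I_n).

Definition cube_test f := smooth f /\ forall x, rho <= `|x - c| -> f x = 0.

Definition bump1 i : X -> R^o := fun x =>
  flat_coord 1 i (-1) (rho + c 0 i) x * flat_coord 1 i 1 (rho - c 0 i) x.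

Lemma shift_coord_eq i (s : R) x : (s *: e i + x) 0 i = s + x 0 i.
Proof. by rewrite !mxE !eqxx mulr1. Qed.

Lemma shift_coord_neq i j (s : R) x : j != i -> (s *: e i + x) 0 j = x 0 j.
Proof. by move=> /negbTE ji; rewrite !mxE ji eqxx mulr0 add0r. Qed.

Lemma cube_test_coord f j x : cube_test f -> rho <= `|x 0 j - c 0 j| -> f x = 0.
Proof.
move=> [_ f0] xj; apply: f0; apply: le_trans xj _.
by have := rV_norm_ge (x - c) j; rewrite !mxE.
Qed.

Lemma bump1_gt0 i x : `|x 0 i - c 0 i| < rho -> 0 < bump1 i x.
Proof.
rewrite ltr_norml => /andP[? ?].
by rewrite mulr_gt0// /flat_coord flat1_gt0; lra.
Qed.

Lemma bump1_eq0 i x : rho <= `|x 0 i - c 0 i| -> bump1 i x = 0.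
Proof.
rewrite /bump1 ler_normr => /orP[|] ri.
  by rewrite /flat_coord flat_le0 ?mul0r//; lra.
by rewrite mulrC /flat_coord flat_le0 ?mul0r//; lra.
Qed.

Lemma bump1_ge0 i x : 0 <= bump1 i x.
Proof. by rewrite mulr_ge0// flat1_ge0. Qed.

Lemma smooth_bump1 i : smooth (bump1 i).
Proof. by apply: smoothM; exact: smooth_flat_coord. Qed.

Lemma bump1_coord i x y : x 0 i = y 0 i -> bump1 i x = bump1 i y.
Proof. by rewrite /bump1 /flat_coord => ->. Qed.

Definition line_integral i f x : R := \int[mu]_s f (s *: e i + x).

Definition supported_strip i f := forall x, rho <= `|x 0 i - c 0 i| -> f x = 0.

Lemma line_integral_shift i f (t : R) x : continuous f -> supported_strip i f ->
  line_integral i f (t *: e i + x) = line_integral i f x.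
Proof.
move=> cf f0; rewrite /line_integral.
rewrite -[RHS](@Rintegral_shift _ (fun s => f (s *: e i + x))
  (rho + `|x 0 i - c 0 i|) t).
- by congr (Rintegral _ _ _); apply/funext => s; rewrite addrA scalerDl.
- exact: (continuous_line (e i) x cf).
- move=> s sL; apply: f0; rewrite shift_coord_eq -addrA.
  by have := ler_normB (s + (x 0 i - c 0 i)) (x 0 i - c 0 i); rewrite addrK; lra.
Qed.

Lemma segment_line_integral i f (a b : R) x : supported_strip i f ->
  a <= - rho - (x 0 i - c 0 i) -> rho - (x 0 i - c 0 i) <= b ->
  segment_integral a b (e i) f x = line_integral i f x.
Proof.
move=> f0 ax xb; rewrite /line_integral (@Rintegral_support _ _ a b)// => s sab.
apply: f0; rewrite shift_coord_eq leNgt; apply: contra sab.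
by rewrite ltr_norml in_itv/= => /andP[? ?]; apply/andP; split; lra.
Qed.

Lemma line_integral_bump1_gt0 i x : 0 < line_integral i (bump1 i) x.
Proof.
apply: (@Rintegral_gt0 _ (fun s => bump1 i (s *: e i + x))
  (rho + `|x 0 i - c 0 i|) (c 0 i - x 0 i)).
- exact: (continuous_line (e i) x (smooth_continuous (smooth_bump1 i))).
- by move=> s; exact: bump1_ge0.
- move=> s sL; apply: bump1_eq0; rewrite shift_coord_eq -addrA.
  by have := ler_normB (s + (x 0 i - c 0 i)) (x 0 i - c 0 i); rewrite addrK; lra.
- by apply: bump1_gt0; rewrite shift_coord_eq subrK subrr normr0.
Qed.

Lemma line_integral_bump1 i x : line_integral i (bump1 i) x = line_integral i (bump1 i) c.
Proof.
rewrite -(@line_integral_shift i _ (x 0 i - c 0 i) c).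
- congr (Rintegral _ _ _); apply/funext => s; apply: bump1_coord.
  by rewrite !shift_coord_eq subrK.
- exact: smooth_continuous (smooth_bump1 i).
- by move=> y; exact: bump1_eq0.
Qed.

(* Replaces f on each line in direction e i by the multiple of bump1 i that has
   the same integral over the line; the window of integration is large enough
   to contain the support of f whenever bump1 i x != 0. *)
Definition line_average i f : X -> R^o := fun x =>
  (line_integral i (bump1 i) c)^-1 * bump1 i x *
  segment_integral (- (2 * rho)) (2 * rho) (e i) f x.

Lemma line_averageE i f x : supported_strip i f ->
  line_average i f x =
  (line_integral i (bump1 i) c)^-1 * bump1 i x * line_integral i f x.
Proof.
move=> f0; rewrite /line_average.
have [xi|xi] := leP rho `|x 0 i - c 0 i|; first by rewrite bump1_eq0// mulr0 !mul0r.
move: xi; rewrite ltr_norml => /andP[? ?].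
by rewrite segment_line_integral//; lra.
Qed.

Lemma cube_test_line_average i f : cube_test f -> cube_test (line_average i f).
Proof.
have r0 := rho0; move=> cf; have [sf f0] := cf; split.
  apply: smoothM; first by apply: smoothM; [exact: smooth_cst|exact: smooth_bump1].
  by apply: smooth_segment_integral => //; lra.
move=> x xc; rewrite line_averageE; last by move=> y; exact: cube_test_coord.
have [j xj] := rV_norm_attained rho0 xc; rewrite !mxE in xj.
have [ij|ij] := eqVneq j i.
  by rewrite ij in xj; rewrite (bump1_eq0 xj) mulr0 mul0r.
suff -> : line_integral i f x = 0 by rewrite mulr0.
rewrite /line_integral (_ : (fun s => _) = cst 0).
  by rewrite Rintegral_cst// mul0r.
apply/funext => s; apply: (cube_test_coord (j := j)) => //.
by rewrite shift_coord_neq.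
Qed.

Lemma line_integralZD i (k : R) f g x : continuous f -> continuous g ->
  supported_strip i f -> supported_strip i g ->
  line_integral i (fun y => k * f y + g y) x =
  k * line_integral i f x + line_integral i g x.
Proof.
have r0 := rho0; move=> cf cg f0 g0.
have far s : rho + `|x 0 i - c 0 i| < `|s| -> rho <= `|(s *: e i + x) 0 i - c 0 i|.
  move=> sL; rewrite shift_coord_eq -addrA.
  by have := ler_normB (s + (x 0 i - c 0 i)) (x 0 i - c 0 i); rewrite addrK; lra.
apply: (@Rintegral_supportedZD _ _ (rho + `|x 0 i - c 0 i|)
  (fun s => f (s *: e i + x)) (fun s => g (s *: e i + x))).
- exact: (continuous_line (e i) x cf).
- exact: (continuous_line (e i) x cg).
- by move=> s /far; exact: f0.
- by move=> s /far; exact: g0.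
Qed.

Lemma line_integral_line_average i f x : cube_test f ->
  line_integral i (line_average i f) x = line_integral i f x.
Proof.
have r0 := rho0; move=> cf; have [sf _] := cf.
have f0 : supported_strip i f by move=> y; exact: cube_test_coord.
pose N := line_integral i (bump1 i) c.
have N0 : N != 0 by rewrite lt0r_neq0// line_integral_bump1_gt0.
pose z : X -> R^o := fun=> 0.
have z0 : line_integral i z x = 0 by rewrite /line_integral Rintegral_cst// mul0r.
transitivity (line_integral i
    (fun y => N^-1 * line_integral i f x * bump1 i y + z y) x).
  congr (Rintegral _ _ _); apply/funext => s.
  rewrite line_averageE// line_integral_shift//; last exact: smooth_continuous.
  by rewrite -/N /z addr0; ring.
rewrite line_integralZD//; last 3 first.
- exact: smooth_continuous (smooth_bump1 i).
- exact: smooth_continuous (@smooth_cst R n 0).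
- by move=> y; exact: bump1_eq0.
by rewrite z0 addr0 line_integral_bump1 -/N mulrAC mulVf// mul1r.
Qed.

(* f - line_average i f has integral 0 over every line in direction e i, so its
   primitive in that direction vanishes again outside the cube. *)
Lemma line_average_exact i f : cube_test f ->
  exists2 psi, cube_test psi & f = (fun x => line_average i f x + 'D_(e i) psi x).
Proof.
have r0 := rho0; move=> cf; have cA := cube_test_line_average i cf.
pose g : X -> R^o := fun x => -1 * line_average i f x + f x.
have cg : cube_test g.
  split.
    apply: smoothD; last by have [] := cf.
    by apply: smoothM; [exact: smooth_cst|have [] := cA].
  by move=> x xc; rewrite /g (proj2 cA)// (proj2 cf)// mulr0 addr0.
have [sg g0] := cg.
have strip h : cube_test h -> supported_strip i h.
  by move=> ch y; exact: cube_test_coord.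
have g_int x : line_integral i g x = 0.
  rewrite line_integralZD; [|exact: smooth_continuous (proj1 cA)|
    exact: smooth_continuous (proj1 cf)|exact: strip|exact: strip].
  by rewrite line_integral_line_average// mulN1r addNr.
(* For |x - c| < 2 rho the window starts at x_i - 3 rho < c_i - rho, before the support of [g], so
   there [P] is the primitive of [g] from minus infinity. *)
pose P := segment_integral (- (3 * rho)) 0 (e i) g.
have sP : smooth P by apply: smooth_segment_integral => //; lra.
(* Three cases: the line through [x] misses the cube because of another coordinate; or [x] is past
   the cube, the window contains the whole support and the integral is 0 by [g_int]; or [x] is
   before the cube and so is the window. *)
have P0 x : rho <= `|x - c| -> `|x - c| < 2 * rho -> P x = 0.
  move=> xc xc2; have [j xj] := rV_norm_attained rho0 xc; rewrite !mxE in xj.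
  have xi2 := le_lt_trans (rV_norm_ge (x - c) i) xc2.
  rewrite !mxE ltr_norml in xi2; move: xi2 => /andP[xi1 xi2].
  have [ij|ij] := eqVneq j i; last first.
    rewrite /P /segment_integral (_ : (fun s => _) = cst 0).
      by rewrite Rintegral_cst// mul0r.
    apply/funext => s; apply: (cube_test_coord (j := j)) => //.
    by rewrite shift_coord_neq.
  move: xj; rewrite ij ler_normr => /orP[xj|xj].
    by rewrite /P segment_line_integral//; [exact: strip|lra|lra].
  rewrite /P /segment_integral (_ : \int[mu]_(s in _) _ =
    \int[mu]_(s in `[- (3 * rho), 0]) 0); first by rewrite Rintegral_cst// mul0r.
  apply: eq_Rintegral => s; rewrite inE/= in_itv/= => /andP[s1 s2].
  apply: (cube_test_coord (j := i)) => //; rewrite shift_coord_eq ler_normr.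
  by apply/orP; right; lra.
have D x : `|x - c| < 2 * rho -> 'D_(e i) P x = g x.
  move=> xc2; rewrite segment_integral_ftc//; last by lra.
  have xi2 := le_lt_trans (rV_norm_ge (x - c) i) xc2.
  rewrite !mxE ltr_norml in xi2; move: xi2 => /andP[xi1 xi2].
  rewrite scale0r add0r [X in _ - X](_ : _ = 0) ?subr0//.
  apply: (cube_test_coord (j := i)) => //; rewrite shift_coord_eq ler_normr.
  by apply/orP; right; lra.
(* Farther out the window may contain only part of the support, so [P] is cut off. It already
   vanishes on the shell between rho and 2 rho, hence the cut is smooth. *)
pose psi : X -> R^o := fun x => if `|x - c| < 2 * rho then P x else 0.
have norm_cont x : `|y - c| @[y --> x] --> `|x - c|.
  exact: (cvg_norm (cvgB cvg_id (cvg_cst c))).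
have psi_near x : `|x - c| < 2 * rho -> \near x, psi x = P x.
  by move=> /(cvgr_lt _ (norm_cont x)); apply: filterS => y; rewrite /psi => ->.
have psi_far x : rho < `|x - c| -> \near x, psi x = (cst 0 : X -> R^o) x.
  move=> /(cvgr_gt _ (norm_cont x)); apply: filterS => y /ltW yc.
  by rewrite /psi; case: ifPn => // yc2; exact: P0.
exists psi.
  split.
    apply: smooth_near => x.
    have [xc|xc] := ltP `|x - c| (2 * rho); first by exists P => //; exact: psi_near.
    exists (cst 0); first exact: smooth_cst.
    by apply: psi_far; apply: lt_le_trans xc; lra.
  by move=> x xc; rewrite /psi; case: ifPn => // xc2; exact: P0.
apply/funext => x.
have -> : 'D_(e i) psi x = g x.
  have [xc|xc] := ltP `|x - c| (2 * rho).
    by rewrite (near_eq_derive _ (psi_near _ xc)) D.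
  rewrite (near_eq_derive _ (psi_far _ _)) ?derive_cst ?g0//; lra.
by rewrite /g; ring.
Qed.


Lemma cube_testZD (k : R) f g : cube_test f -> cube_test g ->
  cube_test (fun x => k * f x + g x).
Proof.
move=> [sf f0] [sg g0]; split.
  by apply: smoothD => //; apply: smoothM => //; exact: smooth_cst.
by move=> x xc; rewrite f0// g0// mulr0 addr0.
Qed.

Lemma cube_test0 : cube_test (fun=> 0).
Proof. by split; [exact: smooth_cst|]. Qed.

Lemma cube_test_bump : cube_test (bump c rho).
Proof. by split; [exact: smooth_bump|move=> x; exact: bump_eq0]. Qed.

(* After averaging over the coordinates in r, a function is the product of the
   one-variable bumps over r with a function of the other coordinates; the
   cross-multiplied form avoids naming that function. *)
Definition separated (r : seq 'I_n) f := forall x y,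
  (forall j, j \notin r -> x 0 j = y 0 j) ->
  f x * \prod_(j <- r) bump1 j y = f y * \prod_(j <- r) bump1 j x.

Lemma prod_bump1_shift (r : seq 'I_n) i (s : R) x : i \notin r ->
  \prod_(j <- r) bump1 j (s *: e i + x) = \prod_(j <- r) bump1 j x.
Proof.
move=> ir; apply: eq_big_seq => j jr; apply: bump1_coord.
by rewrite shift_coord_neq//; apply: contraNneq ir => <-.
Qed.

Lemma separated_line_average i r f : i \notin r -> cube_test f ->
  separated r f -> separated (i :: r) (line_average i f).
Proof.
move=> ir cf fr x y xy; rewrite !big_cons.
have f0 : supported_strip i f by move=> z; exact: cube_test_coord.
have contf : continuous f by exact: smooth_continuous (proj1 cf).
have cont0 : continuous (fun _ : X => 0 : R^o).
  exact: smooth_continuous (@smooth_cst R n 0).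
have line_integralZ (k : R) z :
    line_integral i (fun y => k * f y : R^o) z = k * line_integral i f z.
  transitivity (line_integral i (fun y => k * f y + 0 : R^o) z).
    by congr (Rintegral _ _ _); apply/funext => s; rewrite addr0.
  rewrite line_integralZD//.
  by rewrite [X in _ + X]Rintegral_cst// mul0r addr0.
rewrite !line_averageE//.
suff E : line_integral i f x * \prod_(j <- r) bump1 j y =
    line_integral i f y * \prod_(j <- r) bump1 j x.
  transitivity ((line_integral i (bump1 i) c)^-1 * bump1 i x * bump1 i y *
    (line_integral i f x * \prod_(j <- r) bump1 j y)); first by ring.
  by rewrite E; ring.
(* [y] is slid along its line until its i-th coordinate is that of [x]. Then [fr] applies to the
   integrands for each value of the parameter, and the line integral of [f] at [y] is unchanged. *)
pose y' := (x 0 i - y 0 i) *: e i + y.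
rewrite -(line_integral_shift (x 0 i - y 0 i) y contf f0) -/y'.
rewrite -(prod_bump1_shift (x 0 i - y 0 i) y ir) -/y'.
rewrite mulrC [RHS]mulrC -!line_integralZ.
congr (Rintegral _ _ _); apply/funext => s; rewrite mulrC [RHS]mulrC.
rewrite -(prod_bump1_shift s x ir) -(prod_bump1_shift s y' ir).
apply: fr => j jr; have [->|ji] := eqVneq j i.
  by rewrite !shift_coord_eq subrK.
by rewrite !shift_coord_neq// xy// inE negb_or ji.
Qed.

(** [G] is total but constrained on functions supported in the cube only, so that a form on test
    functions of [Omega] can be used after an arbitrary extension. *)
Definition kills_derivatives (E : lmodType R) (G : (X -> R^o) -> E) :=
  (forall (k : R) f g, cube_test f -> cube_test g ->
     G (fun x => k * f x + g x) = k *: G f + G g) /\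
  (forall i f, cube_test f -> G ('D_(e i) f) = 0).

(* After averaging over all coordinates only a multiple k of bump c rho is left.
   The constant k does not depend on G, hence it can be computed by taking for G
   the integral. *)
Lemma cube_functional f : cube_test f ->
  exists k : R, forall (E : lmodType R) (G : (X -> R^o) -> E),
    kills_derivatives G -> G f = k *: G (bump c rho).
Proof.
move=> cf.
have [fr [cfr sfr frE]] : exists fr, [/\ cube_test fr,
    separated (index_enum 'I_n) fr &
    forall (E : lmodType R) (G : (X -> R^o) -> E), kills_derivatives G -> G f = G fr].
  elim: (index_enum 'I_n) (index_enum_uniq 'I_n) => [_|i r IH /= /andP[ir ur]].
    exists f; split => // x y xy; rewrite !big_nil !mulr1; congr f.
    by apply/rowP => j; exact: xy.
  have [fr [cfr sfr frE]] := IH ur.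
  exists (line_average i fr); split.
  - exact: cube_test_line_average.
  - exact: separated_line_average.
  - move=> E G kG; rewrite frE//; have [GZD GD] := kG.
    have [psi cpsi psiE] := line_average_exact i cfr.
    have cavg := cube_test_line_average i cfr.
    have cD : cube_test ('D_(e i) psi).
      rewrite (_ : 'D_(e i) psi = fun x => -1 * line_average i fr x + fr x).
        exact: cube_testZD.
      apply/funext => x; have fx := congr1 (@^~ x) psiE; rewrite /= in fx.
      by rewrite fx; ring.
    rewrite {1}psiE (_ : (fun x => _) =
      fun x => 1 * line_average i fr x + 'D_(e i) psi x).
      by rewrite GZD// GD// scale1r addr0.
    by apply/funext => x; rewrite mul1r.
have B0 : 0 < \prod_(j <- index_enum 'I_n) bump1 j c.
  by apply: prodr_gt0 => j _; apply: bump1_gt0; rewrite subrr normr0.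
(* [fr] is separated in all coordinates; comparing [x] with the centre [c], where every one-variable
   bump is positive, gives fr(x) = k bump(x) with this k. *)
exists (fr c / \prod_(j <- index_enum 'I_n) bump1 j c) => E G kG.
rewrite frE//; have [GZD _] := kG.
have G0 : G (fun=> 0) = 0.
  have := GZD (-1) _ _ cube_test0 cube_test0.
  rewrite scaleN1r addNr (_ : (fun _ => _) = fun=> 0)//.
  by apply/funext => x; rewrite mulr0 addr0.
rewrite -[RHS]addr0 -G0 -GZD//; [|exact: cube_test_bump|exact: cube_test0].
congr G; apply/funext => x; rewrite addr0.
have := sfr x c; rewrite -/(bump c rho x) => E1.
rewrite mulrAC -E1 ?mulfK ?lt0r_neq0// => j.
by rewrite mem_index_enum.
Qed.

End cube.

(** * Linear forms killing all derivatives *)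

Section test_function_spaces.
Variables (R : realType) (n : nat) (Omega : set 'rV[R]_n).
Local Notation X := 'rV[R]_n.
Implicit Types (f g : X -> R^o) (x y c : X) (phi psi : testfun Omega).

Lemma testfun_test phi : is_test Omega phi.
Proof. exact: set_mem (testfunP phi). Qed.

Lemma testfun_eq phi psi : phi =1 psi -> phi = psi.
Proof. by move=> pq; apply: val_inj; apply: funext => x; exact: pq. Qed.

Lemma testfun_smooth phi : smooth phi.
Proof. by have [] := testfun_test phi. Qed.

Lemma supp_out f x : ~ supp f x -> f x = 0.
Proof.
by move=> fx; apply: contra_notP fx => /eqP fx; exact: subset_closure.
Qed.

Lemma test_compactly_supported f : is_test Omega f -> exists L, compactly_supported L f.
Proof.
move=> [sf cf _]; have [M [_ MK]] := compact_bounded cf.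
exists (M + 1); split; first exact: smooth_continuous.
move=> x Mx; apply: supp_out => fx.
have M1 : M < M + 1 by rewrite ltrDl.
by have := MK _ M1 x fx; rewrite /= leNgt Mx.
Qed.

Lemma cube_test_is_test c (rho : R) f : cube_test c rho f ->
  (forall x, `|x - c| <= rho -> Omega x) -> is_test Omega f.
Proof.
move=> [sf f0] cO; pose K := [set x : X | `|x - c| <= rho].
have clK : closed K.
  have -> : K = (fun x => `|x - c|) @^-1` [set t | t <= rho] by [].
  apply: closed_comp; last exact: closed_le.
  by move=> x _; exact: (cvg_norm (cvgB cvg_id (cvg_cst c))).
have cK : compact K.
  apply: bounded_closed_compact => //; exists (rho + `|c|); split.
    exact: num_real.
  move=> M M1 x /= xc; apply: ltW; apply: le_lt_trans M1.
  by rewrite -[x](subrK c) (le_trans (ler_normD _ _))// lerD2r.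
have fK : supp f `<=` K.
  rewrite /supp (closure_id K).1//; apply: closureS => x /= fx.
  by rewrite /K/= leNgt; apply: contra fx => /ltW/f0 ->.
split => //; first by apply: subclosed_compact fK => //; exact: closed_closure.
by move=> x /fK; exact: cO.
Qed.

Lemma is_testM f g : is_test Omega f -> smooth g -> is_test Omega (fun x => f x * g x).
Proof.
move=> [sf cf fO] sg.
have sub : supp (fun x => f x * g x : R^o) `<=` supp f.
  by apply: closureS => x /=; apply: contra => /eqP ->; rewrite mul0r.
split; first exact: smoothM.
  by apply: subclosed_compact sub => //; exact: closed_closure.
exact: subset_trans fO.
Qed.

Definition testint phi : R := integral_rV phi.

Lemma testintZD (k : R) phi psi : testint (k *: phi + psi) = k * testint phi + testint psi.
Proof.
have [L cL] := test_compactly_supported (testfun_test phi).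
have [L' cL'] := test_compactly_supported (testfun_test psi).
by rewrite -(integral_rVZD k cL cL').
Qed.

Lemma testint_derive v phi : testint (test_derive v phi) = 0.
Proof.
have [L cL] := test_compactly_supported (testfun_test phi).
have sphi := testfun_smooth phi.
apply: (integral_rV_derive cL) => [x|].
  exact: smooth_derivable.
exact: smooth_continuous (smooth_derive v sphi).
Qed.

Section constant_functional.
Variables (E : lmodType R) (G : testfun Omega -> E).
Hypothesis linG : forall (k : R) phi psi, G (k *: phi + psi) = k *: G phi + G psi.
Hypothesis dG : forall v phi, G (test_derive v phi) = 0.

(* The value 0 off the test functions is never used. *)
Definition extension f : E :=
  if pselect (is_test Omega f) is left tf then G (TestFun (mem_set tf)) else 0.

Lemma extensionE phi : extension phi = G phi.
Proof.
rewrite /extension; case: pselect => [tf|]; last by move: (testfun_test phi).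
by congr G; exact: testfun_eq.
Qed.

Lemma extension_kills c (rho : R) : (forall x, `|x - c| <= rho -> Omega x) ->
  kills_derivatives c rho extension.
Proof.
move=> cO; split=> [k f g cf cg|i f cf].
  have tf := cube_test_is_test cf cO; have tg := cube_test_is_test cg cO.
  pose phi := TestFun (mem_set tf); pose psi := TestFun (mem_set tg).
  by rewrite -[f]/(phi : X -> R^o) -[g]/(psi : X -> R^o) !extensionE -linG -extensionE.
have tf := cube_test_is_test cf cO; pose phi := TestFun (mem_set tf).
by rewrite -[f]/(phi : X -> R^o) -(dG (delta_mx 0 i) phi) -extensionE.
Qed.

End constant_functional.

(** * From constancy on small cubes to constancy on a connected open set *)

Section locally_constant.
Variables (E : lmodType R) (G : testfun Omega -> E).
Hypothesis linG : forall (k : R) phi psi, G (k *: phi + psi) = k *: G phi + G psi.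
Hypothesis dG : forall v phi, G (test_derive v phi) = 0.

Definition constant_near (a : E) c (rho : R) := forall phi,
  (forall x, rho <= `|x - c| -> phi x = 0) -> G phi = testint phi *: a.

Lemma testint_gt0 phi x : (forall y, 0 <= phi y) -> 0 < phi x -> 0 < testint phi.
Proof.
move=> p0 px; have [L cL] := test_compactly_supported (testfun_test phi).
exact: (integral_rV_gt0 cL p0 px).
Qed.

Lemma bump_test c (rho : R) : 0 < rho -> (forall x, `|x - c| <= rho -> Omega x) ->
  exists beta : testfun Omega, beta = bump c rho :> (X -> R^o) /\ 0 < testint beta.
Proof.
move=> rho0 cO; have tb := cube_test_is_test (cube_test_bump c rho0) cO.
exists (TestFun (mem_set tb)); split => //; apply: (@testint_gt0 _ c) => [y|] /=.
  exact: bump_ge0.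
by apply: bump_gt0 => //; rewrite subrr normr0.
Qed.

Lemma constant_near_center c (rho : R) : 0 < rho ->
  (forall x, `|x - c| <= rho -> Omega x) -> exists a, constant_near a c rho.
Proof.
move=> rho0 cO; have [beta [betaE b0]] := bump_test rho0 cO.
exists ((testint beta)^-1 *: G beta) => phi phi0.
have cphi : cube_test c rho phi by split => //; exact: testfun_smooth.
have [k kE] := cube_functional rho0 cphi.
have := kE _ _ (extension_kills linG dG cO); rewrite -betaE !extensionE => ->.
pose I : testfun Omega -> R^o := @testint.
have linI (r : R) psi psi' : I (r *: psi + psi') = r *: I psi + I psi'.
  exact: testintZD.
have := kE _ _ (extension_kills linI (@testint_derive) cO).
rewrite -betaE !extensionE /I => ->.
rewrite scalerA [k *: testint beta]/GRing.scale/= -mulrA mulfV ?mulr1//.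
by rewrite lt0r_neq0.
Qed.

Lemma constant_near_sub a c c' (rho rho' : R) : constant_near a c rho ->
  `|c' - c| + rho' <= rho -> constant_near a c' rho'.
Proof.
move=> ac cc' phi phi0; apply: ac => x xc; apply: phi0.
have := ler_normD (x - c') (c' - c); rewrite addrA subrK; lra.
Qed.

Lemma constant_near_unique a a' c (rho : R) : 0 < rho ->
  (forall x, `|x - c| <= rho -> Omega x) ->
  constant_near a c rho -> constant_near a' c rho -> a = a'.
Proof.
move=> rho0 cO aP a'P; have [beta [betaE b0]] := bump_test rho0 cO.
have beta0 x : rho <= `|x - c| -> beta x = 0 by rewrite betaE; exact: bump_eq0.
have := a'P _ beta0; rewrite (aP _ beta0) => /(congr1 (GRing.scale (testint beta)^-1)).
by rewrite !scalerA mulVf ?scale1r ?lt0r_neq0.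
Qed.

Lemma open_closed_ball (U : set X) x : open U -> U x ->
  exists2 rho : R, 0 < rho & forall y, `|y - x| <= rho -> U y.
Proof.
move=> oU Ux; have /nbhs_ballP[r /= r0 xU] : nbhs x U by exact: open_nbhs_nbhs.
exists (r / 2); first by rewrite divr_gt0.
move=> y yx; apply: xU; rewrite -ball_normE /= distrC.
by apply: le_lt_trans yx _; lra.
Qed.

(** The points near which the constant is [a] form an open set. Its complement in [Omega] is open
    too: if a cube with constant a' contains such a point, both constants are valid on a smaller
    cube about that point, and a bump function there forces a = a'. *)
Lemma constant_near_everywhere : open Omega -> connected Omega -> Omega !=set0 ->
  exists a, forall x, Omega x -> exists2 rho : R, 0 < rho & constant_near a x rho.
Proof.
move=> oO cO [x0 Ox0].
have [rho0 rho00 x0O] := open_closed_ball oO Ox0.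
have [a a_x0] := constant_near_center rho00 x0O; exists a.
pose A := [set x | Omega x /\ exists2 rho : R, 0 < rho & constant_near a x rho].
have oA : open A.
  rewrite openE => x [Ox [rho r0 ax]]; apply/nbhs_ballP.
  have [r r00 xO] := open_closed_ball oO Ox.
  exists (Num.min r (rho / 2)) => [|y]; first by rewrite /= lt_min r00 divr_gt0.
  rewrite -ball_normE /= distrC lt_min => /andP[yr yrho]; split.
    by apply: xO; exact: ltW.
  exists (rho / 2); first by rewrite divr_gt0.
  by apply: constant_near_sub ax _; lra.
pose B := Omega `\` A.
have oB : open B.
  rewrite openE => x [Ox nAx]; apply/nbhs_ballP.
  have [rho r0 xO] := open_closed_ball oO Ox.
  have [a' a'x] := constant_near_center r0 xO.
  exists (rho / 2) => [|y]; first by rewrite /= divr_gt0.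
  rewrite -ball_normE /= distrC => yx; split; first by apply: xO; lra.
  move=> [Oy [r r1 ay]]; apply: nAx; split => //; exists rho => //.
  suff -> : a = a' by [].
  pose d := Num.min r (rho / 2).
  have d0 : 0 < d by rewrite lt_min r1 divr_gt0.
  have d1 : d <= r by rewrite ge_min lexx.
  have d2 : d <= rho / 2 by rewrite ge_min lexx orbT.
  apply: (@constant_near_unique _ _ y d) => //.
  - move=> z zy; apply: xO; have := ler_normD (z - y) (y - x).
    by rewrite addrA subrK; lra.
  - by apply: constant_near_sub ay _; rewrite subrr normr0 add0r.
  - by apply: constant_near_sub a'x _; lra.
suff AO : A = Omega by move=> x; rewrite -{1}AO => -[].
apply: cO.
- by exists x0; split => //; exists rho0.
- by exists A => //; apply/seteqP; split => [x [Ox ?]|x []].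
- exists (~` B); first exact: open_closedC.
  apply/seteqP; split => [x [Ox Ax]|x [Ox nB]].
    by split => // -[_]; apply.
  by apply: contrapT => nAx; apply: nB.
Qed.

(** The support is covered by finitely many half-size cubes, and these are removed one by one: psi =
    psi theta + psi (1 - theta) with a plateau theta that is 1 on the half cube and supported in the
    full one. The first term is handled on its cube, and the second is supported in the remaining
    half cubes. *)
Lemma constant_functional : open Omega -> connected Omega -> Omega !=set0 ->
  exists a : E, forall phi, G phi = testint phi *: a.
Proof.
move=> oO cO nO; have [a aP] := constant_near_everywhere oO cO nO; exists a => phi.
have /choice[rho rhoP] : forall x, exists rho : R, 0 < rho /\
    (Omega x -> constant_near a x rho).
  move=> x; have [/aP[rho r0 ax]|] := pselect (Omega x); first by exists rho.
  by exists 1.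
have cover_ind (s : seq X) : {in s, forall x, Omega x} -> forall psi : testfun Omega,
    (supp psi `<=` \bigcup_(x in [set` s]) ball x (rho x / 2)) ->
    G psi = testint psi *: a.
  elim: s => [|x s IH] sO psi psis.
    have -> : psi = -1 *: psi + psi.
      apply: testfun_eq => x; rewrite scaleN1r addNr; apply: supp_out => /psis.
      by move=> [].
    by rewrite linG testintZD !scaleN1r mulN1r !addNr scale0r.
  have [rx ax] := rhoP x.
  have r2 : rho x / 2 < rho x by lra.
  have r20 : 0 < rho x / 2 by lra.
  have [theta [stheta theta1 theta0]] := plateau x r20 r2.
  have tpsi := is_testM (testfun_test psi) stheta.
  pose psi1 := TestFun (mem_set tpsi).
  pose psi2 : testfun Omega := -1 *: psi1 + psi.
  have psi2E y : psi2 y = - (psi y * theta y) + psi y by rewrite -mulN1r.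
  have psiE : psi = 1 *: psi1 + psi2 by rewrite scale1r /psi2 scaleN1r addrA subrr add0r.
  rewrite psiE linG testintZD scalerDl -scalerA; congr (_ *: _ + _).
    apply: ax; first by apply: sO; rewrite mem_head.
    by move=> y /theta0 ty; rewrite /= ty mulr0.
  apply: IH.
    by move=> y ys; apply: sO; rewrite inE ys orbT.
  move=> y ypsi2.
  have ypsi : supp psi y.
    move: y ypsi2; apply: closureS => y; rewrite /mkset; apply: contra => /eqP py.
    by rewrite psi2E py mul0r oppr0 addr0.
  have [z /= zs yz] := psis _ ypsi.
  exists z => //=; move: zs; rewrite inE => /orP[/eqP zx|//].
  (* A point of the support of [psi2] cannot lie in the open half cube about [x], since [psi2]
     vanishes on this whole neighbourhood. *)
  have ny : nbhs y (ball x (rho x / 2)).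
    by apply: open_nbhs_nbhs; split; [exact: ball_open|rewrite -zx].
  have [w [w0 xw]] := ypsi2 _ ny.
  have {}w0 : psi2 w != 0 := w0; move/eqP: w0; case.
  rewrite psi2E theta1 ?mulr1 ?addNr//.
  by move: xw; rewrite -ball_normE/= distrC => /ltW.
have cK : compact (supp phi) by have [] := testfun_test phi.
rewrite compact_cover in cK.
have [||D DO Dphi] := cK X (supp phi) (fun x => ball x (rho x / 2)).
- by move=> x _; apply: ball_open; have [] := rhoP x; rewrite divr_gt0.
- move=> x xphi; exists x => //; apply: ballxx; have [rx _] := rhoP x.
  by rewrite divr_gt0.
apply: (cover_ind (finmap.enum_fset D)) => [x xD|x /Dphi[y yD xy]]; last by exists y.
have [_ _ phiO] := testfun_test phi.
by apply: phiO; have := DO x xD; rewrite inE.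
Qed.

End locally_constant.
End test_function_spaces.

(** * Symmetric tensors and polynomials *)

Section multilinear_maps.
Variables (R : realType) (n m : nat).
Local Notation X := 'rV[R]_n.
Local Notation Y := 'rV[R]_m.

Definition prepend k (v : X) (y : 'I_k -> X) : 'I_k.+1 -> X :=
  fun i => oapp y v (unlift ord0 i).

Lemma prepend0 k (v : X) (y : 'I_k -> X) : prepend v y ord0 = v.
Proof. by rewrite /prepend unlift_none. Qed.

Lemma prependS k (v : X) (y : 'I_k -> X) i : prepend v y (lift ord0 i) = y i.
Proof. by rewrite /prepend liftK. Qed.

Lemma eq_prepend k (v : X) (y : 'I_k -> X) (z : 'I_k.+1 -> X) :
  z ord0 = v -> (forall i, z (lift ord0 i) = y i) -> z = prepend v y.
Proof.
move=> z0 zS; apply/funext => i; case: (unliftP ord0 i) => [j ->|->].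
  by rewrite zS prependS.
by rewrite z0 prepend0.
Qed.

Lemma prepend_eta k (x : 'I_k.+1 -> X) : x = prepend (x ord0) (x \o lift ord0).
Proof. exact: eq_prepend. Qed.

Lemma prepend_const k (x : X) : (fun=> x) = prepend x (fun _ : 'I_k => x).
Proof. exact: eq_prepend. Qed.

Lemma prepend_update k v (y : 'I_k -> X) i w :
  prepend v [eta y with i |-> w] = [eta prepend v y with lift ord0 i |-> w].
Proof.
apply/esym/eq_prepend => [|j] /=; first by rewrite prepend0.
by rewrite (inj_eq lift_inj) prependS.
Qed.

Lemma prepend_update0 k v w (y : 'I_k -> X) :
  prepend v y = [eta prepend w y with ord0 |-> v].
Proof. by apply/esym/eq_prepend => [|j] //=; rewrite prependS. Qed.

Implicit Types (v w x : X).

Definition slice k (T : ('I_k.+1 -> X) -> Y) v : ('I_k -> X) -> Y :=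
  fun y => T (prepend v y).

Lemma slice_multilinear k (T : ('I_k.+1 -> X) -> Y) v :
  multilinear T -> multilinear (slice T v).
Proof.
move=> mT i x a u w; rewrite /slice !prepend_update.
exact: mT.
Qed.

Lemma sliceP k (T : ('I_k.+1 -> X) -> Y) a v w y : multilinear T ->
  slice T (a *: v + w) y = a *: slice T v y + slice T w y.
Proof.
move=> mT; rewrite /slice (prepend_update0 _ 0) mT.
by rewrite -!prepend_update0.
Qed.

Lemma slice_sum k (T : ('I_k.+1 -> X) -> Y) v y : multilinear T ->
  slice T v y = \sum_i v 0 i *: slice T (delta_mx 0 i) y.
Proof.
move=> mT; rewrite [in LHS](row_sum_delta v).
have s0 : slice T 0 y = 0.
  by have := sliceP (-1) 0 0 y mT; rewrite scaler0 addr0 scaleN1r addNr.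
elim: (index_enum _) => [|i r IH]; first by rewrite !big_nil.
by rewrite !big_cons sliceP// IH.
Qed.

Lemma slice_symmetric k (T : ('I_k.+1 -> X) -> Y) v :
  symmetric_map T -> symmetric_map (slice T v).
Proof.
move=> sT s x; rewrite /slice -[RHS](sT (lift_perm ord0 ord0 s)); congr T.
apply/esym/eq_prepend => [|i] /=; first by rewrite lift_perm_id prepend0.
by rewrite lift_perm_lift prependS.
Qed.

Lemma slice_Sym k (T : ('I_k.+1 -> X) -> Y) v : Sym n m k.+1 T -> Sym n m k (slice T v).
Proof.
by move=> [mT sT]; split; [exact: slice_multilinear|exact: slice_symmetric].
Qed.

Lemma slice_comm k (T : ('I_k.+2 -> X) -> Y) v w : symmetric_map T ->
  slice (slice T v) w = slice (slice T w) v.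
Proof.
move=> sT; apply/funext => y; rewrite /slice.
rewrite -[LHS](sT (tperm ord0 (lift ord0 ord0))); congr T.
apply: eq_prepend => [|i] /=; first by rewrite tpermL prependS prepend0.
case: (unliftP ord0 i) => [j ->|->].
  by rewrite tpermD// !prependS.
by rewrite tpermR !prepend0.
Qed.

Definition diag k (T : ('I_k -> X) -> Y) : X -> Y := fun x => T (fun=> x).

(** [smooth] concerns scalar functions, so polynomials are differentiated one component at a
    time. *)
Definition diag_coord k (T : ('I_k -> X) -> Y) (j : 'I_m) : X -> R^o :=
  fun x => diag T x 0 j.

Lemma diag0 (T : ('I_0 -> X) -> Y) (y z : 'I_0 -> X) : T y = T z.
Proof. by congr T; apply/funext => -[]. Qed.

Lemma diagS k (T : ('I_k.+1 -> X) -> Y) x : multilinear T ->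
  diag T x = \sum_i x 0 i *: diag (slice T (delta_mx 0 i)) x.
Proof.
by move=> mT; rewrite /diag prepend_const -[LHS]/(slice T x _) slice_sum.
Qed.

Lemma diag_coordS k (T : ('I_k.+1 -> X) -> Y) j : multilinear T ->
  diag_coord T j = fun x => \sum_i x 0 i * diag_coord (slice T (delta_mx 0 i)) j x.
Proof.
move=> mT; apply/funext => x; rewrite /diag_coord diagS// summxE.
by apply: eq_bigr => i _; rewrite mxE.
Qed.

Lemma smooth_diag_coord k (T : ('I_k -> X) -> Y) j : multilinear T ->
  smooth (diag_coord T j).
Proof.
elim: k T => [|k IH] T mT.
  rewrite (_ : diag_coord T j = fun=> diag_coord T j 0); first exact: smooth_cst.
  by apply/funext => x; rewrite /diag_coord /diag (diag0 T (fun=> x) (fun=> 0)).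
rewrite diag_coordS//; apply: smooth_sum => i; apply: smoothM.
  exact: smooth_coord.
exact/IH/slice_multilinear.
Qed.

Lemma derive_diag_coord0 (T : ('I_0 -> X) -> Y) j v : 'D_v (diag_coord T j) = fun=> 0.
Proof.
rewrite (_ : diag_coord T j = cst (diag_coord T j 0)).
  by apply/funext => x; exact: derive_cst.
by apply/funext => x; rewrite /diag_coord /diag (diag0 T (fun=> x) (fun=> 0)).
Qed.

Lemma derive_fct_sum (I : Type) (r : seq I) (F : I -> X -> R^o) x v :
  (forall i, smooth (F i)) ->
  'D_v (fun y => \sum_(i <- r) F i y : R^o) x = \sum_(i <- r) 'D_v (F i) x.
Proof.
move=> sF; elim: r => [|i r IH].
  rewrite big_nil (_ : (fun y => _) = cst 0) ?derive_cst//.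
  by apply/funext => y; rewrite big_nil.
rewrite big_cons -IH -deriveD; [|exact: smooth_derivable|]; last first.
  by apply: smooth_derivable; exact: smooth_sum.
by congr ('D_v _ x); apply/funext => y; rewrite big_cons.
Qed.

(** Write T(x, ..., x) as the sum of x_i T(e_i, x, ..., x). In the Leibniz rule the derivatives of
    the x_i contribute T(v, x, ..., x) once; by induction the other terms contribute it k times,
    after [slice_comm] has exchanged v and e_i. *)
Lemma derive_diag_coord k (T : ('I_k.+1 -> X) -> Y) j v : Sym n m k.+1 T ->
  'D_v (diag_coord T j) = fun x => k.+1%:R * diag_coord (slice T v) j x.
Proof.
elim: k T => [|k IH] T ST; have [mT sT] := ST; apply/funext => x.
- rewrite diag_coordS// derive_fct_sum; last first.
    move=> i; apply: smoothM; first exact: smooth_coord.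
    exact/smooth_diag_coord/slice_multilinear.
  rewrite mul1r /diag_coord [in RHS]/diag slice_sum// summxE.
  apply: eq_bigr => i _; rewrite (@derive_fctM _ _ (fun y => y 0 i)
      (diag_coord (slice T (delta_mx 0 i)) j)); first last.
  + exact/smooth_derivable/smooth_diag_coord/slice_multilinear.
  + exact/smooth_derivable/smooth_coord.
  by rewrite (congr1 (@^~ x) (derive_diag_coord0 _ _ _)) mulr0 addr0 derive_coord mxE.
- rewrite diag_coordS// derive_fct_sum; last first.
    move=> i; apply: smoothM; first exact: smooth_coord.
    exact/smooth_diag_coord/slice_multilinear.
  transitivity (\sum_i (v 0 i * diag_coord (slice T (delta_mx 0 i)) j x +
      k.+1%:R * (x 0 i * diag_coord (slice (slice T v) (delta_mx 0 i)) j x))).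
    apply: eq_bigr => i _; rewrite (@derive_fctM _ _ (fun y => y 0 i)
      (diag_coord (slice T (delta_mx 0 i)) j)); first last.
    + exact/smooth_derivable/smooth_diag_coord/slice_multilinear.
    + exact/smooth_derivable/smooth_coord.
    rewrite (congr1 (@^~ x) (IH _ (slice_Sym (delta_mx 0 i) ST)))/=.
    by rewrite derive_coord slice_comm//; ring.
  rewrite big_split/= -mulr_sumr.
  have := congr1 (@^~ x) (diag_coordS j (slice_multilinear v mT)) => /= <-.
  have -> : \sum_i v 0 i * diag_coord (slice T (delta_mx 0 i)) j x =
      diag_coord (slice T v) j x.
    rewrite /diag_coord [in RHS]/diag slice_sum// summxE.
    by apply: eq_bigr => i _; rewrite mxE.
  by rewrite [in RHS]mulrS; ring.
Qed.

Lemma iter_derive0 s : iter_derive s (fun _ : X => 0 : R^o) = fun=> 0.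
Proof.
elim: s => [//|v s /= ->]; apply/funext => x; exact: derive_cst.
Qed.

Lemma iter_deriveD s (f g : X -> R^o) : smooth f -> smooth g ->
  iter_derive s (fun x => f x + g x) = fun x => iter_derive s f x + iter_derive s g x.
Proof.
by move=> sf sg; have := iter_deriveZD s 1 sf sg; rewrite !scale1r.
Qed.

Lemma iter_deriveZ s (k : R) (f : X -> R^o) : smooth f ->
  iter_derive s (fun x => k * f x) = fun x => k * iter_derive s f x.
Proof.
move=> sf; have s0 : smooth (0 : X -> R^o) by exact: smooth_cst.
have := iter_deriveZD s k sf s0.
by rewrite (iter_derive0 s : iter_derive s 0 = 0) !addr0.
Qed.

(** Polarization: it recovers a symmetric tensor from its polynomial, one factor of k! coming from
    each application of [derive_diag_coord]. *)
Lemma iter_derive_diag_coord k (T : ('I_k -> X) -> Y) j (x : 'I_k -> X) :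
  Sym n m k T ->
  iter_derive [seq x i | i <- enum 'I_k] (diag_coord T j) = fun=> k`!%:R * T x 0 j.
Proof.
elim: k T x => [|k IH] T x ST; have [mT sT] := ST.
  rewrite enum_ord0/=; apply/funext => y.
  by rewrite fact0 mul1r /diag_coord /diag (diag0 T (fun=> y) x).
rewrite enum_ordSl/= -map_comp.
have sd : smooth (diag_coord (slice T (x ord0)) j).
  exact/smooth_diag_coord/slice_multilinear.
rewrite -iter_derive_comm1; last exact: smooth_diag_coord.
rewrite derive_diag_coord// iter_deriveZ//; apply/funext => y.
rewrite (IH _ (x \o lift ord0)); last exact: slice_Sym.
by rewrite /slice -prepend_eta factS natrM mulrA.
Qed.

Lemma iter_derive_diag_coord_gt k (T : ('I_k -> X) -> Y) j s :
  Sym n m k T -> (k < size s)%N -> iter_derive s (diag_coord T j) = fun=> 0.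
Proof.
elim: k T s => [|k IH] T [//|v s] ST ks /=; have [mT sT] := ST;
  rewrite -iter_derive_comm1; try exact: smooth_diag_coord.
  by rewrite derive_diag_coord0 iter_derive0.
have sd : smooth (diag_coord (slice T v) j).
  exact/smooth_diag_coord/slice_multilinear.
rewrite derive_diag_coord// iter_deriveZ// IH//; last exact: slice_Sym.
by apply/funext => x; rewrite mulr0.
Qed.

End multilinear_maps.

Local Opaque diff.

(** * Distributional and C^1 solutions *)

Section homomorphisms.
Variables (R : realType) (n m : nat).
Local Notation X := 'rV[R]_n.
Local Notation Y := 'rV[R]_m.

Lemma linfunE (f : X -> Y) : linear f -> linfun f =1 f.
Proof.
move=> lf v.
pose F : {linear X -> Y} := HB.pack f (GRing.isLinear.Build _ _ _ _ f lf).
exact: (lfunE F v).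
Qed.

Definition unit_hom (i : 'I_n) (j : 'I_m) : 'Hom(X, Y) :=
  linfun (fun v : X => v 0 i *: delta_mx 0 j : Y).

Lemma unit_homE i j v : unit_hom i j v = v 0 i *: delta_mx 0 j.
Proof.
by apply: linfunE => a u w; rewrite !mxE scalerDl scalerA.
Qed.

Lemma hom_sum_unit (A : 'Hom(X, Y)) :
  A = \sum_i \sum_j (A (delta_mx 0 i) 0 j) *: unit_hom i j.
Proof.
apply/lfunP => v; rewrite [in LHS](row_sum_delta v) linear_sum sum_lfunE.
apply: eq_bigr => i _; rewrite linearZ/= sum_lfunE.
rewrite [in LHS](row_sum_delta (A (delta_mx 0 i))) scaler_sumr.
apply: eq_bigr => j _; rewrite scale_lfunE unit_homE !scalerA mulrC.
by [].
Qed.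

Lemma functional_sum_unit (l : {linear 'Hom(X, Y) -> R^o}) (A : 'Hom(X, Y)) :
  l A = \sum_i \sum_j (A (delta_mx 0 i) 0 j) * l (unit_hom i j).
Proof.
rewrite {1}(hom_sum_unit A) linear_sum; apply: eq_bigr => i _.
by rewrite linear_sum; apply: eq_bigr => j _; rewrite linearZ.
Qed.

(** The functionals used are the coordinates of A - proj_V(A), which vanish on V. This turns the
    weak condition on DF into membership in V for each test function. *)
Lemma mem_vspace_functional (V : {vspace 'Hom(X, Y)}) (B : 'Hom(X, Y)) :
  (forall l : {linear 'Hom(X, Y) -> R^o}, (forall A, A \in V -> l A = 0) -> l B = 0) ->
  B \in V.
Proof.
move=> lB; suff /eqP : B - projv V B = 0.
  by rewrite subr_eq0 => /eqP ->; exact: memv_proj.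
rewrite (coord_vbasis (memvf (B - projv V B))) big1// => i _.
pose f A : R^o := coord (vbasis fullv) i (A - projv V A).
have fl : linear f.
  move=> a u w; rewrite /f [projv V _]linearP opprD addrACA -scalerBr.
  by rewrite linearP.
pose l : {linear 'Hom(X, Y) -> R^o} := HB.pack f (GRing.isLinear.Build _ _ _ _ f fl).
have -> : coord (vbasis fullv) i (B - projv V B) = l B by [].
rewrite lB ?scale0r// => A AV.
by rewrite -[LHS]/(f A) /f projv_id// subrr linear0.
Qed.

End homomorphisms.

(** * Tensors formed by the derivatives of a distribution *)

Section distributional_tensors.
Variables (R : realType) (n m : nat) (Omega : set 'rV[R]_n).
Local Notation X := 'rV[R]_n.
Local Notation Y := 'rV[R]_m.
Local Notation D := (testfun Omega).
Implicit Types (phi psi : D) (F : D -> Y) (v w : X).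

Definition iter_test (s : seq X) phi : D := foldr (@test_derive R n Omega) phi s.

Lemma iter_testE s phi : iter_test s phi = iter_derive s phi :> (X -> R^o).
Proof. by elim: s => [//|v s /= <-]. Qed.

Lemma iter_test_perm s1 s2 phi : perm_eq s1 s2 -> iter_test s1 phi = iter_test s2 phi.
Proof.
move=> s12; apply: testfun_eq => x; rewrite !iter_testE.
by rewrite (iter_derive_perm (testfun_smooth phi) s12).
Qed.

Lemma iter_test_rcons s v phi : iter_test (rcons s v) phi = iter_test s (test_derive v phi).
Proof. by rewrite /iter_test foldr_rcons. Qed.

Lemma test_derive_linear (k : R) v w phi :
  test_derive (k *: v + w) phi = k *: test_derive v phi + test_derive w phi.
Proof.
by apply: testfun_eq => x; apply: smooth_derive_is_linear; exact: testfun_smooth.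
Qed.

Lemma test_deriveZD (k : R) v phi psi :
  test_derive v (k *: phi + psi) = k *: test_derive v phi + test_derive v psi.
Proof.
apply: testfun_eq => x.
have := congr1 (@^~ x) (iter_deriveZD [:: v] k (testfun_smooth phi) (testfun_smooth psi)).
by [].
Qed.

Lemma iter_testZD s (k : R) phi psi :
  iter_test s (k *: phi + psi) = k *: iter_test s phi + iter_test s psi.
Proof. by elim: s => [//|v s /= ->]; exact: test_deriveZD. Qed.

(** The k-th derivative of [F] tested against [phi] is (-1)^k times this; the sign is omitted
    because it does not affect membership in [M V k]. *)
Definition tensor F phi k (x : 'I_k -> X) : Y := F (iter_test [seq x i | i <- enum 'I_k] phi).

Lemma perm_enum_rem k (i : 'I_k) : perm_eq (enum 'I_k) (i :: rem i (enum 'I_k)).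
Proof. by apply: perm_to_rem; rewrite mem_enum. Qed.

(** Since derivatives commute, the i-th one may be taken last, which displays the dependence on the
    i-th argument as v |-> F(d_v psi) with psi fixed. *)
Lemma tensor_update F phi k (x : 'I_k -> X) i v :
  tensor F phi [eta x with i |-> v] =
  F (test_derive v (iter_test [seq x j | j <- rem i (enum 'I_k)] phi)).
Proof.
rewrite /tensor (iter_test_perm _ (perm_map _ (perm_enum_rem i))) /= eqxx.
congr (F (test_derive v (iter_test _ phi))).
apply/eq_in_map => j; rewrite rem_filter ?enum_uniq// mem_filter => /andP[/= + _].
by move=> /negbTE ->.
Qed.

Lemma tensor_Sym F phi k : linear F -> Sym n m k (tensor F phi (k := k)).
Proof.
move=> lF; split.
  by move=> i x a v w; rewrite !tensor_update test_derive_linear lF.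
move=> s x; rewrite /tensor; congr F; apply: iter_test_perm.
rewrite (map_comp x s); apply: (perm_map x); apply: uniq_perm.
- by rewrite map_inj_uniq ?enum_uniq//; exact: perm_inj.
- exact: enum_uniq.
- move=> i; rewrite mem_enum; apply/mapP; exists (s^-1%g i); first by rewrite mem_enum.
  by rewrite permKV.
Qed.

Variable V : {vspace 'Hom(X, Y)}.

Lemma distD_mem F phi : Sigma_distr Omega V F -> distD F phi \in V.
Proof. by move=> [_ Fl]; apply: mem_vspace_functional => l lV; exact: Fl. Qed.

Lemma distD_linear F phi : linear F -> linear (fun v => - F (test_derive v phi)).
Proof.
by move=> lF a v w /=; rewrite test_derive_linear lF opprD scalerN.
Qed.

(** With all arguments but the last fixed, the tensor is minus DF tested against the derivative of
    [phi] along the fixed arguments, an operator in V. *)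
Lemma tensor_M F phi k : Sigma_distr Omega V F -> M V k (tensor F phi (k := k)).
Proof.
move=> SF; have [[lF _] _] := SF.
case: k => [|k]; first exact: tensor_Sym.
split; first exact: tensor_Sym.
move=> x; have := distD_mem
  (iter_test [seq x j | j <- rem ord_max (enum 'I_k.+1)] phi) SF.
rewrite -memvN; congr (_ \in V); apply/lfunP => v.
have lT := (tensor_Sym phi k.+1 lF).1 ord_max x.
rewrite (linfunE lT) opp_lfunE /distD (linfunE (distD_linear _ lF)) opprK.
by rewrite tensor_update.
Qed.

Lemma Sigma_distr_submod : is_vector_space (Sigma_distr Omega V).
Proof.
split.
  rewrite inE; split; first split.
  - by move=> a phi psi /=; rewrite scaler0 addr0.
  - move=> K cK KO; exists 0, 0%N => phi _ B _.
    by rewrite normr0 mul0r.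
  - move=> l _ phi; rewrite (_ : distD _ phi = 0) ?linear0//.
    apply/lfunP => v; rewrite linfunE ?oppr0 ?lfunE//.
    by move=> a u w /=; rewrite !oppr0 scaler0 addr0.
move=> a F G; rewrite !inE => -[[lF bF] FV] [[lG bG] GV].
have lFG : linear (a *: F + G).
  move=> k phi psi; rewrite !fctE lF lG !scalerDr !scalerA addrACA.
  by rewrite [a * k]mulrC.
split; first split => //.
- move=> K cK KO; have [C [N CN]] := bF K cK KO; have [C' [N' CN']] := bG K cK KO.
  exists (`|a| * C + C'), (maxn N N') => phi phiK B pB.
  rewrite mulrDl -mulrA (le_trans (ler_normD _ _))// lerD//.
    rewrite normrZ ler_wpM2l//; apply: CN => // s x sN; apply: pB.
    by rewrite (leq_trans sN)// leq_maxl.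
  by apply: CN' => // s x sN; apply: pB; rewrite (leq_trans sN)// leq_maxr.
- move=> l lV phi.
  rewrite (_ : distD _ phi = a *: distD F phi + distD G phi).
    by rewrite linearP FV// GV// scaler0 addr0.
  apply/lfunP => v; rewrite add_lfunE scale_lfunE /distD !linfunE.
  - by rewrite opprD scalerN.
  - exact: distD_linear.
  - exact: distD_linear.
  - exact: distD_linear.
Qed.

End distributional_tensors.

(** * C^1 solutions as distributional solutions *)

Section integration_by_parts.
Variables (R : realType) (n m : nat) (Omega : set 'rV[R]_n).
Hypothesis openOmega : open Omega.
Local Notation X := 'rV[R]_n.
Local Notation Y := 'rV[R]_m.
Local Notation D := (testfun Omega).
Implicit Types (phi psi : D) (h : X -> R^o) (v w x : X) (F G : X -> Y).

Lemma continuous_sum_at (I : Type) (r : seq I) (f : I -> X -> R) x :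
  (forall i, {for x, continuous (f i)}) ->
  {for x, continuous (fun y => \sum_(i <- r) f i y)}.
Proof.
move=> cf; elim: r => [|i r IH].
  rewrite (_ : (fun y => _) = cst 0); first exact: cst_continuous.
  by apply/funext => y; rewrite big_nil.
rewrite (_ : (fun y => _) = fun y => f i y + \sum_(i <- r) f i y).
  exact: (cvgD (cf i) IH).
by apply/funext => y; rewrite big_cons.
Qed.

Definition C1_scalar h := forall x, Omega x ->
  differentiable h x /\ forall v, {for x, continuous ('D_v h)}.

Lemma smooth_C1_scalar h : smooth h -> C1_scalar h.
Proof.
move=> sh x _; split; first exact: smooth_differentiable.
by move=> v; exact: smooth_continuous (smooth_derive v sh) x.
Qed.

Lemma near_Omega x : Omega x -> \forall y \near x, Omega y.
Proof. by move=> Ox; exact: open_nbhs_nbhs. Qed.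

Lemma near_test_out phi x : ~ Omega x -> \near x, phi x = 0.
Proof.
move=> nOx; have : nbhs x (~` supp phi).
  apply: open_nbhs_nbhs; split; last first.
    by have [_ _ phiO] := testfun_test phi; move=> /phiO.
  by apply: closed_openC; exact: closed_closure.
by apply: filterS => y; exact: supp_out.
Qed.

(** [h] is controlled on [Omega] only, but [phi] vanishes in a neighbourhood of every point outside
    [Omega], so the product is continuous on the whole space. *)
Lemma test_mul_supported L phi h : (forall x, Omega x -> {for x, continuous h}) ->
  compactly_supported L phi -> compactly_supported L (fun x => phi x * h x).
Proof.
move=> ch [cp p0]; split => [x|x Lx]; last by rewrite p0// mul0r.
have [Ox|nOx] := pselect (Omega x).
  exact: (cvgM (cp x) (ch x Ox)).
have np := near_test_out phi nOx.
have E : {near x, cst 0 =1 (fun y => phi y * h y)}.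
  by apply: filterS np => y /= ->; rewrite mul0r.
apply: (cvg_trans (near_eq_cvg E)).
by rewrite (nbhs_singleton np) mul0r; exact: cvg_cst.
Qed.

Lemma derive_test_mul phi h x v : C1_scalar h ->
  derivable (fun y => phi y * h y : R^o) x v /\
  'D_v (fun y => phi y * h y : R^o) x = 'D_v phi x * h x + phi x * 'D_v h x.
Proof.
move=> Ch; have [Ox|nOx] := pselect (Omega x).
  have dh : derivable h x v by apply: diff_derivable; have [] := Ch x Ox.
  have dp : derivable phi x v by apply: smooth_derivable; exact: testfun_smooth.
  by split; [exact: derivableM dp dh|exact: derive_fctM dp dh].
have np := near_test_out phi nOx.
have nph : \near x, cst 0 x = phi x * h x.
  by apply: filterS np => y ->; rewrite mul0r.
split; first by apply: near_eq_derivable nph _; exact: derivable_cst.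
rewrite -(near_eq_derive v nph) derive_cst (near_eq_derive v (g := cst 0) np).
by rewrite derive_cst mul0r (nbhs_singleton np) mul0r addr0.
Qed.

Lemma C1_scalar_continuous h x : C1_scalar h -> Omega x -> {for x, continuous h}.
Proof. by move=> Ch Ox; apply: differentiable_continuous; have [] := Ch x Ox. Qed.

(** The derivative of the compactly supported product phi h has integral 0. *)
Lemma test_parts phi h v : C1_scalar h ->
  integral_rV (fun x => test_derive v phi x * h x) =
  - integral_rV (fun x => phi x * 'D_v h x).
Proof.
move=> Ch; have [L cL] := test_compactly_supported (testfun_test phi).
have [L' cL'] := test_compactly_supported (testfun_test (test_derive v phi)).
have ch x : Omega x -> {for x, continuous h} by exact: C1_scalar_continuous.
have cDh x : Omega x -> {for x, continuous ('D_v h)} by move=> /Ch[_]; apply.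
have c1 := test_mul_supported ch cL'.
have c2 := test_mul_supported cDh cL.
have c3 := test_mul_supported ch cL.
have E : 'D_v (fun y => phi y * h y : R^o) =
    fun x => 1 * (test_derive v phi x * h x) + phi x * 'D_v h x.
  by apply/funext => x; rewrite (derive_test_mul phi x v Ch).2 mul1r.
have [M M0 [d1 d2]] := compactly_supported_pair c1 c2.
have := integral_rV_derive c3 (fun x => (derive_test_mul phi x v Ch).1).
rewrite E (integral_rVZD 1 c1 c2) mul1r => I0.
apply/eqP; rewrite -addr_eq0; apply/eqP; apply: I0.
by have [] := compactly_supportedZD 1 d1 d2.
Qed.

Lemma C1_coord F j : C1_on Omega F -> C1_scalar (fun x => F x 0 j).
Proof.
move=> CF x Ox; have [dF cJ] := CF x Ox.
have dFj y : Omega y -> differentiable (fun x => F x 0 j : R^o) y.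
  move=> Oy; have [dFy _] := CF y Oy.
  rewrite (_ : (fun x => _) = (fun M : Y => M 0 j : R^o) \o F)//.
  by apply: differentiable_comp => //; exact: differentiable_coord.
split; first exact: dFj.
move=> v.
have E y : Omega y -> 'D_v (fun x => F x 0 j : R^o) y = \sum_i v 0 i * jacobian F y i j.
  move=> Oy; have [dFy _] := CF y Oy.
  have := congr1 (fun M : Y => M 0 j) (deriveEjacobian v dFy).
  rewrite mxE => <-.
  by rewrite derive_mx ?mxE//; exact: diff_derivable.
have nE : {near x, (fun y => \sum_i v 0 i * jacobian F y i j) =1
    'D_v (fun x => F x 0 j : R^o)}.
  by apply: filterS (near_Omega Ox) => y Oy; rewrite E.
apply: (cvg_trans (near_eq_cvg nE)).
rewrite E//.
have cJij i : {for x, continuous (fun y => jacobian F y i j)}.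
  apply: (@continuous_comp _ _ _ (jacobian F) (fun M : 'M[R]_(n, m) => M i j)).
    exact: cJ.
  exact: coord_continuous.
apply: (@continuous_sum_at _ _ (fun i y => v 0 i * jacobian F y i j)) => i.
exact: (cvgM (cvg_cst (v 0 i)) (cJij i)).
Qed.

Definition solution (V : {vspace 'Hom(X, Y)}) F :=
  C1_on Omega F /\ forall x, Omega x -> linfun ('d F x) \in V.

Lemma linfun_diff F x v j : Omega x -> C1_on Omega F ->
  linfun ('d F x) v 0 j = 'D_v (fun y => F y 0 j : R^o) x.
Proof.
move=> Ox CF; have [dF _] := CF x Ox.
rewrite lfunE/= -deriveE// derive_mx ?mxE//.
exact: diff_derivable.
Qed.

Lemma linfun_diff_mem (V : {vspace 'Hom(X, Y)}) F x (A : 'Hom(X, Y)) :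
  (forall v, A v = 'd F x v) -> A \in V -> linfun ('d F x) \in V.
Proof. by move=> AF; congr (_ \in V); apply/lfunP => v; rewrite lfunE. Qed.

Lemma jacobianE F x i j : jacobian F x i j = 'd F x (delta_mx 0 i) 0 j.
Proof. by rewrite /jacobian /lin1_mx mxE. Qed.

Lemma solutionZD V (a : R) F G : solution V F -> solution V G ->
  solution V (a *: F + G).
Proof.
move=> [CF FV] [CG GV].
have dFG x v : Omega x -> 'd (a *: F + G) x v = a *: 'd F x v + 'd G x v.
  move=> Ox; have [dF _] := CF x Ox; have [dG _] := CG x Ox.
  have dZ := differentiableZ a dF.
  have dvF : derivable F x v := diff_derivable dF.
  have dvG : derivable G x v := diff_derivable dG.
  have dvZ : derivable (a *: F) x v := diff_derivable dZ.
  have EF : 'D_v F x = 'd F x v by exact: deriveE.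
  have EG : 'D_v G x = 'd G x v by exact: deriveE.
  have EFG : 'D_v (a *: F + G) x = 'd (a *: F + G) x v.
    by apply: deriveE; exact: differentiableD.
  have EZ : 'D_v (a *: F) x = a *: 'd F x v.
    exact: (etrans (deriveZ a dvF) (congr1 (GRing.scale a) EF)).
  exact: (etrans (esym EFG) (etrans (deriveD dvZ dvG) (congr2 +%R EZ EG))).
split=> x Ox; have [dF cF] := CF x Ox; have [dG cG] := CG x Ox.
- split; first by apply: differentiableD => //; exact: differentiableZ.
  have nJ : {near x, (fun y => a *: jacobian F y + jacobian G y) =1
      jacobian (a *: F + G)}.
    apply: filterS (near_Omega Ox) => y Oy; apply/matrixP => i j.
    have mxZD p q (A B : 'M[R]_(p, q)) k l : (a *: A + B) k l = a * A k l + B k l.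
      by rewrite !mxE.
    apply: (etrans (mxZD _ _ _ _ _ _)).
    apply: (etrans (congr2 (fun s t => a * s + t) (jacobianE F y i j) (jacobianE G y i j))).
    apply: (etrans (esym (mxZD _ _ _ _ _ _))).
    exact: (esym (etrans (jacobianE _ _ _ _)
      (congr1 (fun M : Y => M 0 j) (dFG y (delta_mx 0 i) Oy)))).
  apply: (cvg_trans (near_eq_cvg nJ)).
  rewrite -(nbhs_singleton nJ).
  exact: (cvgD (cvgZ (cvg_cst a) cF) cG).
- apply: (@linfun_diff_mem _ _ _ (a *: linfun ('d F x) + linfun ('d G x))).
    have homZD (A B : 'Hom(X, Y)) v : (a *: A + B) v = a *: A v + B v.
      by rewrite add_lfunE scale_lfunE.
    move=> v; apply: (etrans (homZD _ _ _)).
    apply: (etrans (congr2 (fun s t => a *: s + t) (lfunE ('d F x) v) (lfunE ('d G x) v))).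
    exact: (esym (dFG x v Ox)).
  by rewrite rpredD ?rpredZ// ?FV ?GV.
Qed.

Lemma solution0 V : solution V 0.
Proof.
have d0 x : 'd (0 : X -> Y) x = 0 :> (X -> Y) by exact: diff_cst.
split=> x Ox; last first.
  apply: (@linfun_diff_mem _ _ _ 0); last exact: mem0v.
  by move=> v; rewrite lfunE d0.
split; first exact: differentiable_cst.
rewrite (_ : jacobian 0 = cst 0); first exact: cst_continuous.
apply/funext => y; apply/row_matrixP => i.
by rewrite /jacobian !rowE mul_rV_lin1 d0 mulmx0.
Qed.

Lemma distr_ofE F phi j :
  distr_of Omega F phi 0 j = integral_rV (fun x => phi x * F x 0 j).
Proof. by rewrite mxE. Qed.

Lemma distr_of_linear F : (forall x, Omega x -> {for x, continuous F}) ->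
  linear (distr_of Omega F).
Proof.
move=> cF k phi psi; apply/rowP => j.
have cFj x : Omega x -> {for x, continuous (fun y => F y 0 j)}.
  move=> Ox; apply: (@continuous_comp _ _ _ F (fun M : Y => M 0 j)); first exact: cF.
  exact: coord_continuous.
have [L cL] := test_compactly_supported (testfun_test phi).
have [L' cL'] := test_compactly_supported (testfun_test psi).
rewrite !mxE -(integral_rVZD k (test_mul_supported cFj cL) (test_mul_supported cFj cL')).
congr integral_rV; apply/funext => x.
by rewrite mulrA -mulrDl.
Qed.

Lemma distr_of_bounded F (K : set X) : (forall x, Omega x -> {for x, continuous F}) ->
  compact K -> K `<=` Omega ->
  exists C : R, forall phi, supp phi `<=` K -> forall B : R,
    (forall x, `|phi x| <= B) -> `|distr_of Omega F phi| <= C * B.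
Proof.
move=> cF cK KO.
have [M [_ KM]] := compact_bounded cK.
(* The constant will be the volume of a cube containing [K] times a bound of [F] on [K]: the
   distribution of a continuous function has order 0. *)
have cFK : compact (F @` K).
  apply: continuous_compact => //; apply: continuous_in_subspaceT => x.
  by rewrite inE => /KO; exact: cF.
have [N [_ FN]] := compact_bounded cFK.
pose L := `|M| + 1; pose b := `|N| + 1.
have L0 : 0 <= L by rewrite addr_ge0.
have b0 : 0 <= b by rewrite addr_ge0.
have Kb x : K x -> `|F x| <= b.
  move=> Kx; apply: (FN b); last by exists x.
  by rewrite (le_lt_trans (ler_norm N))// ltrDl.
have KL x : K x -> `|x| <= L.
  by move=> Kx; apply: (KM L) => //; rewrite (le_lt_trans (ler_norm M))// ltrDl.
exists ((2 * L) ^+ n * b) => phi phiK B pB.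
have B0 : 0 <= B by apply: le_trans (pB 0).
apply/rV_norm_leP => [|j]; first by rewrite !mulr_ge0// exprn_ge0// mulr_ge0.
have cL : compactly_supported L phi.
  split; first exact/smooth_continuous/testfun_smooth.
  by move=> x Lx; apply: supp_out => /phiK/KL; rewrite leNgt Lx.
have cFj x : Omega x -> {for x, continuous (fun y => F y 0 j)}.
  move=> Ox; apply: (@continuous_comp _ _ _ F (fun M : Y => M 0 j)); first exact: cF.
  exact: coord_continuous.
rewrite distr_ofE -mulrA; apply: le_integral_rV => //.
  exact: test_mul_supported.
move=> x; have [xK|xK] := pselect (K x).
  rewrite normrM mulrC ler_pM//.
  by apply: le_trans (Kb x xK); exact: rV_norm_ge.
by rewrite (supp_out (f := phi)) ?mul0r ?normr0 ?mulr_ge0// => /phiK.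
Qed.

Lemma C1_continuous F x : C1_on Omega F -> Omega x -> {for x, continuous F}.
Proof. by move=> CF Ox; apply: differentiable_continuous; have [] := CF x Ox. Qed.

Lemma integral_rV_sum (I : Type) (r : seq I) (a : I -> R) (f : I -> X -> R) (L : R) :
  (forall i, compactly_supported L (f i)) ->
  integral_rV (fun x => \sum_(i <- r) a i * f i x) =
  \sum_(i <- r) a i * integral_rV (f i).
Proof.
move=> cf; suff [] : compactly_supported L (fun x => \sum_(i <- r) a i * f i x) /\
    integral_rV (fun x => \sum_(i <- r) a i * f i x) =
    \sum_(i <- r) a i * integral_rV (f i) by [].
elim: r => [|i r [cr IH]].
  rewrite big_nil (_ : (fun x => _) = fun=> 0).
    by split; [split => [x|//]; exact: cst_continuous|exact: integral_rV0].
  by apply/funext => x; rewrite big_nil.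
rewrite big_cons (_ : (fun x => _) =
    fun x => a i * f i x + \sum_(i <- r) a i * f i x); last first.
  by apply/funext => x; rewrite big_cons.
split; first exact: compactly_supportedZD.
by rewrite (integral_rVZD _ (cf i) cr) IH.
Qed.

(** Expanding [l] in the matrix units and integrating by parts gives l(DF)(phi) as the integral of
    phi(x) l(DF(x)), whose integrand is 0 at every point. *)
Lemma distr_of_solution V F : solution V F -> Sigma_distr Omega V (distr_of Omega F).
Proof.
move=> [CF FV]; have cF x : Omega x -> {for x, continuous F}.
  exact: C1_continuous.
have lF := distr_of_linear cF.
split; first split => //.
  move=> K cK KO; have [C CP] := distr_of_bounded cF cK KO.
  exists C, 0%N => phi phiK B pB; apply: CP => // x.
  exact: (pB [::] x).
move=> l lV phi; rewrite functional_sum_unit.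
have [L cL] := test_compactly_supported (testfun_test phi).
have Dj i j x : Omega x ->
    {for x, continuous ('D_(delta_mx 0 i) (fun y => F y 0 j : R^o))}.
  by move=> Ox; have [_] := C1_coord j CF Ox; apply.
pose a (ij : 'I_n * 'I_m) : R := l (unit_hom R ij.1 ij.2).
pose f (ij : 'I_n * 'I_m) x : R :=
  phi x * 'D_(delta_mx 0 ij.1) (fun y => F y 0 ij.2 : R^o) x.
have cf ij : compactly_supported L (f ij).
  by apply: test_mul_supported cL => x; exact: Dj.
transitivity (\sum_i \sum_j a (i, j) * integral_rV (f (i, j))).
  apply: eq_bigr => i _; apply: eq_bigr => j _; rewrite mulrC; congr (_ * _).
  rewrite linfunE; last exact: distD_linear.
  rewrite mxE distr_ofE (test_parts _ _ (C1_coord j CF)) opprK.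
  by [].
rewrite pair_big/= -(integral_rV_sum _ _ cf) -[RHS](integral_rV0 R n).
congr integral_rV; apply/funext => x.
have [Ox|nOx] := pselect (Omega x); last first.
  rewrite big1// => ij _; rewrite /f (nbhs_singleton (near_test_out phi nOx)).
  by rewrite mul0r mulr0.
transitivity (phi x * l (linfun ('d F x))); last by rewrite lV ?mulr0//; exact: FV.
rewrite functional_sum_unit pair_big/= mulr_sumr; apply: eq_bigr => -[i j] _ /=.
by rewrite linfun_diff// /a /f/=; ring.
Qed.

End integration_by_parts.

(** * Polynomial solutions *)

Section polynomials.
Variables (R : realType) (n m : nat) (Omega : set 'rV[R]_n).
Hypothesis openOmega : open Omega.
Variable V : {vspace 'Hom('rV[R]_n, 'rV[R]_m)}.
Local Notation X := 'rV[R]_n.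
Local Notation Y := 'rV[R]_m.

Lemma M_Sym k (T : ('I_k -> X) -> Y) : M V k T -> Sym n m k T.
Proof. by case: k T => [|k] T // []. Qed.

Lemma smooth_coords_differentiable (F : X -> Y) x :
  (forall j, smooth (fun y => F y 0 j : R^o)) -> differentiable F x.
Proof.
move=> sF.
rewrite (_ : F = \sum_(j < m) (fun y => F y 0 j *: (delta_mx 0 j : Y))).
  apply: differentiable_sum => j; apply: differentiableZl.
  exact: smooth_differentiable (sF j).
by apply/funext => y; rewrite fct_sumE -row_sum_delta.
Qed.

Lemma smooth_coords_derive (F : X -> Y) x v j :
  (forall j, smooth (fun y => F y 0 j : R^o)) ->
  'd F x v 0 j = 'D_v (fun y => F y 0 j : R^o) x.
Proof.
move=> sF; have dF := smooth_coords_differentiable x sF.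
have dvF : derivable F x v := diff_derivable dF.
apply: (etrans (congr1 (fun M : Y => M 0 j) (esym (deriveE v dF)))).
apply: (etrans (congr1 (fun M : Y => M 0 j) (derive_mx dvF))).
by rewrite mxE.
Qed.

Lemma continuous_mx_entries p q (J : X -> 'M[R]_(p, q)) x :
  (forall i j, {for x, continuous (fun y => J y i j)}) -> {for x, continuous J}.
Proof.
move=> cJ; apply/(@cvgrPdist_le R 'M[R]_(p, q) _ (nbhs x)) => e e0.
have : \forall y \near x, forall ij : 'I_p * 'I_q, `|J x ij.1 ij.2 - J y ij.1 ij.2| <= e.
  apply: (@filter_forall X _ (fun (ij : 'I_p * 'I_q) y =>
    `|J x ij.1 ij.2 - J y ij.1 ij.2| <= e) (nbhs x)) => -[i j] /=.
  exact: (@cvgr_dist_le _ _ _ (nbhs x) _ _ _ (cJ i j) e e0).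
apply: filterS => y Jy.
rewrite [leLHS]/Num.Def.normr/= mx_normrE (bigmax_le _ (ltW e0))// => ij _.
by have := Jy ij; rewrite !mxE.
Qed.

Lemma smooth_coords_C1 (F : X -> Y) :
  (forall j, smooth (fun y => F y 0 j : R^o)) -> C1_on Omega F.
Proof.
move=> sF x _; split; first exact: smooth_coords_differentiable.
have cij i j : {for x, continuous (fun y => jacobian F y i j)}.
  rewrite (_ : (fun y => _) = 'D_(delta_mx 0 i) (fun y => F y 0 j : R^o)).
    exact: smooth_continuous (smooth_derive _ (sF j)) x.
  apply/funext => y.
  exact: (etrans (jacobianE _ _ _ _) (smooth_coords_derive _ _ _ sF)).
apply: continuous_mx_entries => i j; exact: cij.
Qed.

(** Differentiating a polynomial fills the first argument of its tensor, whereas [M] imposes its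
    condition on the last one; a transposition reconciles the two. *)
Lemma diag_M_update k (T : ('I_k.+1 -> X) -> Y) x v : symmetric_map T ->
  slice T v (fun=> x) = T [eta (fun=> x) with ord_max |-> v].
Proof.
move=> sT; rewrite /slice -[LHS](sT (tperm ord0 ord_max)); congr T.
apply/funext => i /=; case: tpermP => [->|->|/eqP i0 /eqP im].
- have [k0|k0] := eqVneq ord0 (ord_max : 'I_k.+1); first by rewrite -k0 prepend0.
  case: (unliftP ord0 (ord_max : 'I_k.+1)) => [l ->|E]; first by rewrite prependS.
  by rewrite E eqxx in k0.
- by rewrite eqxx prepend0.
- rewrite (negbTE im); case: (unliftP ord0 i) => [l ->|E]; first by rewrite prependS.
  by rewrite E eqxx in i0.
Qed.

Lemma solution_diag k (T : ('I_k -> X) -> Y) : M V k T -> solution Omega V (diag T).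
Proof.
move=> MT; have ST := M_Sym MT; have [mT sT] := ST.
have sd j : smooth (fun y => diag T y 0 j : R^o) by exact: (smooth_diag_coord j mT).
split; first exact: smooth_coords_C1.
move=> x _.
case: k T MT ST mT sT sd => [|k] T MT ST mT sT sd.
  apply: (@linfun_diff_mem _ _ _ _ _ _ 0); last exact: mem0v.
  move=> v; rewrite lfunE; apply/rowP => j.
  apply/esym/(etrans (smooth_coords_derive _ _ _ sd)).
  apply: (etrans (congr1 (@^~ x) (derive_diag_coord0 T j v))).
  by rewrite mxE.
pose f v := T [eta (fun=> x) with ord_max |-> v].
have lf : linear f by exact: mT.
apply: (@linfun_diff_mem _ _ _ _ _ _ (k.+1%:R *: linfun f)); last first.
  by rewrite rpredZ//; exact: MT.2.
move=> v; rewrite scale_lfunE linfunE//; apply/rowP => j.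
apply/esym/(etrans (smooth_coords_derive _ _ _ sd)).
apply: (etrans (congr1 (@^~ x) (derive_diag_coord j v ST))).
by rewrite /= mxE /diag_coord /diag diag_M_update.
Qed.

Lemma Sym0 k : Sym n m k (fun _ : 'I_k -> X => 0 : Y).
Proof. by split => // i x a v w; rewrite scaler0 addr0. Qed.

Lemma SymZD k (a : R) (T T' : ('I_k -> X) -> Y) : Sym n m k T -> Sym n m k T' ->
  Sym n m k (a *: T + T').
Proof.
move=> [mT sT] [mT' sT']; split.
  move=> i x b v w; rewrite !fctE mT mT' !scalerDr !scalerA addrACA.
  by rewrite [a * b]mulrC.
by move=> s x; rewrite !fctE sT sT'.
Qed.

Lemma M0 k : M V k (fun _ : 'I_k -> X => 0 : Y).
Proof.
case: k => [|k]; first exact: Sym0.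
split; first exact: Sym0.
move=> x; rewrite (_ : linfun _ = 0) ?mem0v//; apply/lfunP => v.

Qed.

Lemma MZD k (a : R) (T T' : ('I_k -> X) -> Y) : M V k T -> M V k T' ->
  M V k (a *: T + T').
Proof.
case: k T T' => [|k] T T'; first exact: SymZD.
move=> [ST VT] [ST' VT']; have STT := SymZD a ST ST'; split => // x.
rewrite (_ : linfun _ = a *: linfun (fun v => T [eta x with ord_max |-> v]) +
    linfun (fun v => T' [eta x with ord_max |-> v])).
  by rewrite rpredD ?rpredZ// ?VT ?VT'.
apply/lfunP => v; rewrite add_lfunE scale_lfunE !linfunE//.
- exact: ST'.1.
- exact: ST.1.
- exact: STT.1.
Qed.

Lemma calP_submod : is_vector_space (calP V).
Proof.
split.
  rewrite inE; exists 0%N, (fun=> fun=> 0); split => [k|]; first exact: M0.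
  by apply/funext => x; rewrite big_ord0.
move=> a p q; rewrite !inE => -[N [T [MT ->]]] [N' [T' [MT' ->]]].
pose U (N : nat) (T : forall k, ('I_k -> X) -> Y) k := if (k < N)%N then T k else fun=> 0.
have MU N0 T0 k : (forall k, M V k (T0 k)) -> M V k (U N0 T0 k).
  by move=> MT0; rewrite /U; case: ifP => // _; exact: M0.
have UE N0 T0 K x : (N0 <= K)%N ->
    \sum_(k < K) U N0 T0 k (fun=> x) = \sum_(k < N0) T0 k (fun=> x).
  move=> NK; rewrite (big_ord_widen K (fun k => T0 k (fun=> x)) NK) [RHS]big_mkcond.
  by apply: eq_bigr => k _; rewrite /U; case: ifP.
(* The families T and T' may be nonzero beyond the degrees N and N' occurring in
   p and q, hence the truncation U. *)
exists (maxn N N'), (fun k => a *: U N T k + U N' T' k); split.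
  by move=> k; apply: MZD; exact: MU.
apply/funext => x; rewrite big_split/= -scaler_sumr.
by rewrite !UE ?leq_maxl ?leq_maxr.
Qed.

Lemma calPZD (a : R) p q : calP V p -> calP V q -> calP V (a *: p + q).
Proof.
by move=> Pp Pq; have [_ /(_ a p q)] := calP_submod; rewrite !inE; apply.
Qed.

Lemma calP0 : calP V 0.
Proof. by have [] := calP_submod; rewrite inE. Qed.

Lemma calP_diag k (T : ('I_k -> X) -> Y) : M V k T -> calP V (diag T).
Proof.
move=> MT.
pose Z k' : ('I_k' -> X) -> Y := fun=> 0.
(* The family is zero except in degree [k]; k + 1 summands are needed to reach that degree. *)
exists k.+1, (@eqtype.dfwith _ _ Z k T); split.
  move=> i; have [->|ik] := eqVneq i k; first by rewrite eqtype.dfwith_in.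
  by rewrite eqtype.dfwith_out 1?eq_sym//; exact: M0.
apply/funext => x; rewrite big_ord_recr/= eqtype.dfwith_in big1 ?add0r// => i _.
by rewrite eqtype.dfwith_out// gt_eqF// ltEnat/= ltn_ord.
Qed.

Lemma calP_ind (P : (X -> Y) -> Prop) : P 0 ->
  (forall k (T : ('I_k -> X) -> Y) p, M V k T -> P p -> P (diag T + p)) ->
  forall p, calP V p -> P p.
Proof.
move=> P0 PD p [N [T [MT ->]]]; elim: N => [|N IH].
  by rewrite (_ : (fun x => _) = 0)//; apply/funext => x; rewrite big_ord0.
rewrite (_ : (fun x => _) = diag (T N) + (fun x => \sum_(k < N) T k (fun=> x))).
  exact: PD.
by apply/funext => x; rewrite big_ord_recr/= addrC.
Qed.

Lemma calP_solution p : calP V p -> solution Omega V p.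
Proof.
move: p; apply: calP_ind => [|k T p MT sp]; first exact: solution0.
have -> : diag T + p = 1 *: diag T + p by congr (_ + _); rewrite scale1r.
exact: (solutionZD openOmega 1 (solution_diag MT) sp).
Qed.

Lemma continuous_coord (F : X -> Y) x j : {for x, continuous F} ->
  {for x, continuous (fun y => F y 0 j)}.
Proof.
move=> cF; apply: (@continuous_comp _ _ _ F (fun M : Y => M 0 j)) => //.
exact: coord_continuous.
Qed.

Lemma distr_ofZD (a : R) (F G : X -> Y) :
  (forall x, Omega x -> {for x, continuous F}) ->
  (forall x, Omega x -> {for x, continuous G}) ->
  distr_of Omega (a *: F + G) = a *: distr_of Omega F + distr_of Omega G.
Proof.
move=> cF cG; apply/funext => phi; apply/rowP => j.
have [L cL] := test_compactly_supported (testfun_test phi).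
have cFj x : Omega x -> {for x, continuous (fun y => F y 0 j)}.
  by move=> /cF; exact: continuous_coord.
have cGj x : Omega x -> {for x, continuous (fun y => G y 0 j)}.
  by move=> /cG; exact: continuous_coord.
have := integral_rVZD a (test_mul_supported cFj cL) (test_mul_supported cGj cL).
rewrite !mxE => <-; congr integral_rV; apply/funext => x.
by rewrite !mxE; ring.
Qed.

Lemma calP_continuous p x : calP V p -> Omega x -> {for x, continuous p}.
Proof. by move=> /calP_solution[Cp _]; exact: C1_continuous. Qed.

Lemma test_iter_parts phi (h : X -> R^o) s : smooth h ->
  integral_rV (fun x => @iter_test R n Omega s phi x * h x) =
  (-1) ^+ size s * integral_rV (fun x => phi x * iter_derive s h x).
Proof.
elim: s h => [|v s IH] h sh; first by rewrite mul1r.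
rewrite /= (test_parts _ _ (smooth_C1_scalar sh)).
rewrite (IH _ (smooth_derive v sh)) (iter_derive_comm1 s v sh).
by rewrite exprS mulN1r mulNr.
Qed.

End polynomials.

(** * Distributional solutions are polynomials *)

Section distributional_solutions.
Variables (R : realType) (n m : nat) (Omega : set 'rV[R]_n).
Hypothesis openOmega : open Omega.
Hypothesis connectedOmega : connected Omega.
Hypothesis Omega0 : Omega !=set0.
Variable V : {vspace 'Hom('rV[R]_n, 'rV[R]_m)}.
Local Notation X := 'rV[R]_n.
Local Notation Y := 'rV[R]_m.
Local Notation D := (testfun Omega).
Implicit Types (phi : D) (F : D -> Y).

Lemma distr_of0 : distr_of Omega (0 : X -> Y) = 0.
Proof.
apply/funext => phi; apply/rowP => j; rewrite [LHS]mxE [RHS]mxE.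
transitivity (integral_rV (fun _ : X => 0 : R)); last exact: integral_rV0.
by congr integral_rV; apply/funext => x; rewrite mxE mulr0.
Qed.

Lemma distr_of_diag_iter k (T : ('I_k -> X) -> Y) phi (x : 'I_k -> X) :
  Sym n m k T ->
  distr_of Omega (diag T) (iter_test [seq x i | i <- enum 'I_k] phi) =
  testint phi *: ((-1) ^+ k * k`!%:R *: T x).
Proof.
move=> ST; apply/rowP => j; rewrite !mxE.
have sd : smooth (diag_coord T j) by apply: smooth_diag_coord; have [] := ST.
rewrite (test_iter_parts _ _ sd) iter_derive_diag_coord// size_map size_enum_ord.
have [L cL] := test_compactly_supported (testfun_test phi).
have c0 : compactly_supported L (fun _ : X => 0 : R).
  by split => // y; exact: cst_continuous.
have := integral_rVZD (k`!%:R * T x 0 j) cL c0.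
rewrite integral_rV0 addr0 => E.
transitivity ((-1) ^+ k * (k`!%:R * T x 0 j * integral_rV phi)).
  by congr (_ * _); rewrite -E; congr integral_rV; apply/funext => y; rewrite addr0 mulrC.
by rewrite /testint; ring.
Qed.

Lemma seq_enum_ord (s : seq X) k : size s = k ->
  s = [seq (fun i : 'I_k => nth 0 s i) i | i <- enum 'I_k].
Proof.
move=> <-; rewrite (map_comp (nth 0 s) (@nat_of_ord _)) val_enum_ord.
by rewrite -[LHS](mkseq_nth 0).
Qed.

(* If the derivatives of order k + 1 vanish, those of order k are constant, and
   these constants form a tensor a in M V k; subtracting the polynomial
   (-1)^k a(x, ..., x) / k! kills the derivatives of order k as well. *)
Lemma solution_of_vanishing_derivatives k F : Sigma_distr Omega V F ->
  (forall s phi, size s = k -> F (iter_test s phi) = 0) ->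
  exists2 p, calP V p & F = distr_of Omega p.
Proof.
elim: k F => [|k IH] F SF F0.
  exists 0; first exact: calP0.
  by rewrite distr_of0; apply/funext => phi; exact: (F0 [::]).
have [[lF _] _] := SF.
have [x0 Ox0] := Omega0.
have [rho rho0 x0O] := open_closed_ball openOmega Ox0.
have [beta [_ b0]] := bump_test rho0 x0O.
(* The constant values of the derivatives of order k are read off from a single bump with nonzero
   integral. In this form [a] is visibly in [M V k], and [aP] shows that it does not depend on the
   bump. *)
pose a := (testint beta)^-1 *: tensor F beta (k := k).
have aP s phi : size s = k ->
    F (iter_test s phi) = testint phi *: a (fun i => nth 0 s i).
  move=> sk; pose G psi := F (iter_test s psi).
  have linG (r : R) psi psi' : G (r *: psi + psi') = r *: G psi + G psi'.
    by rewrite /G iter_testZD lF.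
  have dG v psi : G (test_derive v psi) = 0.
    by rewrite /G -iter_test_rcons F0// size_rcons sk.
  have [c cG] := constant_functional linG dG openOmega connectedOmega Omega0.
  rewrite -/(G phi) cG; congr (_ *: _).
  rewrite /a /tensor fctE -seq_enum_ord// -/(G beta) cG scalerA mulVf ?scale1r//.
  by rewrite lt0r_neq0.
have Ma : M V k a.
  have := MZD (testint beta)^-1 (tensor_M beta k SF) (M0 V k).
  by rewrite (_ : _ + _ = a)//; apply/funext => y; rewrite !fctE addr0.
(* This inverts the factor (-1)^k k! of [distr_of_diag_iter], since (-1)^k is its own inverse. *)
pose e : R := (-1) ^+ k / k`!%:R.
have k0 : k`!%:R != 0 :> R by rewrite pnatr_eq0 -lt0n fact_gt0.
pose T : ('I_k -> X) -> Y := e *: a.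
have MT : M V k T.
  have := MZD e Ma (M0 V k).
  by rewrite (_ : _ + _ = T)//; apply/funext => y; rewrite !fctE addr0.
have Pd : calP V (diag T) by exact: calP_diag.
have Sd := distr_of_solution openOmega (calP_solution openOmega Pd).
pose F' := -1 *: distr_of Omega (diag T) + F.
have SF' : Sigma_distr Omega V F'.
  have [_ /(_ (-1) (distr_of Omega (diag T)) F)] := Sigma_distr_submod Omega V.
  by rewrite !inE; apply.
have [|p Pp pE] := IH F' SF'.
  move=> s phi sk; rewrite /F' !fctE aP// {1}(seq_enum_ord sk).
  rewrite distr_of_diag_iter; last exact: M_Sym MT.
  rewrite scaleN1r; apply/eqP; rewrite addrC subr_eq0; apply/eqP.
  congr (_ *: _); rewrite /T /e fctE scalerA -[LHS]scale1r; congr (_ *: _).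
  by rewrite mulrACA divff// mulr1 -expr2 sqrr_sign.
exists (1 *: diag T + p); first exact: calPZD.
have cont q : calP V q -> forall x, Omega x -> {for x, continuous q}.
  by move=> Pq x; exact: (calP_continuous openOmega Pq).
rewrite distr_ofZD; [|exact: cont..].
by rewrite -pE /F' scale1r scaleN1r addrA subrr add0r.
Qed.

Lemma distr_of_calP N F : M V N = [set 0] -> Sigma_distr Omega V F ->
  exists2 p, calP V p & F = distr_of Omega p.
Proof.
move=> MN SF; apply: (@solution_of_vanishing_derivatives N) => // s phi sN.
have T0 : tensor F phi (k := N) = 0 by have := tensor_M phi N SF; rewrite MN.
have := congr1 (@^~ (fun i : 'I_N => nth 0 s i)) T0.
by rewrite /= /tensor -seq_enum_ord.
Qed.

(** If h(x) > 0, then h is positive on a small cube at x and a bump supported there has a positive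
    integral against h. This is applied to h and to -h. *)
Lemma integral_test_eq0 (h : X -> R^o) : (forall x, Omega x -> {for x, continuous h}) ->
  (forall phi, integral_rV (fun x => phi x * h x) = 0) ->
  forall x, Omega x -> h x = 0.
Proof.
have pos (g : X -> R^o) x : (forall y, Omega y -> {for y, continuous g}) ->
    (forall phi, integral_rV (fun y => phi y * g y) = 0) -> Omega x -> g x <= 0.
  move=> cg g0 Ox; rewrite leNgt; apply/negP => gx.
  have : \forall y \near x, Omega y /\ 0 < g y.
    apply: filterI; first exact: near_Omega.
    exact: (cvgr_gt _ (cg x Ox)).
  move=> /nbhs_ballP[r /= r0 xr].
  have r20 : 0 < r / 2 by rewrite divr_gt0.
  have rball y : `|y - x| <= r / 2 -> ball x r y.
    by move=> yx; rewrite -ball_normE/= distrC; lra.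
  have [beta [betaE b0]] := bump_test r20 (fun y yx => (xr y (rball y yx)).1).
  have [L cL] := test_compactly_supported (testfun_test beta).
  have : 0 < integral_rV (fun y => beta y * g y); last by rewrite g0 ltxx.
  apply: (integral_rV_gt0 (x := x) (test_mul_supported cg cL)) => [y|].
    have [yx|yx] := leP (r / 2) `|y - x|.
      by rewrite betaE bump_eq0// mul0r.
    rewrite mulr_ge0//; first by rewrite betaE bump_ge0.
    by apply: ltW; exact: (xr y (rball y (ltW yx))).2.
  by rewrite mulr_gt0// betaE bump_gt0// subrr normr0.
move=> ch h0 x Ox; apply/eqP; rewrite eq_le (pos h x ch h0 Ox)/= -oppr_le0.
apply: (pos (fun y => - h y)) => // [y Oy|phi].
  exact: (cvgN (ch y Oy)).
have [L cL] := test_compactly_supported (testfun_test phi).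
have cph := test_mul_supported ch cL.
have c0 : compactly_supported L (fun _ : X => 0 : R).
  by split => // y; exact: cst_continuous.
have := integral_rVZD (-1) cph c0; rewrite h0 mulr0 integral_rV0 addr0 => E.
by rewrite -[RHS]E; congr integral_rV; apply/funext => y; ring.
Qed.

End distributional_solutions.

(** * Finite dimension *)

Section finite_dimension.
Variable R : realType.

(** In contrast with [finite_dimensional], the generators may lie outside [S]; monomials can then be
    used although they need not belong to [calP V]. *)
Definition spanned (E : lmodType R) (S : set E) :=
  exists (I : finType) (g : I -> E), forall u, S u ->
    exists c : I -> R, u = \sum_i c i *: g i.

Lemma submod_sum (E : lmodType R) (S : set E) (I : Type) (r : seq I) (c : I -> R)
  (g : I -> E) : is_vector_space S -> (forall i, S (g i)) -> S (\sum_(i <- r) c i *: g i).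
Proof.
move=> [S0 SD] Sg; elim: r => [|i r IH].
  by rewrite big_nil; move: S0; rewrite inE.
by rewrite big_cons; have /(_ (c i) (g i) (\sum_(i <- r) c i *: g i)) := SD;
  rewrite !inE; apply.
Qed.

(** Take a subspace of maximal dimension among those contained in [W]: adjoining a vector of [W]
    cannot enlarge it. *)
Lemma set_vspace d (W : set 'rV[R]_d) : is_vector_space W ->
  exists U : {vspace 'rV[R]_d}, forall v, W v <-> v \in U.
Proof.
move=> [W0 WD].
pose Q k := `[< exists2 U : {vspace 'rV[R]_d}, (forall v, v \in U -> W v) & \dim U = k >].
have Q0 : exists k, Q k.
  exists 0%N; apply/asboolP; exists 0%VS; last exact: dimv0.
  by move=> v; rewrite memv0 => /eqP ->; move: W0; rewrite inE.
have Qd k : Q k -> (k <= d)%N.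
  move=> /asboolP[U _ <-]; have := dimvS (subvf U).
  by rewrite dimvf /dim/= mul1n.
case: (ex_maxnP Q0 Qd) => k /asboolP[U UW dU] kmax; exists U => v; split; last exact: UW.
move=> Wv; pose U' := (U + <[v]>)%VS.
have U'W u : u \in U' -> W u.
  move=> /memv_addP[u1 u1U [_ /vlineP[a ->] ->]]; rewrite addrC.
  by have /(_ a v u1) := WD; rewrite !inE; apply => //; exact: UW.
have UU' : (U <= U')%VS by exact: addvSl.
have /kmax dU' : Q (\dim U') by apply/asboolP; exists U'.
have /eqP -> : U == U' by rewrite eqEdim UU' dU.
exact: (subvP (addvSr U <[v]>)) (memv_line v).
Qed.

(** The preimage of [S] under the map from coefficients to linear combinations is a subspace of a
    coordinate space, and the image of a basis of it lies in [S] and spans [S]. *)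
Lemma spanned_finite_dimensional (E : lmodType R) (S : set E) :
  is_vector_space S -> spanned S -> finite_dimensional S.
Proof.
move=> VS [I [g gS]]; have [S0 SD] := VS.
pose f (v : 'rV[R]_#|I|) : E := \sum_i v 0 (enum_rank i) *: g i.
have fD a u v : f (a *: u + v) = a *: f u + f v.
  rewrite /f scaler_sumr -big_split/=; apply: eq_bigr => i _.
  by rewrite !mxE scalerDl scalerA.
pose W := [set v | S (f v)].
have [U UW] : exists U : {vspace 'rV[R]_#|I|}, forall v, W v <-> v \in U.
  apply: set_vspace; split.
    rewrite inE /W/= /f big1; first by move: S0; rewrite inE.
    by move=> i _; rewrite mxE scale0r.
  move=> a u v; rewrite !inE /W/= fD => Su Sv.
  by have /(_ a (f u) (f v)) := SD; rewrite !inE; apply.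
exists (\dim U), (fun i => f (vbasis U)`_i); split.
  move=> i; apply/UW; apply: (vbasis_mem (U := U)); apply: mem_nth.
  by rewrite size_tuple.
move=> u Su; have [c uE] := gS _ Su.
pose v : 'rV[R]_#|I| := \row_i c (enum_val i).
have uv : u = f v.
  by rewrite uE; apply: eq_bigr => i _; rewrite mxE enum_rankK.
have vU : v \in U by apply/UW; rewrite /W/= -uv.
exists (fun i => coord (vbasis U) i v).
rewrite uv {1}(coord_vbasis vU).
have f0 : f 0 = 0 by rewrite /f big1// => i _; rewrite mxE scale0r.
elim/big_rec2 : _ => [//|i x y _ <-]; exact: fD.
Qed.

Lemma finite_dimensional_image (E E' : lmodType R) (S : set E) (L : E -> E') :
  is_vector_space S -> (forall a u v, S u -> S v -> L (a *: u + v) = a *: L u + L v) ->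
  finite_dimensional S -> finite_dimensional (L @` S).
Proof.
move=> VS LD [d [b [bS bspan]]]; exists d, (L \o b); split.
  by move=> i; exists (b i).
move=> _ [u Su <-]; have [c ->] := bspan _ Su; exists c.
have S0 : S 0 by have [] := VS; rewrite inE.
have L0 : L 0 = 0.
  by have := LD (-1) 0 0 S0 S0; rewrite scaler0 addr0 scaleN1r addNr.
elim: (index_enum _) => [|i r IH]; first by rewrite !big_nil.
by rewrite !big_cons LD ?IH//; exact: submod_sum.
Qed.

Lemma spanned_add (E : lmodType R) (S1 S2 : set E) : spanned S1 -> spanned S2 ->
  spanned [set u | exists u1 u2, [/\ S1 u1, S2 u2 & u = u1 + u2]].
Proof.
move=> [I [g gS]] [J [h hS]].
exists (I + J)%type, (fun ij => match ij with inl i => g i | inr j => h j end).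
move=> _ [u1 [u2 [/gS[c ->] /hS[c' ->] ->]]].
exists (fun ij => match ij with inl i => c i | inr j => c' j end).
by rewrite big_sumType.
Qed.

(** The coefficients of d + 1 vectors in d generators form a (d + 1) x d matrix, which has a nonzero
    left kernel. *)
Lemma finite_dimensional_dependent (E : lmodType R) (S : set E) :
  finite_dimensional S -> exists d, forall u : 'I_d.+1 -> E, (forall i, S (u i)) ->
    exists2 c : 'I_d.+1 -> R, (exists i, c i != 0) & \sum_i c i *: u i = 0.
Proof.
move=> [d [b [_ bspan]]]; exists d => u uS.
have /choice[C CE] : forall i, exists c : 'I_d -> R, u i = \sum_j c j *: b j.
  by move=> i; exact: bspan.
pose A : 'M[R]_(d.+1, d) := \matrix_(i, j) C i j.
have A0 : kermx A != 0.
  rewrite kermx_eq0 /row_free; apply/negP => /eqP rA.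
  by have := rank_leq_col A; rewrite rA ltnn.
have /rowV0Pn[v /sub_kermxP vA v0] := A0.
exists (fun i => v 0 i).
  by have /rV0Pn[i vi] := v0; exists i.
under eq_bigr do rewrite CE scaler_sumr.
rewrite exchange_big/= big1// => j _.
under eq_bigr do rewrite scalerA.
rewrite -scaler_suml (_ : \sum_i _ = (v *m A) 0 j); first by rewrite vA mxE scale0r.
by rewrite mxE; apply: eq_bigr => i _; rewrite mxE.
Qed.

End finite_dimension.

(** * The dimension of the space of polynomial solutions *)

Section polynomial_dimension.
Variables (R : realType) (n m : nat).
Variable V : {vspace 'Hom('rV[R]_n, 'rV[R]_m)}.
Local Notation X := 'rV[R]_n.
Local Notation Y := 'rV[R]_m.

(** The generators built by the induction are the monomials x_(i_1) ... x_(i_k) times the basis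
    vectors of R^m, with repetitions. *)
Lemma spanned_diag k :
  spanned [set p : X -> Y | exists2 T : ('I_k -> X) -> Y, multilinear T & p = diag T].
Proof.
elim: k => [|k [I [g gS]]].
  exists 'I_m, (fun j => fun=> delta_mx 0 j) => _ [T _ ->].
  exists (fun j => T (fun=> 0) 0 j); apply/funext => x.
  rewrite fct_sumE /diag (diag0 T (fun=> x) (fun=> 0)) [LHS]row_sum_delta.
  by [].
exists ('I_n * I)%type, (fun (il : 'I_n * I) (x : X) => x 0 il.1 *: g il.2 x) => _ [T mT ->].
have /choice[c cE] : forall i : 'I_n, exists c : I -> R,
    diag (slice T (delta_mx 0 i)) = \sum_l c l *: g l.
  by move=> i; apply: gS; exists (slice T (delta_mx 0 i)) => //; exact: slice_multilinear.
exists (fun il => c il.1 il.2); apply/funext => x.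
rewrite diagS// fct_sumE.
transitivity (\sum_i \sum_l c i l *: (x 0 i *: g l x)).
  apply: eq_bigr => i _; rewrite cE fct_sumE scaler_sumr.
  by apply: eq_bigr => l _; rewrite fctE !scalerA mulrC.
by rewrite pair_big; apply: eq_bigr => -[i l] _.
Qed.

Lemma spanned_calP_lt N : spanned [set p : X -> Y |
  exists2 T : forall k, ('I_k -> X) -> Y, (forall k, multilinear (T k)) &
    p = fun x => \sum_(k < N) T k (fun=> x)].
Proof.
elim: N => [|N IH].
  exists void, (fun=> 0) => _ [T _ ->]; exists (fun=> 0).
  rewrite big1; last by case.
  by apply/funext => x; rewrite big_ord0.
have [I [g gS]] := spanned_add IH (spanned_diag N).
exists I, g => _ [T mT ->]; apply: gS.
exists (fun x => \sum_(k < N) T k (fun=> x)), (diag (T N)); split.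
- by exists T.
- by exists (T N).
- by apply/funext => x; rewrite big_ord_recr.
Qed.

Lemma finite_dimensional_calP N : (forall k, (N <= k)%N -> M V k = [set 0]) ->
  finite_dimensional (calP V).
Proof.
move=> MN; apply: spanned_finite_dimensional; first exact: calP_submod.
have [I [g gS]] := spanned_calP_lt N; exists I, g => _ [N' [T [MT ->]]]; apply: gS.
(* [T'] vanishes from degree N' on by truncation and from degree N on by [MN], so its sums below N
   and below N' both equal the sum below their maximum. *)
pose T' k : ('I_k -> X) -> Y := if (k < N')%N then T k else fun=> 0.
have MT' k : M V k (T' k) by rewrite /T'; case: ifP => _ //; exact: M0.
exists T'; first by move=> k; have [] := M_Sym (MT' k).
have trunc K N0 x : (N0 <= K)%N -> (forall k, (N0 <= k)%N -> T' k = fun=> 0) ->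
    \sum_(k < K) T' k (fun=> x) = \sum_(k < N0) T' k (fun=> x).
  move=> NK T0; rewrite (big_ord_widen K (fun k => T' k (fun=> x)) NK) [RHS]big_mkcond.
  by apply: eq_bigr => k _; case: ltnP => // /T0 ->.
apply/funext => x; rewrite -(trunc (maxn N N') N x) ?leq_maxl//; last first.
  by move=> k /MN E; have := MT' k; rewrite E.
rewrite (trunc _ N') ?leq_maxr//; last first.
  by move=> k; rewrite leqNgt /T' => /negbTE ->.
by apply: eq_bigr => k _; rewrite /T' ltn_ord.
Qed.

Lemma delta_fin_bound : (delta V < +oo)%E <->
  exists N, forall k, (N <= k)%N -> M V k = [set 0].
Proof.
split.
  rewrite /delta; set S := [set _ | _ in _] => Soo.
  have [r Sr] : exists r : R, forall x, S x -> (x <= r%:E)%E.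
    move: Soo; case E : (ereal_sup S) => [r| |] // _.
      by exists r => x Sx; rewrite -E; exact: ereal_sup_ubound.
    exists 0 => x Sx; apply: (@le_trans _ _ (ereal_sup S)); last by rewrite E leNye.
    exact: ereal_sup_ubound.
  exists (Num.bound `|r|) => k rk; apply: contrapT => Mk.
  have : S (k%:R)%:E by exists k.
  move=> /Sr; rewrite lee_fin leNgt => /negP; apply.
  apply: le_lt_trans (ler_norm r) _.
  by apply: lt_le_trans (archi_boundP (normr_ge0 r)) _; rewrite ler_nat.
move=> [N MN]; apply: (@le_lt_trans _ _ (N%:R)%:E); last exact: ltry.
apply: ge_ereal_sup => _ [k /= Mk <-]; rewrite lee_fin ler_nat leqNgt.
by apply/negP => /ltnW/MN.
Qed.


Lemma near_iter_derive s (f g : X -> R^o) (x : X) :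
  (\forall y \near x, f y = g y) ->
  \forall y \near x, iter_derive s f y = iter_derive s g y.
Proof.
move=> fg; elim: s => [//|v s IH] /=.
by move/near_join : IH; apply: filterS => y; exact: near_eq_derive.
Qed.

Lemma iter_derive_sum (I : Type) (r : seq I) (c : I -> R) (f : I -> X -> R^o) s x :
  (forall i, smooth (f i)) ->
  iter_derive s (fun y => \sum_(i <- r) c i * f i y : R^o) x =
  \sum_(i <- r) c i * iter_derive s (f i) x.
Proof.
move=> sf; have scf i : smooth (fun y => c i * f i y : R^o).
  by apply: smoothM => //; exact: smooth_cst.
elim: r => [|i r IH].
  have E : (fun y => \sum_(i <- [::]) c i * f i y : R^o) = fun=> 0.
    by apply/funext => y; rewrite big_nil.
  by rewrite E iter_derive0 big_nil.
have E : (fun y => \sum_(j <- i :: r) c j * f j y : R^o) =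
    fun y => c i * f i y + \sum_(j <- r) c j * f j y.
  by apply/funext => y; rewrite big_cons.
rewrite E iter_deriveD//; last exact: smooth_sum.
by rewrite iter_deriveZ// IH big_cons.
Qed.

(** The relation is required only near one point, since derivatives depend only on the germ. [i] is
    chosen of largest degree among the indices with nonzero coefficient, and injectivity of [deg]
    makes every other such degree strictly smaller. *)
Lemma diag_combination_eq0 d (deg : 'I_d -> nat)
    (T : forall i, ('I_(deg i) -> X) -> Y) (c : 'I_d -> R) (x0 : X) :
  injective deg -> (forall i, Sym n m (deg i) (T i)) -> (exists i, c i != 0) ->
  (\forall x \near x0, \sum_i c i *: diag (T i) x = 0) -> exists i, T i = 0.
Proof.
move=> dinj ST [i0 ci0] near0.
case: (@arg_maxnP _ i0 (fun i => c i != 0) deg ci0) => i ci imax.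
exists i; apply/funext => y; apply/rowP => j; rewrite mxE.
pose s := [seq y l | l <- enum 'I_(deg i)].
have sT l : smooth (diag_coord (T l) j) by apply: smooth_diag_coord; have [] := ST l.
have nearj : \forall x \near x0,
    (\sum_l c l * diag_coord (T l) j x : R^o) = (fun=> 0) x.
  apply: filterS near0 => x /(congr1 (fun M : Y => M 0 j)); rewrite summxE mxE => E.
  by rewrite -[RHS]E; apply: eq_bigr => l _; rewrite mxE.
have := nbhs_singleton (near_iter_derive s nearj).
rewrite iter_derive0 iter_derive_sum// (bigD1 i)//= big1 => [|l li].
  rewrite addr0 /s iter_derive_diag_coord// => /eqP.
  by rewrite !mulf_eq0 (negbTE ci) pnatr_eq0 eqn0Ngt fact_gt0/= => /eqP.
have [->|cl] := eqVneq (c l) 0; first by rewrite mul0r.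
rewrite iter_derive_diag_coord_gt ?mulr0//.
rewrite size_map size_enum_ord ltn_neqAle (imax l cl : (deg l <= deg i)%N) andbT.
by apply: contra li => /eqP/dinj ->.
Qed.

(** [L] stands for restriction to [Omega] in the C^1 case and for [distr_of] in the distributional
    one; it only has to be linear on [calP V] and to determine the values on [Omega]. *)
Lemma delta_finite (Omega : set X) (E : lmodType R) (S : set E) (L : (X -> Y) -> E) :
  open Omega -> Omega !=set0 -> finite_dimensional S ->
  (forall p, calP V p -> S (L p)) ->
  (forall a p q, calP V p -> calP V q -> L (a *: p + q) = a *: L p + L q) ->
  (forall p, calP V p -> L p = 0 -> forall x, Omega x -> p x = 0) ->
  (delta V < +oo)%E.
Proof.
move=> oO [x0 Ox0] fS LS LD Linj; apply/delta_fin_bound; apply: contrapT => noN.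
have [d dep] := finite_dimensional_dependent fS.
have /choice[g gP] : forall N, exists k, (N <= k)%N /\ M V k <> [set 0].
  move=> N; apply: contrapT => noK; apply: noN; exists N => k Nk.
  by apply: contrapT => Mk; apply: noK; exists k.
(* If [delta] is infinite, nonzero spaces [M V k] occur in arbitrarily high degrees, and d + 1
   distinct ones give d + 1 elements of [S], which must be dependent. *)
have [deg degM degS] : exists2 deg : nat -> nat,
    (forall i, M V (deg i) <> [set 0]) & (forall i, (deg i < deg i.+1)%N).
  exists (fix deg i := if i is i'.+1 then g (deg i').+1 else g 0%N).
    by case=> [|i]; [exact: (gP 0%N).2|exact: (gP _.+1).2].
  by move=> i; exact: (gP _.+1).1.
have dinj : injective (fun i : 'I_d.+1 => deg i).
  have dlt : {homo deg : i j / (i < j)%N} by exact: (homo_ltn ltn_trans degS).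
  move=> i j dij; apply: ord_inj.
  by case: (ltngtP i j) => // /dlt; rewrite [deg i]dij ltnn.
have degT i : exists T : ('I_(deg i) -> X) -> Y, M V (deg i) T /\ T <> 0.
  apply: contrapT => noT; apply: (degM i); apply/seteqP; split => [T MT|_ ->].
    by apply: contrapT => T0; apply: noT; exists T.
  exact: M0.
pose T (i : 'I_d.+1) := projT1 (cid (degT i)).
have MT (i : 'I_d.+1) : M V (deg i) (T i) by rewrite /T; case: cid => /= T' [].
have T0 (i : 'I_d.+1) : T i <> 0 by rewrite /T; case: cid => /= T' [].
have PT (i : 'I_d.+1) : calP V (diag (T i)) by exact: calP_diag.
have [c c0 cE] := dep (fun i => L (diag (T i))) (fun i => LS _ (PT i)).
have Psum : calP V (\sum_i c i *: diag (T i)) by apply: submod_sum => //; exact: calP_submod.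
have Lsum : L (\sum_i c i *: diag (T i)) = 0.
  rewrite -cE; have L0 : L 0 = 0.
    by have := LD (-1) 0 0 (calP0 V) (calP0 V); rewrite scaler0 addr0 scaleN1r addNr.
  elim: (index_enum _) => [|i r IH]; first by rewrite !big_nil.
  rewrite !big_cons LD ?IH//; apply: submod_sum => //; exact: calP_submod.
have [|i Ti] := @diag_combination_eq0 _ (fun i : 'I_d.+1 => deg i) T c x0 dinj
  (fun i => M_Sym (MT i)) c0; last exact: T0 Ti.
apply: filterS (near_Omega oO Ox0) => x Ox.
by have := Linj _ Psum Lsum x Ox; rewrite fct_sumE.
Qed.

End polynomial_dimension.

Theorem theorem1 (R : realType) (n m : nat) (n_gt0 : (0 < n)%N)
    (m_gt0 : (0 < m)%N) (Omega : set 'rV[R]_n) (openOmega : open Omega)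
    (V : {vspace 'Hom('rV[R]_n, 'rV[R]_m)}) :
  (is_vector_space (Sigma_C1 Omega V) /\
   (Omega !=set0 -> connected Omega ->
    (finite_dimensional (Sigma_C1 Omega V) <-> (delta V < +oo)%E) /\
    ((delta V < +oo)%E -> Sigma_C1 Omega V = [set sigL Omega p | p in calP V])))
  /\
  (is_vector_space (Sigma_distr Omega V) /\
   (Omega !=set0 -> connected Omega ->
    (finite_dimensional (Sigma_distr Omega V) <-> (delta V < +oo)%E) /\
    ((delta V < +oo)%E ->
      Sigma_distr Omega V = [set distr_of Omega p | p in calP V]))).
Proof.
have contP p : calP V p -> forall x, Omega x -> {for x, continuous p}.
  by move=> Pp x; exact: (calP_continuous openOmega Pp).
have distrD a p q : calP V p -> calP V q ->
    distr_of Omega (a *: p + q) = a *: distr_of Omega p + distr_of Omega q.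
  by move=> Pp Pq; apply: distr_ofZD; exact: contP.
have sigLD a (p q : 'rV[R]_n -> 'rV[R]_m) :
    sigL Omega (a *: p + q) = a *: sigL Omega p + sigL Omega q by [].
have distr_inj (F : 'rV[R]_n -> 'rV[R]_m) : (forall x, Omega x -> {for x, continuous F}) ->
    distr_of Omega F = 0 -> forall x, Omega x -> F x = 0.
  move=> cF F0 x Ox; apply/rowP => j; rewrite mxE.
  apply: (@integral_test_eq0 _ _ _ openOmega (fun y => F y 0 j)) => // [y Oy|phi].
    exact/continuous_coord/cF.
  have := congr1 (fun G : testfun Omega -> 'rV[R]_m => G phi 0 j) F0.
  by rewrite /= !mxE.
have SC1 F : solution Omega V F -> Sigma_C1 Omega V (sigL Omega F).
  by move=> sF; exists F.
have distr_eq : Omega !=set0 -> connected Omega -> (delta V < +oo)%E ->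
    Sigma_distr Omega V = [set distr_of Omega p | p in calP V].
  move=> nO cO /delta_fin_bound[N MN]; apply/seteqP; split => [F SF|_ [p Pp <-]].
    have [p Pp ->] := distr_of_calP openOmega cO nO (MN N (leqnn N)) SF.
    by exists p.
  exact: (distr_of_solution openOmega (calP_solution openOmega Pp)).
have C1_eq : Omega !=set0 -> connected Omega -> (delta V < +oo)%E ->
    Sigma_C1 Omega V = [set sigL Omega p | p in calP V].
  move=> nO cO dV; apply/seteqP; split => [_ [F sF <-]|_ [p Pp <-]]; last first.
    exact/SC1/calP_solution.
  have := distr_of_solution openOmega sF; rewrite (distr_eq nO cO dV) => -[p Pp pF].
  exists p => //; apply/funext => -[x xO]; rewrite /sigL/=.
  have Ox : Omega x by rewrite inE in xO.
  have cF y : Omega y -> {for y, continuous F} by apply: C1_continuous; have [] := sF.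
  apply/eqP; rewrite -subr_eq0; apply/eqP.
  (* [F] and [p] define the same distribution, so their continuous difference vanishes on
     [Omega]. *)
  have := @distr_inj (-1 *: F + p) _ _ x Ox.
  rewrite !fctE scaleN1r addrC; apply.
  - by move=> y Oy; exact: (cvgD (cvgZ (cvg_cst _) (cF y Oy)) (contP p Pp y Oy)).
  - by rewrite distr_ofZD ?pF ?scaleN1r ?addNr//; exact: contP.
split; split.
- split.
    by rewrite inE; exists 0 => //; exact: solution0.
  move=> a u v; rewrite !inE => -[F sF <-] [G sG <-].
  exists (a *: F + G); first exact: (solutionZD openOmega a sF sG).
  exact: sigLD.
- move=> nO cO; split; last exact: C1_eq.
  split=> [fS|dV].
    apply: (delta_finite (L := sigL Omega) openOmega nO fS) => [p Pp|//|p Pp p0 x Ox].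
      exact/SC1/calP_solution.
    have xO : x \in Omega by rewrite inE.
    exact: (congr1 (fun f => f (exist _ x xO)) p0).
  rewrite C1_eq//; apply: finite_dimensional_image => //; first exact: calP_submod.
  by have /delta_fin_bound[N] := dV; exact: finite_dimensional_calP.
- exact: Sigma_distr_submod.
- move=> nO cO; split; last exact: distr_eq.
  split=> [fS|dV].
    apply: (delta_finite (L := distr_of Omega) openOmega nO fS) => [p Pp|a p q|p Pp p0].
    + exact: (distr_of_solution openOmega (calP_solution openOmega Pp)).
    + exact: distrD.
    + exact: distr_inj (contP _ Pp) p0.
  rewrite distr_eq//; apply: finite_dimensional_image => //; first exact: calP_submod.
  by have /delta_fin_bound[N] := dV; exact: finite_dimensional_calP.
Qed.
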